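(* Let $L$ be a link diagram that is quasi-alternating at a crossing $c$, and let $L'$ be the link obtained from $L$ by replacing the quasi-alternating crossing $c$ by a reduced alternating connected tangle diagram $T$ of the same type as $c$. If the Jones polynomial $V_L(t)$ has no gaps, then $V_{L'}(t)$ has no gaps.
   Context: Links are in $S^3$ and are represented by planar diagrams. For a crossing $c$ of an unoriented link diagram $L$, $L_0$ and $L_\infty$ denote the two diagrams obtained by smoothing $c$ ($L_0$ is the $A$-smoothing and $L_\infty$ the $A^{-1}$-smoothing in the Kauffman bracket relation $\langle L\rangle=A\langle L_0\rangle+A^{-1}\langle L_\infty\rangle$; also $\langle O\rangle=1$ and $\langle O\cup L\rangle=(-A^2-A^{-2})\langle L\rangle$). The Jones polynomial of an oriented link is $V_L(t)=(-A^3)^{-w(L)}\langle L\rangle$ evaluated at $A^4=t^{-1}$, where $w(L)$ is the writhe. The determinant is $\det(L)=|V_L(-1)|$. A Jones polynomial has no gap if it has the form $\sum_{i=n}^{m}c_it^i$ with indices increasing by $1$ ($n,m$ both integers or both half-integers) and $c_i\neq 0$ for all $n\le i\le m$; this property does not depend on the orientation of the link, since a change of orientation multiplies $V_L$ by a power of $t$ up to sign. Quasi-alternating links: the set $\mathcal{Q}$ is the smallest set of links such that (i) the unknot is in $\mathcal{Q}$; (ii) if a link $L$ has a diagram containing a crossing $c$ such that both smoothings $L_0,L_\infty$ at $c$ belong to $\mathcal{Q}$, $\det(L_0),\det(L_\infty)\ge 1$ and $\det(L)=\det(L_0)+\det(L_\infty)$, then $L\in\mathcal{Q}$; in this case one says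 that (the diagram of) $L$ is quasi-alternating at $c$ and that $c$ is a quasi-alternating crossing. Tangles: a tangle is a proper embedding of a disjoint union of 2 arcs and possibly some loops in a ball $B^3$, with the endpoints of the arcs at 4 fixed boundary points; it is represented by a planar diagram in a disk. It is connected if it is represented by a connected diagram (such a diagram is used). A crossing of a link diagram is nugatory if some simple closed curve in the projection plane meets the diagram only at that crossing, crossing it transversally between opposite regions. The numerator and denominator closures of $T$ are the two link diagrams obtained by joining the endpoints of $T$ in pairs by simple arcs outside the disk. A crossing of $T$ is nugatory in $T$ if it is nugatory in both closures of $T$; $T$ is reduced if it has no nugatory crossings. Tait graph and type: colour the regions of a connected link diagram in checkerboard fashion. The Tait graph has one vertex for each shaded region and one edge for each crossing, joining the shaded regions that meet there. An edge is positive if the $A$-smoothing of its crossing merges the two shaded corners at the crossing, and negative if the $A^{-1}$-smoothing does. For a tangle diagram in a disk, checkerboard coloured so that two opposite boundary arcs of the disk are shaded, the Tait graph is defined the same way. With a given colouring, an alternating connected tangle has all edges of one sign and is called positive or negative accordingly. Given a checkerboard colouring of $L$, let $e$ be the edge corresponding to $c$. Replacing $c$ by $T$ means removing a small disk around $c$ and inserting $T$, the colouring of $T$ being induced by that of $L$ outside the disk. The alternating tangle $T$ is of the same type as $c$ (extends $c$) if $T$ is positive when $e$ is positive, and negative when $e$ is negative. This does not depend on which of the two checkerboard colourings is chosen. *)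

(* Defs.v *)
From Stdlib Require Import Relations.
From mathcomp Require Import all_boot all_order all_algebra all_field.

Set Implicit Arguments.
Unset Strict Implicit.
Unset Printing Implicit Defensive.

Import Order.TTheory GRing.Theory Num.Theory.

(* A graph drawn on an oriented sphere is given by its vertices; a vertex is
   the list of the labels of the edges around it, in counterclockwise order.
   Each label occurs exactly twice, once for each end of the edge. *)
Definition code := seq (seq nat).

Definition well_labelled (V : code) : bool :=
  all (fun l => count_mem l (flatten V) == 2) (flatten V).

(* A dart is an end of an edge.  The dart (i, j) also names the corner at
   vertex i between the darts (i, j) and (i, j + 1). *)
Definition dart (V : code) : finType :=
  {i : 'I_(size V) & 'I_(size (nth [::] V i))}.

Section Darts.
Variable V : code.
Implicit Type d : dart V.

Definition vtx d : nat := tag d.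
Definition pos d : nat := tagged d.
Definition label d : nat := nth 0 (nth [::] V (vtx d)) (pos d).

Definition node d : dart V := Tagged _ (ordS (tagged d)).
Definition nodeV d : dart V := Tagged _ (ord_pred (tagged d)).

(* the other end of the same edge *)
Definition edge d : dart V :=
  odflt d [pick d' | (d' != d) && (label d' == label d)].

(* Walking along the boundary of a region, kept on the left, leads from the
   corner d to the corner face d. *)
Definition face d : dart V := nodeV (edge d).

(* At a vertex of even degree, the dart opposite to d. *)
Definition across d : dart V :=
  iter (size (nth [::] V (vtx d)))./2 node d.

Definition components : nat :=
  n_comp [rel d d' | (d' == node d) || (d' == edge d)] (dart V).

(* Euler's formula |V| - |E| + |F| = 2 |C|, with #|dart V| = 2 |E|.  For a
   disconnected graph it says that each component is spherical; faces are then
   those of the components taken separately. *)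
Definition planar : bool :=
  size V + fcard edge (dart V) + fcard face (dart V)
    == #|dart V| + components.*2.

(* kappa d tells whether the corner d is shaded; the regions on the two sides
   of an edge get different colours. *)
Definition checkerboard (kappa : dart V -> bool) : Prop :=
  forall d, kappa (face d) = kappa d /\ kappa (node d) = ~~ kappa d.

(* Some simple closed curve passes through vertex i between opposite corners
   and is otherwise contained in a single region; the graph is supposed to be
   connected, as the closures of a connected tangle are. *)
Definition nugatory (i : nat) : bool :=
  [exists d, (vtx d == i) && fconnect face d (across d)].

End Darts.

(* The crossing (a, b, c, d) has its edges listed counterclockwise; a and c are
   the two ends of the lower strand, b and d those of the upper strand. *)
Definition crossing := (nat * nat * nat * nat)%type.

Definition crossing_seq (x : crossing) : seq nat :=
  let: (a, b, c, d) := x in [:: a; b; c; d].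

(* An arc (a, b) is a vertex of degree two: it only says that the edges a and b
   are joined.  In particular an arc (a, a) is a circle without crossing. *)
Record diagram := Diagram {
  crossings : seq crossing;
  arcs : seq (nat * nat) }.

Definition arc_code (ps : seq (nat * nat)) : code :=
  [seq [:: p.1; p.2] | p <- ps].

Definition diagram_code (D : diagram) : code :=
  map crossing_seq (crossings D) ++ arc_code (arcs D).

Definition link_diagram (D : diagram) : Prop :=
  [/\ 0 < size (diagram_code D), well_labelled (diagram_code D)
    & planar (diagram_code D)].

Definition relabel_crossing (f : nat -> nat) (x : crossing) : crossing :=
  let: (a, b, c, d) := x in (f a, f b, f c, f d).

Definition relabel_arc (f : nat -> nat) (p : nat * nat) : nat * nat :=
  (f p.1, f p.2).

Definition relabel (f : nat -> nat) (D : diagram) : diagram :=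
  Diagram (map (relabel_crossing f) (crossings D))
          (map (relabel_arc f) (arcs D)).

Definition rename (a b : nat) : nat -> nat := fun l => if l == b then a else l.

(* The first six moves change the description of a diagram and not the diagram
   itself; the others are the Reidemeister moves.  In the third Reidemeister
   move the top, middle and bottom strands have the ends t, t'; m, m'; b, b',
   which occur around the disk in the counterclockwise order t m b t' m' b' for
   move_R3 and t b m t' b' m' for move_R3'; x, y, z are the sides of the
   triangle. *)
Inductive move : diagram -> diagram -> Prop :=
| move_perm xs xs' ps ps' :
    perm_eq xs xs' -> perm_eq ps ps' -> move (Diagram xs ps) (Diagram xs' ps')
| move_rotate a b c d xs ps :
    move (Diagram ((a, b, c, d) :: xs) ps) (Diagram ((c, d, a, b) :: xs) ps)
| move_flip a b xs ps :
    move (Diagram xs ((a, b) :: ps)) (Diagram xs ((b, a) :: ps))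
| move_relabel f D : injective f -> move D (relabel f D)
| move_join a b xs ps : a != b ->
    move (Diagram xs ((a, b) :: ps)) (relabel (rename a b) (Diagram xs ps))
| move_R1 a b c xs ps :
    move (Diagram ((a, a, b, c) :: xs) ps) (Diagram xs ((b, c) :: ps))
| move_R1' a b c xs ps :
    move (Diagram ((b, a, a, c) :: xs) ps) (Diagram xs ((b, c) :: ps))
| move_R2 a b c d x y xs ps :
    move (Diagram [:: (a, x, y, b), (y, x, c, d) & xs] ps)
         (Diagram xs [:: (a, c), (b, d) & ps])
| move_R3 t m b t' m' b' x y z xs ps :
    move
      (Diagram [:: (m, x, y, t), (b, t', z, x), (z, m', b', y) & xs] ps)
      (Diagram [:: (m', x, y, t'), (b', t, z, x), (z, m, b, y) & xs] ps)
| move_R3' t m b t' m' b' x y z xs ps :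
    move
      (Diagram [:: (b, x, z, t), (m, t', y, x), (z, y, b', m') & xs] ps)
      (Diagram [:: (b', x, z, t'), (m', t, y, x), (z, y, b, m) & xs] ps).

(* Two diagrams represent the same link.  Since every diagram along the way is
   planar, two strands can only be moved over each other across a common
   region (or when they belong to different components of the diagram). *)
Definition isotopic : diagram -> diagram -> Prop :=
  clos_refl_sym_trans diagram
    (fun D D' => [/\ link_diagram D, link_diagram D' & move D D']).

Definition unknot : diagram := Diagram [::] [:: (0, 0)].

Section Smoothing.
Variables (D : diagram) (i : 'I_(size (crossings D))).

Definition crossing_at : crossing := tnth (in_tuple (crossings D)) i.

Definition other_crossings : seq crossing :=
  take i (crossings D) ++ drop i.+1 (crossings D).

(* The A-smoothing merges the two regions swept by the upper strand when it is
   turned counterclockwise, that is the corners between b and c and between d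
   and a. *)
Definition smooth_0 : diagram :=
  let: (a, b, c, d) := crossing_at in
  Diagram other_crossings [:: (a, b), (c, d) & arcs D].

Definition smooth_infty : diagram :=
  let: (a, b, c, d) := crossing_at in
  Diagram other_crossings [:: (a, d), (b, c) & arcs D].

End Smoothing.

Local Open Scope ring_scope.

(* All exponents of A occurring in a Jones polynomial are even, so that the
   Jones polynomial at t is the value of [jones] at any A with A^4 = t^-1, up
   to the choice of a square root of t. *)
Section Jones.
Variables (F : fieldType) (A : F).

Fixpoint bracket_rec (xs : seq crossing) (ps : seq (nat * nat)) : F :=
  match xs with
  | [::] => (- A ^+ 2 - A ^- 2) ^+ (components (arc_code ps)).-1
  | (a, b, c, d) :: xs' =>
      A * bracket_rec xs' [:: (a, b), (c, d) & ps]
      + A^-1 * bracket_rec xs' [:: (a, d), (b, c) & ps]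
  end.

Definition bracket (D : diagram) : F := bracket_rec (crossings D) (arcs D).

Definition orient (D : diagram) := dart (diagram_code D) -> bool.

(* o d tells whether the strand leaves the vertex along d. *)
Definition orientation (D : diagram) (o : orient D) : Prop :=
  forall d, o (edge d) = ~~ o d /\ o (across d) = ~~ o d.

(* A crossing (a, b, c, d) is positive when its strands run from a to c and
   from d to b, or from c to a and from b to d. *)
Definition writhe (D : diagram) (o : orient D) : int :=
  \sum_(d : dart (diagram_code D) |
          (vtx d < size (crossings D))%N && (pos d == 0%N))
    (if o d == o (node d) then -1 else 1).

Definition jones (D : diagram) (o : orient D) : F :=
  (- A ^+ 3) ^ (- writhe o) * bracket D.

End Jones.

Definition laurent_A : {fraction {poly int}} := tofrac 'X.

(* the Jones polynomial, as a Laurent polynomial in A with t = A^-4 *)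
Definition jones_polynomial (D : diagram) (o : orient D) :
  {fraction {poly int}} := jones laurent_A o.

Definition sqrt_t : {fraction {poly int}} := laurent_A ^- 2.

(* V is the sum of the c_i t^(n/2 + i) for 0 <= i <= k *)
Definition no_gap (V : {fraction {poly int}}) : Prop :=
  exists (n : int) (k : nat) (c : 'I_k.+1 -> int),
    (forall i, c i != 0) /\
    V = \sum_(i < k.+1) (c i)%:~R * sqrt_t ^ (n + (i : nat)%:Z * 2).

(* |V(-1)|; it does not depend on the orientation *)
Definition has_det (D : diagram) (m : algC) : Prop :=
  exists2 o : orient D, orientation o & m = `|jones (4.-root (-1) : algC) o|.

Definition det_additive (D : diagram) (i : 'I_(size (crossings D))) : Prop :=
  exists m m0 m1 : algC,
    [/\ has_det D m, has_det (smooth_0 i) m0 & has_det (smooth_infty i) m1] /\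
    [/\ 1 <= m0, 1 <= m1 & m = m0 + m1].

(* D represents a link in the set Q *)
Inductive quasi_alternating : diagram -> Prop :=
| qa_unknot D : isotopic D unknot -> quasi_alternating D
| qa_crossing D L (i : 'I_(size (crossings L))) :
    isotopic D L -> link_diagram L ->
    quasi_alternating (smooth_0 i) -> quasi_alternating (smooth_infty i) ->
    det_additive i -> quasi_alternating D.

Definition quasi_alternating_at (L : diagram) (i : 'I_(size (crossings L))) :
  Prop :=
  [/\ quasi_alternating (smooth_0 i), quasi_alternating (smooth_infty i)
    & det_additive i].

Local Close Scope ring_scope.

(* ends = (e0, e1, e2, e3) are the edges that reach the boundary of the disk,
   in counterclockwise order; an edge that joins two endpoints occurs twice
   there.  Circles without crossing are left out: a connected tangle diagram
   contains none. *)
Record tangle := Tangle {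
  tcrossings : seq crossing;
  ends : nat * nat * nat * nat }.

(* The outside of the disk is shrunk to a vertex, placed last.  Its corner
   number 3 - j is the boundary arc between e_j and e_(j+1), indices mod 4. *)
Definition capped (T : tangle) : code :=
  let: (e0, e1, e2, e3) := ends T in
  rcons (map crossing_seq (tcrossings T)) [:: e0; e3; e2; e1].

Definition tangle_diagram (T : tangle) : Prop :=
  well_labelled (capped T) && planar (capped T).

Definition tangle_connected (T : tangle) : Prop :=
  let: (e0, e1, e2, e3) := ends T in
  components (map crossing_seq (tcrossings T)
              ++ [:: [:: e0]; [:: e1]; [:: e2]; [:: e3]]) = 1.

(* Along every strand, an edge between two crossings has one lower and one
   upper end. *)
Definition tangle_alternating (T : tangle) : Prop :=
  uniq (flatten [seq (let: (a, b, c, d) := x in [:: a; c]) | x <- tcrossings T])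
  && uniq (flatten
       [seq (let: (a, b, c, d) := x in [:: b; d]) | x <- tcrossings T]).

Definition numerator (T : tangle) : diagram :=
  let: (e0, e1, e2, e3) := ends T in
  Diagram (tcrossings T) [:: (e0, e1); (e2, e3)].

Definition denominator (T : tangle) : diagram :=
  let: (e0, e1, e2, e3) := ends T in
  Diagram (tcrossings T) [:: (e1, e2); (e3, e0)].

Definition tangle_reduced (T : tangle) : Prop :=
  forall i, i < size (tcrossings T) ->
    ~ (nugatory (diagram_code (numerator T)) i
       /\ nugatory (diagram_code (denominator T)) i).

(* The shaded corners at vertex i are those merged by the A-smoothing, resp. by
   the A^-1-smoothing. *)
Definition positive_edge (V : code) (kappa : dart V -> bool) (i : nat) : Prop :=
  forall d, vtx d = i -> kappa d = odd (pos d).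

Definition negative_edge (V : code) (kappa : dart V -> bool) (i : nat) : Prop :=
  forall d, vtx d = i -> kappa d = ~~ odd (pos d).

(* The colourings agree when the disk of T is inserted at the crossing i, with
   the endpoint e_j attached to the j-th edge of the crossing. *)
Definition induced_colouring (L : diagram) (i : 'I_(size (crossings L)))
    (T : tangle) (kappa : dart (diagram_code L) -> bool)
    (kappaT : dart (capped T) -> bool) : Prop :=
  forall d dT, vtx d = i -> vtx dT = size (tcrossings T) ->
    pos d + pos dT = 3 -> kappaT dT = kappa d.

Definition same_type (L : diagram) (i : 'I_(size (crossings L))) (T : tangle) :
  Prop :=
  exists (kappa : dart (diagram_code L) -> bool)
         (kappaT : dart (capped T) -> bool),
    [/\ checkerboard kappa, checkerboard kappaT,
        induced_colouring i kappa kappaT,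
        positive_edge kappa i ->
          forall j, j < size (tcrossings T) -> positive_edge kappaT j
      & negative_edge kappa i ->
          forall j, j < size (tcrossings T) -> negative_edge kappaT j].

(* Even labels come from L and odd labels from T.  The endpoint e_j is attached
   to the j-th edge of the crossing; the other ways of inserting T amount to
   rotating the numbering of its endpoints. *)
Definition replace_crossing (L : diagram) (i : 'I_(size (crossings L)))
    (T : tangle) : diagram :=
  let fL := double in
  let fT := fun l => l.*2.+1 in
  let: (a, b, c, d) := crossing_at i in
  let: (e0, e1, e2, e3) := ends T in
  Diagram
    (map (relabel_crossing fL) (other_crossings i)
     ++ map (relabel_crossing fT) (tcrossings T))
    ([:: (fL a, fT e0); (fL b, fT e1); (fL c, fT e2); (fL d, fT e3)]
     ++ map (relabel_arc fL) (arcs L)).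

(* Main.v *)
Require Import Defs.
From Stdlib Require Import Relations.
From mathcomp Require Import all_boot all_order all_algebra all_field.
From mathcomp Require Import zify ring.

Set Implicit Arguments.
Unset Strict Implicit.
Unset Printing Implicit Defensive.

(* The condition det(L) = det(L_0) + det(L_oo) compares absolute values at an
   eighth root of unity, so that it forces the two terms of the skein relation to
   have the same phase there.  By induction, the bracket of a quasi-alternating
   link is, up to a unit, a sum of powers of - A^4: no cancellation occurs, and
   the support of <L> is the union of the supports of A <L_0> and A^-1 <L_oo>.
   Since all crossings of T have the type of c, the bracket of L' is the state
   sum of the Tait graph of T together with one edge e0 for the outside of T,
   weighted by <L_0> and <L_oo>.  If the union of the two supports is an interval
   with at least two elements, which the value at A^2 + A^-2 = -1 forces, then so
   is the support of the state sum, by deletion and contraction of edges. *)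

(** * Classes of labels joined by arcs *)

(** The obstacle is that a union of two intervals may have a gap. The Hopf link has bracket - A^4 -
    A^-4, so multiplying a single power of - A^4 by it opens one; this is why one-element intervals
    are excluded, whereas an interval with two elements still touches its translate by two steps.
    Moreover only the union of the supports of the two weights is known to be an interval. If the
    edge e0 became a loop or a bridge, one weight alone would survive, so the induction keeps e0
    away from both; at the start this is what the connectedness of T gives. The induction sees the
    graph only through the number of circles of each state, a state being a set of crossings.
    Resmoothing one crossing changes this number by one, because the checkerboard colouring orients
    all circles. In the planar case the set of crossings at which it increases grows with the state,
    as does the span of a set of edges in a matroid. These two facts and Euler's formula are all
    that is used. Identities are kept in all fields at once: the field of fractions serves to
    compare coefficients, roots of unity serve for determinants, phases and parities. *)

Definition labels (ps : seq (nat * nat)) : seq nat := flatten (arc_code ps).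

(** A union-find in which the arc (a, b) redirects the class of b to that of a. Connectedness
    becomes an equality of representatives, and classes can be counted without a finite type of
    labels. *)
Fixpoint class_rep (ps : seq (nat * nat)) (x : nat) : nat :=
  if ps is (a, b) :: ps' then
    if class_rep ps' x == class_rep ps' b then class_rep ps' a else class_rep ps' x
  else x.

Definition conn ps x y := class_rep ps x == class_rep ps y.

Definition classes (vs : seq nat) ps := size (undup (map (class_rep ps) vs)).

(** For the arcs of a completely smoothed diagram the classes are its circles. The count makes sense
    for any list of pairs, also when chords are added to the circles. *)
Definition cc ps := classes (labels ps) ps.

Lemma labels_cons a b ps : labels ((a, b) :: ps) = [:: a, b & labels ps].
Proof. by []. Qed.

Lemma labels_nil : labels [::] = [::]. Proof. by []. Qed.

Lemma labels_cat ps qs : labels (ps ++ qs) = labels ps ++ labels qs.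
Proof. by rewrite /labels /arc_code map_cat flatten_cat. Qed.

Lemma mem_labels ps x :
  (x \in labels ps) = has (fun p => (x == p.1) || (x == p.2)) ps.
Proof. by elim: ps => //= -[a b] ps IH; rewrite labels_cons !inE IH orbA. Qed.

Lemma mem_labels1 ps p : p \in ps -> p.1 \in labels ps.
Proof. by rewrite mem_labels => pp; apply/hasP; exists p; rewrite ?eqxx. Qed.

Lemma mem_labels2 ps p : p \in ps -> p.2 \in labels ps.
Proof. by rewrite mem_labels => pp; apply/hasP; exists p; rewrite ?eqxx ?orbT. Qed.

Lemma labels_perm ps qs : perm_eq ps qs -> perm_eq (labels ps) (labels qs).
Proof.
by move=> e; apply/perm_flatten/perm_map.
Qed.

Lemma eq_mem_labels ps qs : ps =i qs -> labels ps =i labels qs.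
Proof. by move=> e x; rewrite !mem_labels; apply: eq_has_r. Qed.

(** The universal property of the equivalence generated by the arcs. To derive something from a
    connection, a suitable [g] is chosen here. *)
Lemma conn_elim (T : Type) (g : nat -> T) ps x y :
  (forall p, p \in ps -> g p.1 = g p.2) -> conn ps x y -> g x = g y.
Proof.
move=> gE /eqP xy.
suff rE z : g (class_rep ps z) = g z by rewrite -(rE x) xy rE.
elim: ps gE z {xy} => //= -[a b] ps IH gE z.
have {}IH u : g (class_rep ps u) = g u.
  by apply: IH => p pp; apply: gE; rewrite inE pp orbT.
case: eqP => // zb.
by rewrite IH (gE (a, b)) ?mem_head // -[LHS]IH -zb IH.
Qed.

Lemma conn_mem ps p : p \in ps -> conn ps p.1 p.2.
Proof.
elim: ps => //= -[a b] ps IH; rewrite inE => /predU1P[-> | /IH]; rewrite /conn /=.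
  by rewrite eqxx; case: ifP.
by move=> /eqP ->.
Qed.

Lemma conn_refl ps : reflexive (conn ps). Proof. by move=> x; apply: eqxx. Qed.
Lemma conn_sym ps : symmetric (conn ps).
Proof. by move=> x y; apply: eq_sym. Qed.
Lemma conn_trans ps : transitive (conn ps).
Proof. by move=> y x z /eqP xy; rewrite /conn xy. Qed.

Lemma conn_sub ps qs x y :
  (forall p, p \in ps -> conn qs p.1 p.2) -> conn ps x y -> conn qs x y.
Proof. by move=> pq /conn_elim xy; apply/eqP/xy => p /pq/eqP. Qed.

Lemma conn_subset ps qs x y : {subset ps <= qs} -> conn ps x y -> conn qs x y.
Proof. by move=> sub; apply: conn_sub => p /sub/conn_mem. Qed.

Lemma conn_iso ps x y : x \notin labels ps -> conn ps x y -> x = y.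
Proof.
move=> xN /(@conn_elim _ (pred1 x)) /= H; apply/eqP; rewrite eq_sym -H ?eqxx //.
move=> p pp; apply/idP/idP => /eqP e; case/negP: xN; rewrite -e.
  exact: mem_labels1.
exact: mem_labels2.
Qed.

Lemma size_undup_map (T U V : eqType) (f : T -> U) (g : T -> V) (s t : seq T) :
  s =i t -> {in s &, forall x y, (f x == f y) = (g x == g y)} ->
  size (undup (map f s)) = size (undup (map g t)).
Proof.
move=> st fg.
have -> : size (undup (map f s)) = size (undup (map g s)).
  elim: s {st} fg => //= x s IH fg.
  have -> : (f x \in map f s) = (g x \in map g s).
    apply/mapP/mapP => -[y ys e]; exists y => //; apply/eqP.
      by rewrite -fg ?inE ?eqxx ?ys ?orbT // e.
    by rewrite fg ?inE ?eqxx ?ys ?orbT // e.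
  have {}IH : size (undup (map f s)) = size (undup (map g s)).
    by apply: IH => y z ys zs; apply: fg; rewrite inE ?ys ?zs orbT.
  by case: ifP; rewrite /= IH.
apply/perm_size/uniq_perm; rewrite ?undup_uniq // => u.
rewrite !mem_undup; apply/mapP/mapP => -[y ys ->]; exists y => //.
  by rewrite -st.
by rewrite st.
Qed.

Lemma eq_classes vs ws ps qs : vs =i ws ->
  {in vs &, conn ps =2 conn qs} -> classes vs ps = classes ws qs.
Proof. exact: size_undup_map. Qed.

Lemma eq_classes_sub vs ws ps qs : vs =i ws ->
  (forall p, p \in ps -> conn qs p.1 p.2) ->
  (forall p, p \in qs -> conn ps p.1 p.2) -> classes vs ps = classes ws qs.
Proof.
by move=> vw pq qp; apply: eq_classes => // x y _ _; apply/idP/idP; apply: conn_sub.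
Qed.

Lemma eq_cc ps qs : labels ps =i labels qs ->
  (forall p, p \in ps -> conn qs p.1 p.2) ->
  (forall p, p \in qs -> conn ps p.1 p.2) -> cc ps = cc qs.
Proof. exact: eq_classes_sub. Qed.

Lemma cc_eq_mem ps qs : ps =i qs -> cc ps = cc qs.
Proof.
move=> e; apply: eq_cc; first exact: eq_mem_labels.
  by move=> p pp; apply: conn_mem; rewrite -e.
by move=> p pp; apply: conn_mem; rewrite e.
Qed.

Lemma classes_cons vs a b ps : a \in vs -> b \in vs ->
  classes vs ps = classes vs ((a, b) :: ps) + ~~ conn ps a b.
Proof.
move=> av bv; rewrite /classes /conn /=; set r := class_rep ps.
have [e | ne] := eqVneq (r a) (r b).
  rewrite addn0; congr (size (undup _)); apply/eq_map => x.
  by case: eqP => // ->.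
set s := undup (map r vs); rewrite /= addn1.
have bs : r b \in s by rewrite mem_undup map_f.
have us : uniq s by rewrite undup_uniq.
rewrite (perm_size (perm_to_rem bs)) /=; congr S.
apply/perm_size/uniq_perm; rewrite ?undup_uniq ?rem_uniq // => x.
rewrite mem_undup (mem_rem_uniq _ us) inE mem_undup.
apply/andP/mapP => [[xb /mapP[y yv xy]] | [y yv ->]].
  by exists y; rewrite // -xy (negbTE xb).
by case: (eqVneq (r y) (r b)) => [_|->]; rewrite ?ne map_f.
Qed.

Lemma classes_gt0 x vs ps : x \in vs -> 0 < classes vs ps.
Proof.
move=> xv; rewrite /classes -has_predT; apply/hasP; exists (class_rep ps x) => //.
by rewrite mem_undup map_f.
Qed.

Lemma classes_new x vs ps : x \notin vs -> x \notin labels ps ->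
  classes (x :: vs) ps = (classes vs ps).+1.
Proof.
move=> xv xp; rewrite /classes /=.
case: ifP => // /mapP[y yv e]; case/negP: xv.
by have/conn_iso-> : conn ps x y by apply/eqP.
Qed.

Lemma classes1 x vs ps : x \in vs -> (forall y, y \in vs -> conn ps x y) ->
  classes vs ps = 1.
Proof.
move=> xv h; rewrite /classes (@size_undup_map _ _ _ _ (fun=> tt) _ vs) //.
  case: (vs) xv => //= y s _.
  have e : map (fun=> tt) s = nseq (size s) tt by elim: s => //= z s ->.
  by rewrite e; elim: (size s) => //= n IH; case: ifP => // ; case: n IH.
by move=> y z /h/eqP yx /h/eqP zx; rewrite -yx zx !eqxx.
Qed.

Lemma classes1_conn vs ps x y : classes vs ps = 1 -> x \in vs -> y \in vs ->
  conn ps x y.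
Proof.
rewrite /classes => h xv yv.
have: class_rep ps x \in undup (map (class_rep ps) vs) by rewrite mem_undup map_f.
have: class_rep ps y \in undup (map (class_rep ps) vs) by rewrite mem_undup map_f.
case: (undup _) h => [|u []] // _; rewrite !inE => /eqP e1 /eqP e2.
by rewrite /conn e1 e2.
Qed.

Lemma cc_gt0 ps x : x \in labels ps -> 0 < cc ps.
Proof. exact: classes_gt0. Qed.

Lemma cc_dup a b ps : conn ps a b -> a \in labels ps -> b \in labels ps ->
  cc ((a, b) :: ps) = cc ps.
Proof.
move=> ab al bl; apply: eq_cc.
- move=> x; rewrite labels_cons !inE.
  by case: eqP => [->|_]; rewrite ?al //; case: eqP => [->|_]; rewrite ?bl.
- by move=> p; rewrite inE => /predU1P[->|/conn_mem].
- by move=> p pp; apply: conn_mem; rewrite inE pp orbT.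
Qed.

(** A point of degree two on a strand may be erased: starting from the arc (a, b), the label x is
    added as an isolated class and then attached to a, and the two changes of the count cancel. *)
Lemma cc_elim x a b ps : x != a -> x != b -> x \notin labels ps ->
  cc [:: (a, x), (x, b) & ps] = cc ((a, b) :: ps).
Proof.
move=> xa xb xN.
have -> : cc [:: (a, x), (x, b) & ps] =
    classes (x :: labels ((a, b) :: ps)) [:: (a, x), (a, b) & ps].
  apply: eq_classes_sub => [y | p | p].
  - by rewrite !(labels_cons, inE); do ![case: eqP => ? //=].
  - rewrite !inE => /or3P[/eqP-> | /eqP-> | pp] /=.
    + by apply: (@conn_mem _ (a, x)); rewrite inE eqxx.
    + apply: (@conn_trans _ a); last by apply: (@conn_mem _ (a, b)); rewrite !inE eqxx ?orbT.
      by rewrite conn_sym; apply: (@conn_mem _ (a, x)); rewrite !inE eqxx ?orbT.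
    + by apply: conn_mem; rewrite !inE pp !orbT.
  - rewrite !inE => /or3P[/eqP-> | /eqP-> | pp] /=.
    + by apply: (@conn_mem _ (a, x)); rewrite inE eqxx.
    + apply: (@conn_trans _ x); first by apply: (@conn_mem _ (a, x)); rewrite !inE eqxx ?orbT.
      by apply: (@conn_mem _ (x, b)); rewrite !inE eqxx ?orbT.
    + by apply: conn_mem; rewrite !inE pp !orbT.
have xN' : x \notin labels ((a, b) :: ps) by rewrite labels_cons !inE !negb_or xa xb.
have := @classes_cons (x :: labels ((a, b) :: ps)) a x ((a, b) :: ps).
rewrite labels_cons !inE !eqxx !orbT => /(_ isT isT).
rewrite -labels_cons classes_new //.
have -> : conn ((a, b) :: ps) a x = false.
  apply/negbTE; rewrite conn_sym; apply: contra xa => /conn_iso-> //.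
by rewrite addn1 => -[].
Qed.

Lemma cc_flip a b ps : cc ((a, b) :: ps) = cc ((b, a) :: ps).
Proof.
apply: eq_cc.
- by move=> y; rewrite !(labels_cons, inE); do ![case: eqP => ? //=].
- move=> p; rewrite inE => /predU1P[-> | pp].
    by rewrite conn_sym; apply: (@conn_mem _ (b, a)); rewrite mem_head.
  by apply: conn_mem; rewrite inE pp orbT.
- move=> p; rewrite inE => /predU1P[-> | pp].
    by rewrite conn_sym; apply: (@conn_mem _ (a, b)); rewrite mem_head.
  by apply: conn_mem; rewrite inE pp orbT.
Qed.

Lemma cc_circle a ps : a \notin labels ps -> cc ((a, a) :: ps) = (cc ps).+1.
Proof.
move=> aN; rewrite -(classes_new aN aN); apply: eq_classes_sub.
- by move=> y; rewrite !(labels_cons, inE); do ![case: eqP => ? //=].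
- move=> p; rewrite inE => /predU1P[-> | /conn_mem] //=; exact: conn_refl.
- by move=> p pp; apply: conn_mem; rewrite inE pp orbT.
Qed.

Lemma cc_disjoint ps qs : (forall x, x \in labels ps -> x \notin labels qs) ->
  cc (ps ++ qs) = cc ps + cc qs.
Proof.
move=> dis.
(* The sum type separates the two families of representatives without having to locate their
   values. *)
pose g x : nat + nat :=
  if x \in labels ps then inl (class_rep ps x) else inr (class_rep qs x).
have gE p : p \in ps ++ qs -> g p.1 = g p.2.
  rewrite mem_cat /g => /orP[pp | pq].
    by rewrite (mem_labels1 pp) (mem_labels2 pp) (eqP (conn_mem pp)).
  rewrite !ifN ?(eqP (conn_mem pq)) //.
    by apply/negP => /dis; rewrite (mem_labels2 pq).
  by apply/negP => /dis; rewrite (mem_labels1 pq).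
rewrite /cc /classes.
rewrite (@size_undup_map _ _ _ _ g _ (labels ps ++ labels qs)); first last.
- move=> x y; rewrite labels_cat !mem_cat => xl yl; apply/idP/idP.
    by move=> c; rewrite (conn_elim gE c).
  rewrite /g; case: (boolP (x \in labels ps)) => xp;
    case: (boolP (y \in labels ps)) => yp //.
    move=> e; apply: (@conn_subset ps) => [p pp|]; first by rewrite mem_cat pp.
    by rewrite /conn; case/eqP: e => ->.
  move=> e; apply: (@conn_subset qs) => [p pp|]; first by rewrite mem_cat pp orbT.
  by rewrite /conn; case/eqP: e => ->.
- by move=> x; rewrite labels_cat.
rewrite map_cat undup_cat size_cat; congr (_ + _).
  rewrite (_ : [seq x <- _ | _] = undup (map g (labels ps))); last first.
    apply/all_filterP/allP => u; rewrite mem_undup => /mapP[x xp ->].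
    apply/mapP => -[y yq]; rewrite /g xp; case: ifP => // /dis.
    by rewrite yq.
  apply: size_undup_map => // x y xp yp; rewrite /g xp yp.
  by apply/eqP/eqP => [[]|->].
apply: size_undup_map => // x y xq yq; rewrite /g.
have nq z : z \in labels qs -> (z \in labels ps) = false.
  by move=> zq; apply/negP => /dis; rewrite zq.
by rewrite !nq //; apply/eqP/eqP => [[]|->].
Qed.

Definition map_arcs (f : nat -> nat) (ps : seq (nat * nat)) := map (relabel_arc f) ps.

Lemma labels_map f ps : labels (map_arcs f ps) = map f (labels ps).
Proof. by elim: ps => //= -[a b] ps IH; rewrite !labels_cons IH. Qed.

Lemma conn_map f ps x y : injective f ->
  conn (map_arcs f ps) (f x) (f y) = conn ps x y.
Proof.
move=> inj; apply/idP/idP; last first.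
  move=> /(@conn_elim _ (fun z => class_rep (map_arcs f ps) (f z))) h; apply/eqP/h.
  by move=> p pp; apply/eqP/(@conn_mem _ (relabel_arc f p))/map_f.
pose L := [:: x, y & labels ps].
(* On the finite list [L], [index] provides an inverse of [f]. *)
pose g u := class_rep ps (nth 0 L (index u (map f L))).
have gE z : z \in L -> g (f z) = class_rep ps z.
  by move=> zL; rewrite /g index_map // nth_index.
move=> /(@conn_elim _ g); rewrite !gE ?inE ?eqxx ?orbT // => h; apply/eqP/h.
move=> _ /mapP[p pp ->] /=.
by rewrite !gE ?inE ?mem_labels1 ?mem_labels2 ?orbT // (eqP (conn_mem pp)).
Qed.

Lemma cc_map f ps : injective f -> cc (map_arcs f ps) = cc ps.
Proof.
move=> inj; rewrite /cc /classes labels_map -map_comp.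
by apply: size_undup_map => // x y _ _; apply: conn_map.
Qed.

Lemma conn_join a b ps x y : conn ((a, b) :: ps) x y =
  conn (map_arcs (rename a b) ps) (rename a b x) (rename a b y).
Proof.
apply/idP/idP.
  move=> /(@conn_elim _ (fun z => class_rep (map_arcs (rename a b) ps) (rename a b z))).
  move=> h; apply/eqP/h => p; rewrite inE => /predU1P[-> | pp] /=.
    by rewrite /rename eqxx; case: eqP.
  exact/eqP/(@conn_mem _ (relabel_arc (rename a b) p))/map_f.
have rE z : class_rep ((a, b) :: ps) (rename a b z) = class_rep ((a, b) :: ps) z.
  rewrite /rename; case: eqP => // ->.
  by apply/eqP; apply: (@conn_mem ((a, b) :: ps) (a, b)); rewrite mem_head.
move=> /(@conn_elim _ (class_rep ((a, b) :: ps))); rewrite !rE => h; apply/eqP/h.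
move=> _ /mapP[p pp ->]; rewrite !rE; apply/eqP/conn_mem.
by rewrite inE pp orbT.
Qed.

Lemma cc_join a b ps : (a \in labels ps) || (b \in labels ps) ->
  cc ((a, b) :: ps) = cc (map_arcs (rename a b) ps).
Proof.
move=> ab; rewrite /cc /classes labels_map -map_comp.
rewrite (@size_undup_map _ _ _ _ (class_rep (map_arcs (rename a b) ps) \o rename a b) _
  (labels ((a, b) :: ps))) //; last first.
  by move=> x y _ _; apply: conn_join.
set h := _ \o _.
have hab : h a = h b by rewrite /h /= /rename eqxx; case: eqP.
apply/perm_size/uniq_perm; rewrite ?undup_uniq // => u.
rewrite !mem_undup labels_cons !map_cons !inE hab orbA orbb; case: eqP => // ->.
by case/orP: ab => l; symmetry; [rewrite -hab|]; apply: (map_f h l).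
Qed.

(** * Faces and components of a planar code *)

Lemma well_labelled_perm V W : perm_eq (flatten V) (flatten W) ->
  well_labelled V -> well_labelled W.
Proof.
move=> e; rewrite /well_labelled -(perm_all _ e) => /allP h.
by apply/allP => l lV; rewrite -(permP e) h.
Qed.

(** The roots of the components form a transversal, which [h] followed by [class_rep] sends
    bijectively to the representatives of the classes. *)
Lemma n_comp_classes (T : finType) (e : rel T) (a : pred T) (h : T -> nat) vs ps :
  connect_sym e -> closed e a ->
  {in a, forall x, h x \in vs} -> {in vs, forall v, exists2 x, x \in a & h x = v} ->
  {in a &, forall x y, connect e x y = conn ps (h x) (h y)} ->
  n_comp e a = classes vs ps.
Proof.
move=> es ea hv vh eh; pose A := [predI roots e & a].
have rootA x : x \in a -> fingraph.root e x \in A.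
  move=> xa; rewrite !inE roots_root //=.
  by rewrite -(closed_connect ea (connect_root e x)).
transitivity (size (map (class_rep ps \o h) (enum A))).
  by rewrite size_map -cardE; apply: eq_card => x; rewrite !inE.
apply/perm_size/uniq_perm; rewrite ?undup_uniq //.
  rewrite map_inj_in_uniq ?enum_uniq // => x y.
  rewrite !mem_enum !inE => /andP[/eqP rx xa] /andP[/eqP ry ya] /= xy.
  have : connect e x y by rewrite eh //; apply/eqP.
  by rewrite -(root_connect es) rx ry => /eqP.
move=> u; rewrite mem_undup; apply/mapP/mapP => [[x] | [v /vh[x xa <-] ->]].
  by rewrite mem_enum !inE => /andP[_ xa] ->; exists (h x); rewrite ?hv.
exists (fingraph.root e x); first by rewrite mem_enum rootA.
apply/eqP; rewrite -[_ == _]/(conn ps _ _) -eh ?connect_root //.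
by have := rootA x xa; rewrite !inE => /andP[].
Qed.

Section Darts.
Variable V : code.
Implicit Types d : dart V.

Lemma dart_eq d d' : vtx d = vtx d' -> pos d = pos d' -> d = d'.
Proof.
case: d d' => [i j] [i' j']; rewrite /vtx /pos /= => /val_inj e.
by case: _ / e j' => j' /val_inj ->.
Qed.

Lemma dart_ex i j : i < size V -> j < size (nth [::] V i) ->
  exists2 d : dart V, vtx d = i & pos d = j.
Proof.
move=> iV jV; exists (Tagged (fun i : 'I_(size V) => 'I_(size (nth [::] V i)))
   (Ordinal jV : 'I_(size (nth [::] V (Ordinal iV))))); by [].
Qed.

Lemma vtx_lt d : vtx d < size V. Proof. by rewrite /vtx. Qed.
Lemma pos_lt d : pos d < size (nth [::] V (vtx d)). Proof. by rewrite /pos. Qed.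

Lemma vtx_node d : vtx (node d) = vtx d. Proof. by []. Qed.
Lemma vtx_nodeV d : vtx (nodeV d) = vtx d. Proof. by []. Qed.
Lemma pos_node d : pos (node d) = (pos d).+1 %% size (nth [::] V (vtx d)).
Proof. by []. Qed.
Lemma pos_nodeV d : pos (nodeV d) =
  (pos d + size (nth [::] V (vtx d))).-1 %% size (nth [::] V (vtx d)).
Proof. by []. Qed.

Lemma nodeVK : cancel (@nodeV V) (@node V).
Proof. by case=> i j; rewrite /node /nodeV /= ord_predK. Qed.

Lemma label_in d : label d \in flatten V.
Proof.
by apply/flattenP; exists (nth [::] V (vtx d)); rewrite mem_nth ?vtx_lt ?pos_lt.
Qed.

Lemma label_ex l : l \in flatten V -> exists d : dart V, label d = l.
Proof.
move=> /flattenP[s sV ls].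
have iV : index s V < size V by rewrite index_mem.
have es : nth [::] V (index s V) = s by rewrite nth_index.
have [|d dv dp] := @dart_ex (index s V) (index l s) iV; first by rewrite es index_mem.
by exists d; rewrite /label dv dp es nth_index.
Qed.

Lemma sum_darts (f : nat -> nat -> nat) :
  \sum_(d : dart V) f (vtx d) (pos d) =
  \sum_(i < size V) \sum_(j < size (nth [::] V i)) f i j.
Proof.
by rewrite (@sig_big_dep _ _ _ _ (fun i : 'I_(size V) => 'I_(size (nth [::] V i)))
  (fun=> true) (fun _ _ => true) (fun i j => f i j)).
Qed.

Lemma count_label l : count_mem l (flatten V) = #|[pred d : dart V | label d == l]|.
Proof.
rewrite -sum1_card big_mkcond /=.
rewrite (sum_darts (fun i j => if nth 0 (nth [::] V i) j == l then 1 else 0)).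
rewrite count_flatten sumnE big_map (big_nth [::]) big_mkord.
apply: eq_bigr => i _; rewrite -sum1_count big_mkcond (big_nth 0) big_mkord.
by apply: eq_bigr => j _.
Qed.

Hypothesis wl : well_labelled V.

Lemma card_label d : #|[pred d' : dart V | label d' == label d]| = 2.
Proof. by rewrite -count_label; apply/eqP/(allP wl)/label_in. Qed.

Lemma edge_spec d : edge d != d /\ label (edge d) = label d.
Proof.
rewrite /edge; case: pickP => /= [d' /andP[? /eqP] | no]; first by [].
by have := card_label d; rewrite (cardD1 d) inE eqxx eq_card0.
Qed.

Lemma edge_unique d d' : label d' = label d -> d' = d \/ d' = edge d.
Proof.
move=> e; have [ne le] := edge_spec d.
have [->|nd] := eqVneq d' d; [by left | right].
have := card_label d; rewrite (cardD1 d) inE eqxx (cardD1 (edge d)) !inE ne le eqxx /=.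
rewrite (cardD1 d') !inE nd e eqxx andbT; by case: eqP.
Qed.

Lemma edgeK : involutive (@edge V).
Proof.
move=> d; have [ne le] := edge_spec d; have [ne' le'] := edge_spec (edge d).
have [|//|h] := @edge_unique d (edge (edge d)); first by rewrite le'.
by rewrite h eqxx in ne'.
Qed.

Lemma face_inj : injective (@face V).
Proof. by move=> d d' /(can_inj nodeVK)/(can_inj edgeK). Qed.

Definition adj := [rel d d' : dart V | (d' == node d) || (d' == edge d)].

Lemma node_conn d d' : vtx d = vtx d' -> fconnect (@node V) d d'.
Proof.
move=> e; have -> : d' = iter (size (nth [::] V (vtx d)) - pos d + pos d') (@node V) d.
  apply: dart_eq.
    by elim: (_ + _) => //= n ->; rewrite vtx_node.
  have it n : vtx (iter n (@node V) d) = vtx d by elim: n => //= n <-.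
  have -> n : pos (iter n (@node V) d) = (pos d + n) %% size (nth [::] V (vtx d)).
    elim: n => [|n IH]; first by rewrite addn0 modn_small ?pos_lt.
    by rewrite iterS pos_node it IH -addn1 modnDml addn1 addnS.
  rewrite addnA subnKC ?(ltnW (pos_lt d)) // addnC modnDr modn_small //.
  by rewrite e pos_lt.
exact: fconnect_iter.
Qed.

Lemma adj_node d d' : vtx d = vtx d' -> connect adj d d'.
Proof.
move=> /node_conn; apply: connect_sub => x y /= /eqP <-.
by apply: connect1; rewrite /= eqxx.
Qed.

Lemma adj_edge d : connect adj d (edge d).
Proof. by apply: connect1; rewrite /= eqxx orbT. Qed.

Lemma adj_sym : connect_sym adj.
Proof.
have s x y : adj x y -> connect adj y x.
  case/orP=> /eqP ->; first by apply: adj_node; rewrite vtx_node.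
  by rewrite -{2}[x]edgeK adj_edge.
have h x y : connect adj x y -> connect adj y x.
  move=> /connectP[p]; elim: p x => [|z p IH] x /=; first by move=> _ ->.
  move=> /andP[/s zx] pz ey.
  by apply: connect_trans (IH z pz ey) zx.
by move=> x y; apply/idP/idP; apply: h.
Qed.

Lemma adj_label d d' : label d = label d' -> connect adj d d'.
Proof. by move=> /esym/edge_unique[->|->]; rewrite ?connect0 ?adj_edge. Qed.

Lemma components_classes ps :
  (forall d d', vtx d = vtx d' -> conn ps (label d) (label d')) ->
  (forall p, p \in ps -> exists d d',
     [/\ vtx d = vtx d', label d = p.1 & label d' = p.2]) ->
  components V = classes (flatten V) ps.
Proof.
move=> h1 h2; rewrite /components.
apply: (n_comp_classes (h := @label V)) => //.
- exact: adj_sym.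
- by move=> d _; apply: label_in.
- by move=> l /label_ex[d <-]; exists d.
move=> x y _ _; apply/idP/idP.
  move=> /connectP[p]; elim: p x => [|z p IH] x /=; first by move=> _ ->; apply: conn_refl.
  case/andP=> /orP[] /eqP ez pz /(IH z pz); apply: conn_trans.
    by apply: h1; rewrite ez vtx_node.
  by rewrite ez (edge_spec x).2 conn_refl.
pose g l := omap (fingraph.root adj) [pick d : dart V | label d == l].
have gE d : g (label d) = Some (fingraph.root adj d).
  rewrite /g; case: pickP => [d' /eqP e | /(_ d)]; last by rewrite eqxx.
  by congr Some; apply/eqP; rewrite root_connect ?adj_label //; apply: adj_sym.
move=> /(@conn_elim _ g); rewrite !gE => h; have [] : Some (fingraph.root adj x) = Some (fingraph.root adj y).
  apply: h => p /h2[d [d' [e <- <-]]]; rewrite !gE; congr Some.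
  by apply/eqP; rewrite root_connect ?adj_node //; apply: adj_sym.
by move/eqP; rewrite root_connect //; apply: adj_sym.
Qed.

Lemma components_conn ps : components V = 1 ->
  (forall d d', vtx d = vtx d' -> conn ps (label d) (label d')) ->
  {in flatten V &, forall u v, conn ps u v}.
Proof.
move=> c1 h u v /label_ex[x <-] /label_ex[y <-].
have : connect adj x y.
  have rE z : fingraph.root adj z \in [predI fingraph.roots adj & dart V].
    by rewrite !inE fingraph.roots_root //; apply: adj_sym.
  have /card_le1_eqP/(_ _ _ (rE x) (rE y))/eqP : #|[predI fingraph.roots adj & dart V]| <= 1.
    by move: c1; rewrite /components /n_comp_mem => <-; apply: subset_leq_card; apply/subsetP => z.
  by rewrite eq_sym (root_connect adj_sym).
move=> /connectP[p]; elim: p x => [|z p IH] x /=; first by move=> _ ->; apply: conn_refl.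
case/andP=> /orP[] /eqP ez pz /(IH z pz); apply: conn_trans.
  by apply: h; rewrite ez vtx_node.
by rewrite ez (edge_spec x).2 conn_refl.
Qed.

End Darts.

Lemma components_arcs ps : well_labelled (arc_code ps) ->
  components (arc_code ps) = cc ps.
Proof.
move=> wl; apply: components_classes => // [d d' e | p pp].
  have mem (x : dart (arc_code ps)) : vtx x < size ps.
    by have := vtx_lt x; rewrite size_map.
  have lab (x : dart (arc_code ps)) : conn ps (label x) (nth (0, 0) ps (vtx x)).1.
    rewrite /label; have := pos_lt x; rewrite (nth_map (0, 0)) //.
    case: (pos x) => [|[|]] //= _; first exact: conn_refl.
    by rewrite conn_sym; apply/conn_mem/mem_nth.
  apply: conn_trans (lab d) _; rewrite e conn_sym; exact: lab.
have pi : index p ps < size (arc_code ps) by rewrite size_map index_mem.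
have sz : nth [::] (arc_code ps) (index p ps) = [:: p.1; p.2].
  by rewrite (nth_map (0, 0)) ?index_mem // nth_index.
have [|d dv dp] := dart_ex pi (j := 0); first by rewrite sz.
have [|d' dv' dp'] := dart_ex pi (j := 1); first by rewrite sz.
by exists d, d'; rewrite /label dv dv' dp dp' sz.
Qed.

Section Faces.
Variables (V : code) (kappa : dart V -> bool).
Hypotheses (wl : well_labelled V) (chk : checkerboard kappa).

Lemma kappa_face d : kappa (face d) = kappa d. Proof. by case: (chk d). Qed.
Lemma kappa_node d : kappa (node d) = ~~ kappa d. Proof. by case: (chk d). Qed.
Lemma kappa_nodeV d : kappa (nodeV d) = ~~ kappa d.
Proof. by rewrite -{2}[d](nodeVK) kappa_node negbK. Qed.
Lemma kappa_edge d : kappa (edge d) = ~~ kappa d.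
Proof. by rewrite -(kappa_face (edge d)) /face (edgeK wl) kappa_nodeV. Qed.

(** Every edge has one end of each colour, so labels correspond to darts of colour [b]. A face of
    this colour is walked by [edge], which keeps the label, followed by [nodeV] at a dart of the
    other colour; the arcs of [ps] record exactly these turns. *)
Lemma faces_classes b ps :
  (forall d, kappa d = ~~ b -> conn ps (label d) (label (nodeV d))) ->
  (forall p, p \in ps -> exists2 d, kappa d = ~~ b &
     p = (label d, label (nodeV d)) \/ p = (label (nodeV d), label d)) ->
  n_comp (frel (@face V)) [pred d | kappa d == b] = classes (flatten V) ps.
Proof.
move=> h1 h2.
have fs : connect_sym (frel (@face V)) := fconnect_sym (face_inj wl).
apply: (n_comp_classes (h := @label V)) => //.
- by move=> x y /= /eqP <-; rewrite !inE kappa_face.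
- by move=> d _; apply: label_in.
- move=> l /label_ex[d <-]; have [db|db] := eqVneq (kappa d) b.
    by exists d; rewrite // inE db eqxx.
  exists (edge d); last by case: (edge_spec wl d).
  by rewrite inE kappa_edge; case: (kappa d) (b) db => -[].
move=> x y; rewrite !inE => /eqP xb /eqP yb; apply/idP/idP.
  move=> /connectP[p]; elim: p x xb => [|z p IH] x xb /=; first by move=> _ ->; apply: conn_refl.
  case/andP=> /eqP ez pz yl.
  have zb : kappa z = b by rewrite -ez kappa_face.
  apply: conn_trans (IH z zb pz yl).
  rewrite -ez -(edge_spec wl x).2; apply: h1.
  by rewrite kappa_edge xb.
pose g l := omap (fingraph.root (frel (@face V))) [pick d : dart V | (label d == l) && (kappa d == b)].
have gE d : kappa d = b -> g (label d) = Some (fingraph.root (frel (@face V)) d).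
  move=> db; rewrite /g; case: pickP => [d' /andP[/eqP e /eqP d'b] | /(_ d)]; last by rewrite db !eqxx.
  congr Some; congr fingraph.root; case: (edge_unique wl e) => // e'.
  by move: d'b; rewrite e' kappa_edge db; case: (b).
move=> /(@conn_elim _ g); rewrite !gE // => h.
have [] : Some (fingraph.root (frel (@face V)) x) = Some (fingraph.root (frel (@face V)) y).
  apply: h => p /h2[d dk pE].
  suff e : g (label d) = g (label (nodeV d)) by case: pE => -> /=.
  rewrite -(edge_spec wl d).2 !gE ?kappa_edge ?kappa_nodeV ?dk ?negbK //.
  congr Some; apply/eqP; rewrite root_connect //; apply: connect1 => /=.
  by rewrite /face (edgeK wl).
by move/eqP; rewrite root_connect.
Qed.

Lemma faces_split : fcard (@face V) (dart V) =
  n_comp (frel (@face V)) [pred d | kappa d == false] +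
  n_comp (frel (@face V)) [pred d | kappa d == true].
Proof.
have cl : closed (frel (@face V)) [pred d | kappa d == false].
  by move=> x y /= /eqP <-; rewrite !inE kappa_face.
rewrite (n_compC [pred d | kappa d == false]); congr (_ + _).
by apply: eq_n_comp_r => d; rewrite !inE; case: (kappa d).
Qed.

End Faces.

(** * Circles of the Kauffman states *)

(** Seen from a crossing with arms a, b, c, d, the arcs [ps] amount to [k] closed circles and two
    strands. The strands being oriented, a and c are never joined to each other, so that only two
    pairings are possible. The inequalities keep the two strands apart even when one of them shrinks
    to a single label. *)
Definition oriented_nf (ps : seq (nat * nat)) (a b c d : nat) :=
  exists k b' d',
   [/\ (b' = b /\ d' = d) \/ (b' = d /\ d' = b), a != d', c != b' &
    forall qs, {subset [:: a; b; c; d] <= labels qs} ->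
      (forall x, x \in labels ps -> x \notin [:: a; b; c; d] -> x \notin labels qs) ->
      cc (ps ++ qs) = k + cc [:: (a, b'), (c, d') & qs]].

Lemma oriented_nf_sym ps a b c d : oriented_nf ps c d a b -> oriented_nf ps a b c d.
Proof.
move=> [k [d' [b' [bd cb ad h]]]]; exists k, b', d'; split=> //.
  by case: bd => -[-> ->]; [left | right].
move=> qs sub fr; rewrite h; first by congr addn; apply: cc_eq_mem => p; rewrite !inE orbCA.
  by move=> x; rewrite !inE => H; apply: sub; move: H; rewrite !inE; do 4!case: (x == _).
by move=> x xp xE; apply: fr xp _; move: xE; rewrite !inE; do 4!case: (x == _).
Qed.

Section Step.
Variables (ps : seq (nat * nat)) (x a b c d : nat).
Hypotheses (xa : x != a) (xc : x != c) (aN : a \notin labels ps).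

(** One step back along the arc (x, a), after which x plays the role of a. Either x is already the
    end b' and the strand is complete, or x is an inner label and can be erased. *)
Lemma oriented_nf_step qs b' d' : (b' = b /\ d' = d) \/ (b' = d /\ d' = b) ->
  x != d' -> {subset [:: a; b; c; d] <= labels qs} ->
  (x \notin [:: a; b; c; d] -> x \notin labels qs) ->
  cc [:: (x, b'), (c, d'), (x, a) & qs] = cc [:: (a, b'), (c, d') & qs].
Proof.
move=> bd xd sub fr; have [e | xb] := eqVneq x b'.
  have ain : a \in labels qs by apply: sub; rewrite !inE eqxx.
  have bin : b' \in labels qs.
    by case: bd => -[-> _]; apply: sub; rewrite !inE eqxx ?orbT.
  rewrite e; apply: eq_cc.
  - move=> l; rewrite !labels_cons !inE; case: (eqVneq l b') => [->|]; rewrite ?orbT ?bin ?orbT //.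
    by case: (eqVneq l a) => [->|] //; rewrite ain ?orbT.
  - move=> p; rewrite !inE => /or4P[/eqP->|/eqP->|/eqP->|pq]; first exact: conn_refl.
    + by apply: (@conn_mem _ (c, d')); rewrite !inE eqxx orbT.
    + by rewrite conn_sym; apply: (@conn_mem _ (a, b')); rewrite !inE eqxx.
    + by apply: conn_mem; rewrite !inE pq !orbT.
  - move=> p; rewrite !inE => /or3P[/eqP->|/eqP->|pq].
    + by rewrite conn_sym; apply: (@conn_mem _ (b', a)); rewrite !inE eqxx !orbT.
    + by apply: (@conn_mem _ (c, d')); rewrite !inE eqxx !orbT.
    + by apply: conn_mem; rewrite !inE pq !orbT.
have xN : x \notin labels qs.
  apply: fr; rewrite !inE !negb_or xa xc /=.
  by case: bd xb xd => -[-> ->] -> ->.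
transitivity (cc [:: (a, x), (x, b'), (c, d') & qs]); last first.
  by apply: cc_elim => //; rewrite labels_cons !inE !negb_or xc xd.
rewrite [RHS]cc_flip; apply: cc_eq_mem => p.
by rewrite !inE; do 3!case: (p == _).
Qed.

End Step.

Lemma mem_labels_unzip ps x : (x \in labels ps) = (x \in unzip1 ps) || (x \in unzip2 ps).
Proof.
by elim: ps => //= -[a b] ps IH; rewrite labels_cons !inE IH /=; do 4!case: (_ \in _) || case: (_ == _).
Qed.

(* following the oriented arcs from one free end to the other *)
Lemma oriented_nfP ps a b c d : uniq (unzip1 ps ++ [:: a; c]) ->
  perm_eq (unzip1 ps ++ [:: a; c]) (unzip2 ps ++ [:: b; d]) ->
  oriented_nf ps a b c d.
Proof.
move: {2}(size ps).+1 (ltnSn (size ps)) => n.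
elim: n ps a b c d => // n IH ps a b c d; rewrite ltnS => ps_n u pe.
(* If [a'] is not one of the leaving ends, it is the target of an arc of [ps]; this arc is removed
   and the walk goes on from its source. *)
have step a' c' b' d' : uniq (unzip1 ps ++ [:: a'; c']) ->
    perm_eq (unzip1 ps ++ [:: a'; c']) (unzip2 ps ++ [:: b'; d']) ->
    a' \notin [:: b'; d'] -> oriented_nf ps a' b' c' d'.
  move=> {}u {}pe aN.
  have : a' \in unzip2 ps.
    have : a' \in unzip2 ps ++ [:: b'; d'] by rewrite -(perm_mem pe) mem_cat !inE eqxx orbT.
    by rewrite mem_cat (negbTE aN) orbF.
  case/mapP=> -[x y] xps /= ay; rewrite -{y}ay in xps.
  have ep := perm_to_rem xps; set qs := rem _ ps in ep.
  have e1 : perm_eq (unzip1 ps) (x :: unzip1 qs) := perm_map fst ep.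
  have e2 : perm_eq (unzip2 ps) (a' :: unzip2 qs) := perm_map snd ep.
  have u' : uniq (x :: a' :: unzip1 qs ++ [:: c']).
    rewrite -(perm_uniq (s1 := unzip1 ps ++ [:: a'; c'])) //.
    by apply/permP => q; rewrite /= !count_cat (permP e1) /=; clear; lia.
  have u2 : uniq (a' :: unzip2 qs ++ [:: b'; d']).
    rewrite -(perm_uniq (s1 := unzip1 ps ++ [:: a'; c'])) //.
    by apply: perm_trans pe _; apply/permP => q; rewrite /= !count_cat (permP e2) /=; clear; lia.
  have [k [b1 [d1 [bd xd cb h]]]] : oriented_nf qs x b' c' d'.
    apply: IH.
    - by move: ps_n; rewrite (perm_size ep).
    - rewrite -(perm_uniq (s1 := x :: unzip1 qs ++ [:: c'])).
        by move: u' => /=; rewrite inE negb_or -andbA => /and4P[_ -> _ ->].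
      by apply/permP => q; rewrite /= !count_cat /=; clear; lia.
    - apply/permP => q; move: (permP pe q); rewrite !count_cat (permP e1) (permP e2) /=.
      by clear; move: (count _ _) (count _ _) (nat_of_bool _) => *; lia.
  have [xa xc aq] : [/\ x != a', x != c' & a' \notin labels qs].
    move: u' u2; rewrite /= !mem_cat !inE !mem_cat !inE !negb_or mem_labels_unzip negb_or.
    by case/andP=> /and3P[-> _ ->] /andP[/andP[-> _] _] /andP[/andP[-> _] _].
  exists k, b1, d1; split=> //.
    by case: bd aN => -[_ ->]; rewrite !inE negb_or => /andP[].
  move=> rs sub fr.
  have xps1 : x \in labels ps by rewrite (perm_mem (labels_perm ep)) labels_cons mem_head.
  rewrite -(@oriented_nf_step x a' b' c' d') //; last by move=> xE; apply: fr.
  rewrite -h.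
  - apply: cc_eq_mem => p; rewrite mem_cat (perm_mem ep) !(inE, mem_cat).
    by do 3!case: (_ \in _) || case: (_ == _).
  - move=> l; rewrite labels_cons !inE.
    case: (eqVneq l x) => //= _ lE; apply/orP; right; apply: sub.
    by rewrite !inE lE orbT.
  - move=> l lq lE; rewrite labels_cons !inE !negb_or.
    have la : l != a' by apply: contraNneq aq => <-.
    move: lE; rewrite !inE negb_or => /andP[-> lE]; rewrite la /=; apply: fr.
      by rewrite (perm_mem (labels_perm ep)) labels_cons !inE lq !orbT.
    by rewrite !inE negb_or la.
have [aN | ] := boolP (a \notin [:: b; d]); first exact: step.
rewrite negbK => aE; have [cN | ] := boolP (c \notin [:: b; d]).
  apply: oriented_nf_sym; apply: step.
  - by rewrite -(perm_uniq (s1 := unzip1 ps ++ [:: a; c])) // perm_cat2l (perm_catC [:: a] [:: c]).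
  - apply: (@perm_trans _ (unzip1 ps ++ [:: a; c])).
      by rewrite perm_cat2l (perm_catC [:: c] [:: a]).
    by apply: perm_trans pe _; rewrite perm_cat2l (perm_catC [:: b] [:: d]).
  - by move: cN; rewrite !inE orbC.
rewrite negbK => cE.
have u2 : uniq (unzip2 ps ++ [:: b; d]) by rewrite -(perm_uniq pe).
have ac : a != c by move: u; rewrite cat_uniq /= inE => /and3P[_ _ /andP[]].
(* Now a and c are themselves the ends b and d, in some order, and [ps] consists of circles that
   avoid all four arms. *)
have fr l : l \in labels ps -> l \notin [:: a; b; c; d].
  rewrite mem_labels_unzip => lp.
  have eE z : (z \in [:: b; d]) = (z \in [:: a; c]).
    move: aE cE ac; rewrite !inE.
    by move=> /orP[] /eqP -> /orP[] /eqP ->; rewrite ?eqxx // orbC.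
  have -> : (l \in [:: a; b; c; d]) = (l \in [:: a; c]).
    have -> : (l \in [:: a; b; c; d]) = (l \in [:: a; c]) || (l \in [:: b; d]).
      by rewrite !inE; case: (l == a); case: (l == b); case: (l == c).
    by rewrite eE orbb.
  apply/negP => lE; case/orP: lp => lp.
    by move: u; rewrite cat_uniq => /and3P[_ /hasPn/(_ l lE)]; rewrite lp.
  by move: u2; rewrite cat_uniq => /and3P[_ /hasPn/(_ l)]; rewrite eE lE lp => /(_ isT).
have base b' d' : (b' = b /\ d' = d) \/ (b' = d /\ d' = b) -> a = b' -> c = d' ->
    oriented_nf ps a b c d.
  move=> bd ab cd; exists (cc ps), b', d'; split=> //; rewrite -?ab -?cd // 1?eq_sym //.
  move=> qs sub fq; rewrite cc_disjoint => [|l lp]; last by apply: fq => //; apply: fr.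
  have al : a \in labels qs by apply: sub; rewrite !inE eqxx.
  have cl : c \in labels qs by apply: sub; rewrite !inE eqxx !orbT.
  have cl' : c \in labels ((c, c) :: qs) by rewrite labels_cons mem_head.
  have al' : a \in labels ((c, c) :: qs) by rewrite labels_cons !inE al !orbT.
  by rewrite cc_dup ?conn_refl // cc_dup ?conn_refl.
move: aE cE; rewrite !inE => /orP[] /eqP ab /orP[] /eqP cd.
- by rewrite ab cd eqxx in ac.
- by apply: (base b d) => //; left.
- by apply: (base d b) => //; right.
- by rewrite ab cd eqxx in ac.
Qed.

Definition arm0 (x : crossing) := x.1.1.1.
Definition arm1 (x : crossing) := x.1.1.2.
Definition arm2 (x : crossing) := x.1.2.
Definition arm3 (x : crossing) := x.2.

(* the smoothings of a crossing all of whose arms a, c arrive and b, d leave *)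
Definition smoothing (s : bool) (x : crossing) : seq (nat * nat) :=
  if s then [:: (arm0 x, arm1 x); (arm2 x, arm3 x)]
  else [:: (arm0 x, arm3 x); (arm2 x, arm1 x)].

Section Circles.
Variables (I : finType) (y : I -> crossing).
Implicit Types (S B : {set I}) (P : seq I) (i : I).

Definition ins P := flatten [seq [:: arm0 (y i); arm2 (y i)] | i <- P].
Definition outs P := flatten [seq [:: arm1 (y i); arm3 (y i)] | i <- P].
Definition smoothings P S := flatten [seq smoothing (i \in S) (y i) | i <- P].

Lemma smoothings_cons i P S :
  smoothings (i :: P) S = smoothing (i \in S) (y i) ++ smoothings P S.
Proof. by []. Qed.

Lemma smoothings_in P S p : (p \in smoothings P S) =
  has (fun i => p \in smoothing (i \in S) (y i)) P.
Proof. by elim: P => // i P IH; rewrite smoothings_cons mem_cat IH. Qed.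

Lemma smoothings_perm P Q S : perm_eq P Q -> perm_eq (smoothings P S) (smoothings Q S).
Proof. by move=> e; apply/perm_flatten/perm_map. Qed.

Lemma unzip1_smoothings P S : unzip1 (smoothings P S) = ins P.
Proof.
elim: P => // i P IH.
rewrite smoothings_cons /unzip1 map_cat -/(unzip1 (smoothings P S)) IH.
by rewrite /smoothing; case: (_ \in _).
Qed.

Lemma unzip2_smoothings P S : perm_eq (unzip2 (smoothings P S)) (outs P).
Proof.
elim: P => // i P IH.
rewrite smoothings_cons /unzip2 map_cat; apply: perm_cat; last exact: IH.
rewrite /smoothing; case: (_ \in _) => /=; first exact: perm_refl.
by rewrite (perm_catC [:: arm3 (y i)] [:: arm1 (y i)]).
Qed.

Lemma eq_smoothings P S B : {in P, forall i, (i \in S) = (i \in B)} ->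
  smoothings P S = smoothings P B.
Proof. by move=> e; congr flatten; apply/eq_in_map => i iP; rewrite e. Qed.

Hypothesis uniq_ins : uniq (ins (enum I)).
Hypothesis ins_outs : perm_eq (ins (enum I)) (outs (enum I)).

(** By the two hypotheses above, every edge arrives at one of its ends and leaves from the other.
    This is the alternating orientation of a checkerboard coloured diagram, and both smoothings
    respect it. *)
Definition circles S := cc (smoothings (enum I) S).

Lemma labels_smoothings S : labels (smoothings (enum I) S) =i ins (enum I).
Proof.
move=> x; rewrite mem_labels_unzip unzip1_smoothings.
by rewrite (perm_mem (unzip2_smoothings _ _)) -(perm_mem ins_outs) orbb.
Qed.

Lemma arms_ins i : {subset [:: arm0 (y i); arm1 (y i); arm2 (y i); arm3 (y i)]
  <= ins (enum I)}.
Proof.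
have h (f : crossing -> seq nat) x : x \in f (y i) ->
    x \in flatten [seq f (y j) | j <- enum I].
  by move=> xf; apply/flatten_mapP; exists i; rewrite ?mem_enum.
move=> x; rewrite !inE => /or4P[] /eqP ->.
- by apply: (h (fun x => [:: arm0 x; arm2 x])); rewrite !inE eqxx.
- by rewrite (perm_mem ins_outs); apply: (h (fun x => [:: arm1 x; arm3 x])); rewrite !inE eqxx.
- by apply: (h (fun x => [:: arm0 x; arm2 x])); rewrite !inE eqxx orbT.
- by rewrite (perm_mem ins_outs); apply: (h (fun x => [:: arm1 x; arm3 x])); rewrite !inE eqxx orbT.
Qed.

Lemma perm_enum_rem i : perm_eq (enum I) (i :: rem i (enum I)).
Proof. by apply: perm_to_rem; rewrite mem_enum. Qed.

Lemma nf_smoothings i S :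
  oriented_nf (smoothings (rem i (enum I)) S)
    (arm0 (y i)) (arm1 (y i)) (arm2 (y i)) (arm3 (y i)).
Proof.
have pe := perm_enum_rem i.
have pi : perm_eq (ins (enum I)) (ins (rem i (enum I)) ++ [:: arm0 (y i); arm2 (y i)]).
  exact: perm_trans (perm_flatten (perm_map _ pe)) (permEl (perm_catC [:: _; _] _)).
have po : perm_eq (outs (enum I)) (outs (rem i (enum I)) ++ [:: arm1 (y i); arm3 (y i)]).
  exact: perm_trans (perm_flatten (perm_map _ pe)) (permEl (perm_catC [:: _; _] _)).
apply: oriented_nfP; rewrite unzip1_smoothings; first by rewrite -(perm_uniq pi).
rewrite perm_sym; apply: (@perm_trans _ (outs (enum I))).
  by rewrite perm_sym (perm_trans po) // perm_cat2r perm_sym unzip2_smoothings.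
by rewrite perm_sym (perm_trans _ ins_outs) // perm_sym.
Qed.

Lemma uniq_arms i : arm0 (y i) != arm2 (y i) /\ arm1 (y i) != arm3 (y i).
Proof.
have u2 : uniq (outs (enum I)) by rewrite -(perm_uniq ins_outs).
have pe := perm_enum_rem i; move: uniq_ins u2.
rewrite (perm_uniq (perm_flatten (perm_map _ pe))) /= => /andP[].
rewrite inE negb_or => /andP[-> _] _.
rewrite (perm_uniq (perm_flatten (perm_map _ pe))) /= => /andP[].
by rewrite inE negb_or => /andP[-> _].
Qed.

Lemma cc_four a b c d : cc [:: (a, b); (c, d); (a, d); (c, b)] = 1.
Proof.
apply: (@classes1 a); first by rewrite !labels_cons mem_head.
set ps := [:: _; _; _; _].
have m p : p \in ps -> conn ps p.1 p.2 := @conn_mem ps p.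
have ab : conn ps a b by apply: (m (a, b)); rewrite !inE eqxx.
have ad : conn ps a d by apply: (m (a, d)); rewrite !inE eqxx !orbT.
have ac : conn ps a c.
  by apply: conn_trans ad _; rewrite conn_sym; apply: (m (c, d)); rewrite !inE eqxx orbT.
move=> l; rewrite {1}/ps !labels_cons labels_nil !inE orbC /=.
by do 7?[case/orP]; move=> // /eqP -> //; apply: conn_refl.
Qed.

Lemma cc_two a b c d : a != c -> b != d -> a != d -> c != b ->
  cc [:: (a, b); (c, d); (a, b); (c, d)] = 2.
Proof.
move=> ac bd ad cb.
have one u v : cc [:: (u, v)] = 1.
  apply: (@classes1 u); first by rewrite !labels_cons mem_head.
  move=> l; rewrite !labels_cons labels_nil !inE => /orP[] /eqP ->; first exact: conn_refl.
  by apply: (@conn_mem _ (u, v)); rewrite mem_head.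
rewrite (@cc_eq_mem _ ([:: (a, b)] ++ [:: (c, d)])) => [|p]; last first.
  by rewrite !inE; do 2!case: (p == _).
rewrite cc_disjoint ?one // => l.
rewrite !labels_cons labels_nil !inE => /orP[] /eqP ->; rewrite negb_or.
  by rewrite ac ad.
by rewrite bd eq_sym cb.
Qed.

Lemma smoothings_rem i S :
  smoothings (enum I) S =i smoothing (i \in S) (y i) ++ smoothings (rem i (enum I)) S.
Proof. by move=> p; rewrite (perm_mem (smoothings_perm S (perm_enum_rem i))). Qed.

Lemma smoothings_remU1 i S :
  smoothings (rem i (enum I)) (i |: S) = smoothings (rem i (enum I)) S.
Proof.
apply: eq_smoothings => j; rewrite mem_rem_uniq ?enum_uniq // inE => /andP[ji _].
by rewrite in_setU1 (negbTE ji).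
Qed.

(* outside crossing i the state S is a smoothing of i and k circles *)
Lemma circles_nf i S : i \notin S ->
  exists k (up : bool),
  [/\ circles (i |: S) = k + up.+1, circles S = k + (~~ up).+1,
      (arm0 (y i) != if up then arm3 (y i) else arm1 (y i)) &&
      (arm2 (y i) != if up then arm1 (y i) else arm3 (y i)) &
      forall qs,
        {subset [:: arm0 (y i); arm1 (y i); arm2 (y i); arm3 (y i)] <= labels qs} ->
        (forall x, x \in labels (smoothings (rem i (enum I)) S) ->
           x \notin [:: arm0 (y i); arm1 (y i); arm2 (y i); arm3 (y i)] ->
           x \notin labels qs) ->
        cc (smoothings (rem i (enum I)) S ++ qs) = k + cc (smoothing up (y i) ++ qs)].
Proof.
move=> iS; have [k [b' [d' [bd ad cb h]]]] := nf_smoothings i S.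
have [ac nbd] := uniq_arms i; exists k; rewrite /smoothing.
set a := arm0 (y i) in h bd ad cb ac nbd *; set c := arm2 (y i) in h bd ad cb ac nbd *.
set b := arm1 (y i) in h bd ad cb ac nbd *; set d := arm3 (y i) in h bd ad cb ac nbd *.
have hq qs : labels qs =i [:: a; b; c; d] ->
    cc (qs ++ smoothings (rem i (enum I)) S) = k + cc [:: (a, b'), (c, d') & qs].
  move=> qsl; rewrite -h => [|x|x xl]; rewrite ?qsl //.
  by apply: cc_eq_mem => p; rewrite !mem_cat orbC.
have lS : circles S = k + cc [:: (a, b'); (c, d'); (a, d); (c, b)].
  rewrite -hq; last by move=> x; rewrite !inE; do 4!case: (x == _).
  by apply: cc_eq_mem => p; rewrite (smoothings_rem i) (negbTE iS).
have lSi : circles (i |: S) = k + cc [:: (a, b'); (c, d'); (a, b); (c, d)].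
  rewrite -hq; last by move=> x; rewrite !inE; do 4!case: (x == _).
  by apply: cc_eq_mem => p; rewrite (smoothings_rem i) setU11 smoothings_remU1.
case: bd => -[eb ed]; subst b' d'; [exists true | exists false].
  by split; rewrite ?lS ?lSi ?cc_four ?cc_two ?ad ?cb.
split; rewrite ?lS ?lSi ?ad ?cb //.
- by rewrite (cc_four a d c b).
- by rewrite cc_two // eq_sym.
Qed.

(** With only two pairings outside the crossing, resmoothing it either splits one circle or merges
    two. A circle that stays a single circle, as may happen without a checkerboard colouring, is
    excluded. *)
Lemma circles_step i S : i \notin S ->
  (circles (i |: S) = (circles S).+1 /\
     conn (smoothings (enum I) S) (arm0 (y i)) (arm2 (y i))) \/
  circles S = (circles (i |: S)).+1.
Proof.
move=> iS; have [k [up [lSi lS _ h]]] := circles_nf iS.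
case: up lSi lS h => lSi lS h; last by right; rewrite lS lSi addnS.
left; split; first by rewrite lS lSi addnS.
set a := arm0 (y i) in h *; set c := arm2 (y i) in h *.
set b := arm1 (y i) in h *; set d := arm3 (y i) in h *.
(* The extra arc (a, c) does not change the count k + 1 of the state S, so a and c lie on one circle
   of S. *)
have lSc : cc ((a, c) :: smoothings (enum I) S) = k + 1.
  have <- : cc ([:: (a, b); (c, d)] ++ [:: (a, d); (c, b); (a, c)]) = 1.
    rewrite -(cc_four a b c d) -(@cc_dup a c [:: (a, b); (c, d); (a, d); (c, b)]).
    - by apply: cc_eq_mem => p; rewrite !inE; do 5!case: (p == _).
    - by apply: (classes1_conn (cc_four a b c d)); rewrite !labels_cons !inE !eqxx ?orbT.
    - by rewrite !labels_cons !inE eqxx.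
    - by rewrite !labels_cons !inE eqxx ?orbT.
  apply: etrans (h [:: (a, d); (c, b); (a, c)] _ _) => [|x|x _].
  - apply: cc_eq_mem => p; rewrite inE (smoothings_rem i) (negbTE iS) !mem_cat !inE.
    by rewrite -/a -/b -/c -/d; do 3!case: (p == _); rewrite ?orbT ?orbF.
  - by rewrite !labels_cons labels_nil !inE; do 4!case: (x == _).
  - by apply: contra; rewrite !labels_cons labels_nil !inE; do 4!case: (x == _).
have ic : {subset [:: a; c] <= labels (smoothings (enum I) S)}.
  move=> x xj; rewrite labels_smoothings; apply: (@arms_ins i).
  by move: xj; rewrite !inE => /orP[] ->; rewrite ?orbT.
have := @classes_cons (labels (smoothings (enum I) S)) a c (smoothings (enum I) S).
rewrite !ic ?inE ?eqxx ?orbT // => /(_ isT isT); rewrite -/(cc _) -/(circles S) lS.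
have -> : classes (labels (smoothings (enum I) S)) ((a, c) :: smoothings (enum I) S) =
    cc ((a, c) :: smoothings (enum I) S).
  apply: eq_classes => // x; rewrite labels_cons !inE.
  by case: (eqVneq x a) => [->|_] /=; [|case: (eqVneq x c) => [->|_] //];
    rewrite ic // !inE eqxx ?orbT.
by rewrite lSc; case: (conn _ _ _) => //=; lia.
Qed.

(** * Genus of the surface made of the circles of a state and of bands *)

Definition chords S := [seq (arm0 (y i), arm2 (y i)) | i <- enum S].

(** The components are those of the surface made of discs bounded by the circles of the state B and
    of a band at each crossing of S; outside B, arms 0 and 2 lie on the two strands that the band
    joins. *)
Definition glued B S := smoothings (enum I) B ++ chords S.

Lemma labels_glued B S : labels (glued B S) =i ins (enum I).
Proof.
move=> x; rewrite labels_cat mem_cat labels_smoothings; apply/orb_idr.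
rewrite mem_labels => /hasP[p /mapP[i _ ->] /= /orP[] /eqP ->]; apply: (@arms_ins i).
  by rewrite !inE eqxx.
by rewrite !inE eqxx !orbT.
Qed.

Lemma mem_glued B S p : (p \in glued B S) =
  (p \in smoothings (enum I) B) || (p \in chords S).
Proof. exact: mem_cat. Qed.

Lemma chord_in i S : i \in S -> (arm0 (y i), arm2 (y i)) \in chords S.
Proof. by move=> iS; apply/mapP; exists i; rewrite ?mem_enum. Qed.

Lemma glued_sub B S S' : S \subset S' -> {subset glued B S <= glued B S'}.
Proof.
move=> /subsetP sub p; rewrite !mem_glued => /orP[-> // | /mapP[i]].
by rewrite mem_enum => /sub iS' ->; rewrite chord_in ?orbT.
Qed.

Lemma cc_glued_step B S i : i \notin S ->
  cc (glued B S) = cc (glued B (i |: S)) + ~~ conn (glued B S) (arm0 (y i)) (arm2 (y i)).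
Proof.
move=> iS; rewrite {1}/cc (classes_cons (a := arm0 (y i)) (b := arm2 (y i))).
- congr addn; apply: eq_classes_sub => [x|p|p].
  + by rewrite !labels_glued.
  + rewrite inE => /predU1P[->|/(glued_sub (subsetUr [set i] S))/conn_mem //].
    by apply: (@conn_mem _ (_, _)); rewrite mem_glued chord_in ?setU11 ?orbT.
  + rewrite mem_glued => /orP[ps | /mapP[j]].
      by apply: conn_mem; rewrite inE mem_glued ps orbT.
    rewrite mem_enum in_setU1 => /predU1P[-> -> | jS ->].
      by apply: (@conn_mem _ (_, _)); rewrite mem_head.
    by apply: conn_mem; rewrite inE mem_glued chord_in ?orbT.
- by rewrite labels_glued; apply: (@arms_ins i); rewrite !inE eqxx.
- by rewrite labels_glued; apply: (@arms_ins i); rewrite !inE eqxx !orbT.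
Qed.

Lemma smoothing_in i S p : p \in smoothing (i \in S) (y i) -> p \in smoothings (enum I) S.
Proof. by move=> h; rewrite smoothings_in; apply/hasP; exists i; rewrite ?mem_enum. Qed.

Lemma conn_glued_arms i B S : i \notin B -> i \in S ->
  [/\ conn (glued B S) (arm0 (y i)) (arm1 (y i)),
      conn (glued B S) (arm0 (y i)) (arm2 (y i)) &
      conn (glued B S) (arm0 (y i)) (arm3 (y i))].
Proof.
move=> iB iS.
have ac : conn (glued B S) (arm0 (y i)) (arm2 (y i)).
  by apply: (@conn_mem _ (_, _)); rewrite mem_glued chord_in ?orbT.
have sm p : p \in smoothing false (y i) -> conn (glued B S) p.1 p.2.
  by move=> h; apply: conn_mem; rewrite mem_glued (@smoothing_in i) ?(negbTE iB).
have ad : conn (glued B S) (arm0 (y i)) (arm3 (y i)).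
  by apply: (sm (_, _)); rewrite !inE eqxx.
have cb : conn (glued B S) (arm2 (y i)) (arm1 (y i)).
  by apply: (sm (_, _)); rewrite !inE eqxx orbT.
by split=> //; apply: conn_trans ac cb.
Qed.

Lemma conn_smoothings_glued B S u v : [disjoint B & S] ->
  conn (smoothings (enum I) (B :|: S)) u v -> conn (glued B S) u v.
Proof.
move=> dis; apply: conn_sub => p; rewrite smoothings_in => /hasP[i _].
have [iS | iS] := boolP (i \in S).
  have iB : i \notin B by rewrite (disjointFl dis iS).
  have [ab ac ad] := conn_glued_arms iB iS.
  rewrite in_setU iS orbT /= !inE => /orP[] /eqP -> //=.
  by apply: conn_trans ad; rewrite conn_sym.
rewrite in_setU (negbTE iS) orbF => /smoothing_in h.
by apply: conn_mem; rewrite mem_glued h.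
Qed.

(* Euler's inequality for the surface obtained from the faces of the state B
   by gluing a band at each crossing of S *)
Lemma defect_step B S i : [disjoint B & i |: S] -> i \notin S ->
  (cc (glued B S)).*2 + #|S| + circles (B :|: (i |: S)) <=
  (cc (glued B (i |: S))).*2 + #|i |: S| + circles (B :|: S).
Proof.
move=> dis iS; have iB : i \notin B by rewrite (disjointFl dis) // setU11.
have disS : [disjoint B & S] by apply: disjointWr dis; apply: subsetUr.
have iBS : i \notin B :|: S by rewrite in_setU negb_or iB.
rewrite cardsU1 iS (cc_glued_step B iS) setUCA.
have [[-> /(conn_smoothings_glued disS) ->] | ->] := circles_step iBS.
  by rewrite /= addn0; lia.
by case: (conn _ _ _) => /=; lia.
Qed.

(** After its boundary circles are capped by discs, the surface has genus g with 2 g = 2 cc + |S| -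
    circles B - circles (B u S). Adding bands never lowers the genus. *)
Lemma defect_mono B S S' : [disjoint B & S'] -> S \subset S' ->
  (cc (glued B S)).*2 + #|S| + circles (B :|: S') <=
  (cc (glued B S')).*2 + #|S'| + circles (B :|: S).
Proof.
move=> dis sub; move: {2}#|S' :\: S| (erefl #|S' :\: S|) => n.
elim: n S sub => [|n IH] S sub.
  move/eqP; rewrite cards_eq0 setD_eq0 => sub'.
  by have/eqP -> : S == S' by rewrite eqEsubset sub.
move=> cn; have /card_gt0P[i] : 0 < #|S' :\: S| by rewrite cn.
rewrite in_setD => /andP[iS iS'].
have sub' : i |: S \subset S' by rewrite subUset sub1set iS'.
have cn' : #|S' :\: (i |: S)| = n.
  have := cardsD1 i (S' :\: S); rewrite cn in_setD iS iS' => -[->].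
  by congr #|pred_of_set _|; apply/setP => x; rewrite !inE negb_or andbA.
have h1 := IH _ sub' cn'.
have h2 := defect_step (disjointWr sub' dis) iS.
by move: h1 h2; clear; move: (cc _) (cc _) (cc _) (circles _) (circles _) (circles _) => *; lia.
Qed.

Section Planar.
Hypothesis planar_circles :
  circles set0 + circles setT = #|I| + (cc (glued set0 setT)).*2.

Lemma cc_glued0 B : cc (glued B set0) = circles B.
Proof. by rewrite /glued /chords enum_set0 cats0. Qed.

(** The genus is 0 without bands and, by [planar_circles], with all bands, hence for every S in
    between. This is Euler's formula for the Tait graph with the edges S, whose faces are the
    circles of S. *)
Lemma planar_defect S :
  (cc (glued set0 S)).*2 + #|S| = circles S + circles set0.
Proof.
have dis S' : [disjoint set0 & S' : {set I}] by rewrite -setI_eq0 set0I.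
have h1 := @defect_mono set0 set0 S (dis _) (sub0set _).
have h2 := @defect_mono set0 S setT (dis _) (subsetT _).
move: h1 h2 planar_circles; rewrite !set0U cc_glued0 cards0 cardsT.
by clear; move: (cc _) (cc _) (circles _) (circles _) (circles _) #|S| #|I| => *; lia.
Qed.

(** In genus 0 a new band splits a circle as soon as it joins a component to itself, that is when
    the new edge closes a cycle of the Tait graph. *)
Lemma circles_up S i : i \notin S ->
  (circles (i |: S) == (circles S).+1) =
  conn (glued set0 S) (arm0 (y i)) (arm2 (y i)).
Proof.
move=> iS; have h1 := planar_defect S; have h2 := planar_defect (i |: S).
have h3 := cc_glued_step set0 iS; move: h1 h2; rewrite cardsU1 iS h3.
case: (conn _ _ _); rewrite /= ?addn0 => h1 h2; [apply/eqP | apply/negbTE/eqP]; move: h1 h2;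
  clear; move: (cc _) (circles _) (circles _) (circles _) #|S| => *; lia.
Qed.

Lemma circles_mono S S' i : S \subset S' -> i \notin S' ->
  circles (i |: S) == (circles S).+1 -> circles (i |: S') == (circles S').+1.
Proof.
move=> sub iS'; have iS : i \notin S by apply: contra iS'; apply: subsetP.
by rewrite !circles_up //; apply/conn_subset/glued_sub.
Qed.

Lemma circles_gt0 S i : 0 < circles S.
Proof.
apply: (@cc_gt0 _ (arm0 (y i))); rewrite labels_smoothings.
by apply: (@arms_ins i); rewrite !inE eqxx.
Qed.

Variable e : I.
Hypothesis connected : forall ps, (forall i, i != e ->
   [/\ conn ps (arm0 (y i)) (arm1 (y i)), conn ps (arm0 (y i)) (arm2 (y i)) &
       conn ps (arm0 (y i)) (arm3 (y i))]) ->
  {in ins (enum I) &, forall u v, conn ps u v}.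

Lemma glued_connected B S : (forall i, i != e -> (i \notin B) && (i \in S)) ->
  cc (glued B S) = 1.
Proof.
move=> h; apply: (@classes1 (arm0 (y e))).
  by rewrite labels_glued; apply: (@arms_ins e); rewrite !inE eqxx.
move=> l; rewrite labels_glued => ll; apply: connected => //.
  by move=> i /h/andP[iB iS]; apply: conn_glued_arms.
by apply: (@arms_ins e); rewrite !inE eqxx.
Qed.

Lemma circles_planar : circles set0 + circles setT = #|I| + 2.
Proof. by rewrite planar_circles glued_connected // => i; rewrite !inE. Qed.

(** A loop at e would disconnect the tangle. The genus inequality is used with base state [[set e]]:
    the bands at the other crossings give a connected surface, which bounds the number of circles of
    [[set e]] from above. *)
Lemma circles_not_loop : circles [set e] != (circles set0).+1.
Proof.
have dis : [disjoint [set e] & [set~ e]].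
  by rewrite disjoints1 !inE eqxx.
have := @defect_mono [set e] set0 [set~ e] dis (sub0set _).
rewrite cc_glued0 cards0 setUCr setU0 glued_connected => [|i ie]; last by rewrite !inE ie.
rewrite cardsC1; have := circles_planar.
have : 0 < #|I| by apply/card_gt0P; exists e.
clear; move: (circles _) (circles _) (circles _) #|I| => a b c d *; apply/eqP; lia.
Qed.

Lemma circles_not_bridge : circles (e |: [set~ e]) == (circles [set~ e]).+1.
Proof.
rewrite circles_up ?inE ?eqxx //.
have h : cc (glued set0 [set~ e]) = 1 by apply: glued_connected => i ie; rewrite !inE ie.
apply: (classes1_conn h); rewrite labels_glued; apply: (@arms_ins e);
  by rewrite !inE eqxx ?orbT.
Qed.

End Planar.

End Circles.

Lemma crossing_seqE x : crossing_seq x = [:: arm0 x; arm1 x; arm2 x; arm3 x].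
Proof. by case: x => [[[a b] c] d]. Qed.

(** * Tait graph and Euler's formula of a tangle together with its outside *)

Section Tangle.
Variable T : tangle.
Let xs := tcrossings T.
Let n := size xs.

(* the outside of the disk as a crossing, turned so that its arms arrive and
   leave in the same order as those of the other crossings *)
Definition outer : crossing :=
  let: (e0, e1, e2, e3) := ends T in (e1, e0, e3, e2).

Definition tvertex (i : 'I_n.+1) : crossing := nth outer xs i.

Let V := capped T.

Lemma size_capped : size V = n.+1.
Proof.
by rewrite /V /capped; case: (ends T) => [[[e0 e1] e2] e3]; rewrite size_rcons size_map.
Qed.

(** Rotated by one, [outer] becomes the last row [:: e0; e3; e2; e1] of [capped]. This rotation is
    the reason for the extra parity in [kappaE]. *)
Lemma capped_row i : i < n.+1 ->
  nth [::] V i = rot (i == n) (crossing_seq (nth outer xs i)).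
Proof.
rewrite /V /capped /outer ltnS leq_eqVlt; case: (ends T) => [[[e0 e1] e2] e3].
rewrite nth_rcons size_map -/n; case: eqVneq => [-> _ | _ /= lt].
  by rewrite ltnn nth_default.
by rewrite lt rot0 (nth_map (e1, e0, e3, e2)).
Qed.

Variable kappa : dart V -> bool.
Hypothesis wl : well_labelled V.
Hypothesis chk : checkerboard kappa.
Hypothesis kappaE : forall d, kappa d = odd (pos d) (+) (vtx d == n).

Lemma vtx_capped (d : dart V) : vtx d < n.+1.
Proof. by rewrite -size_capped vtx_lt. Qed.

Lemma pos_capped (d : dart V) : pos d < 4.
Proof. by have := pos_lt d; rewrite capped_row ?vtx_capped // size_rot crossing_seqE. Qed.

Lemma label_capped (d : dart V) : label d =
  nth 0 (rot (vtx d == n) (crossing_seq (nth outer xs (vtx d)))) (pos d).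
Proof. by rewrite /label capped_row ?vtx_capped. Qed.

Lemma dart_cases (d : dart V) x : x = nth outer xs (vtx d) ->
  (label d, label (nodeV d)) \in
    if kappa d then [:: (arm1 x, arm0 x); (arm3 x, arm2 x)]
    else [:: (arm0 x, arm3 x); (arm2 x, arm1 x)].
Proof.
move=> xE; rewrite kappaE !label_capped vtx_nodeV pos_nodeV capped_row ?vtx_capped //.
rewrite size_rot -xE crossing_seqE; have := pos_capped d.
by case: (pos d) => [|[|[|[|//]]]] _; case: (vtx d == n) => /=; rewrite !inE eqxx ?orbT.
Qed.

Lemma dart_ex_capped i (b : bool) (p : nat * nat) : i < n.+1 ->
  let x := nth outer xs i in
  p \in (if b then [:: (arm1 x, arm0 x); (arm3 x, arm2 x)]
         else [:: (arm0 x, arm3 x); (arm2 x, arm1 x)]) ->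
  exists d : dart V, [/\ vtx d = i, kappa d = b & p = (label d, label (nodeV d))].
Proof.
move=> iN x; have sz : size (nth [::] V i) = 4.
  by rewrite capped_row // size_rot crossing_seqE.
have iV : i < size V by rewrite size_capped.
have ex j : j < 4 -> exists2 d : dart V, vtx d = i & pos d = j.
  by rewrite -sz; apply: dart_ex.
have get j : j < 4 -> odd j (+) (i == n) = b ->
    p = (nth 0 (rot (i == n) (crossing_seq x)) j,
         nth 0 (rot (i == n) (crossing_seq x)) ((j + 4).-1 %% 4)) ->
    exists d : dart V, [/\ vtx d = i, kappa d = b & p = (label d, label (nodeV d))].
  move=> /ex[d di dj] kb pE; exists d; split=> //.
    by rewrite kappaE di dj.
  by rewrite !label_capped vtx_nodeV pos_nodeV di dj sz.
rewrite crossing_seqE in get; case: b (i == n) get => [] [] get;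
  rewrite !inE => /orP[] /eqP pE;
  [ apply: (get 0) | apply: (get 2) | apply: (get 1) | apply: (get 3)
  | apply: (get 3) | apply: (get 1) | apply: (get 0) | apply: (get 2) ]; rewrite ?pE //.
Qed.

Lemma mem_flatten_capped l : (l \in flatten V) =
  has (fun i : 'I_n.+1 => l \in crossing_seq (tvertex i)) (enum 'I_n.+1).
Proof.
apply/idP/hasP => [/label_ex[d <-] | [i _ li]].
  exists (Ordinal (vtx_capped d)); rewrite ?mem_enum // /tvertex /=.
  rewrite label_capped; set s := rot _ _.
  have <- : s =i crossing_seq (nth outer xs (vtx d)) by move=> x; rewrite mem_rot.
  by rewrite mem_nth // size_rot crossing_seqE pos_capped.
apply/flattenP; exists (nth [::] V i); first by rewrite mem_nth // size_capped.
by rewrite capped_row // mem_rot.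
Qed.

Lemma card_kappa l b : l \in flatten V ->
  #|[pred d : dart V | (label d == l) && (kappa d == b)]| = 1.
Proof.
move=> /label_ex[d0 d0l].
have [d dl db] : exists2 d : dart V, label d = l & kappa d = b.
  have [e|e] := eqVneq (kappa d0) b; first by exists d0.
  exists (edge d0); first by case: (edge_spec wl d0) => _ ->.
  by rewrite kappa_edge //; case: (kappa d0) b e => [] [].
rewrite -(card1 d); apply: eq_card => d'; rewrite !inE.
apply/andP/eqP => [[/eqP d'l /eqP d'b] | ->]; last by rewrite dl db !eqxx.
have := edge_unique wl (etrans d'l (esym dl)); case=> // e.
by move: d'b; rewrite e kappa_edge // db; case: (b).
Qed.

Lemma sum_capped (f : nat -> nat -> nat) :
  \sum_(d : dart V) f (vtx d) (pos d) =
  \sum_(i < n.+1) (f i 0 + f i 1 + f i 2 + f i 3).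
Proof.
rewrite sum_darts -(big_mkord xpredT (fun i => \sum_(j < size (nth [::] V i)) f i j)).
rewrite size_capped big_mkord; apply: eq_bigr => i _.
rewrite -(big_mkord xpredT) capped_row // size_rot crossing_seqE /=.
by rewrite !big_nat_recr //= big_geq.
Qed.

(** Darts that carry a shaded corner leave and the others arrive; since an edge has one end of each
    colour, the colouring yields the alternating orientation. *)
Lemma count_side (b : bool) l :
  count_mem l (if b then outs tvertex (enum 'I_n.+1) else ins tvertex (enum 'I_n.+1)) =
  #|[pred d : dart V | (label d == l) && (kappa d == b)]|.
Proof.
rewrite -sum1_card big_mkcond /=.
pose f i j := if (nth 0 (rot (i == n) (crossing_seq (nth outer xs i))) j == l) &&
   (odd j (+) (i == n) == b) then 1 else 0.
rewrite (eq_bigr (fun d => f (vtx d) (pos d))) => [|d _]; last first.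
  by rewrite inE label_capped kappaE.
rewrite sum_capped.
transitivity (\sum_(i < n.+1) (if b then (arm1 (tvertex i) == l) + (arm3 (tvertex i) == l)
   else (arm0 (tvertex i) == l) + (arm2 (tvertex i) == l))).
  case: (b); rewrite /ins /outs count_flatten sumnE 2!big_map big_enum;
    by apply: eq_bigr => i _ /=; rewrite addn0.
apply: eq_bigr => i _; rewrite /f /tvertex crossing_seqE.
by case: (_ == n); case: (b) => /=; rewrite ?andbT ?andbF; do 2!case: (_ == l).
Qed.

Lemma ins_flatten l : (l \in ins tvertex (enum 'I_n.+1)) = (l \in flatten V).
Proof.
apply/idP/idP => [|lV]; last first.
  by rewrite -has_pred1 has_count (count_side false) card_kappa.
rewrite mem_flatten_capped => /flatten_mapP[i iP li]; apply/hasP; exists i => //.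
by rewrite crossing_seqE; move: li; rewrite !inE => /orP[] ->; rewrite ?orbT.
Qed.

Lemma outs_flatten l : (l \in outs tvertex (enum 'I_n.+1)) = (l \in flatten V).
Proof.
apply/idP/idP => [|lV]; last first.
  by rewrite -has_pred1 has_count (count_side true) card_kappa.
rewrite mem_flatten_capped => /flatten_mapP[i iP li]; apply/hasP; exists i => //.
by rewrite crossing_seqE; move: li; rewrite !inE => /orP[] ->; rewrite ?orbT.
Qed.

Lemma uniq_ins_tangle : uniq (ins tvertex (enum 'I_n.+1)).
Proof.
apply/count_mem_uniq => l; have [lV|lV] := boolP (l \in flatten V).
  by rewrite (count_side false) card_kappa // ins_flatten lV.
by rewrite ins_flatten (negbTE lV); apply/count_memPn; rewrite ins_flatten.
Qed.

Lemma ins_outs_tangle : perm_eq (ins tvertex (enum 'I_n.+1)) (outs tvertex (enum 'I_n.+1)).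
Proof.
apply/allP => l _ /=; have [lV|lV] := boolP (l \in flatten V).
  by rewrite (count_side false) (count_side true) !card_kappa.
by rewrite !(count_memPn _) // ?ins_flatten ?outs_flatten.
Qed.

Lemma classes_flatten ps : labels ps =i ins tvertex (enum 'I_n.+1) ->
  classes (flatten V) ps = cc ps.
Proof. by move=> e; apply: eq_classes => // l; rewrite e ins_flatten. Qed.

(** The smoothing [false] joins the two arms at each shaded corner, so its circles run around the
    shaded faces. Hence [set0] gives the vertices of the Tait graph, and dually [setT] gives its
    faces. *)
Lemma shaded_faces : n_comp (frel (@face V)) [pred d | kappa d == true] =
  circles tvertex set0.
Proof.
rewrite (faces_classes (ps := smoothings tvertex (enum 'I_n.+1) set0) wl chk).
- by apply: classes_flatten; apply/labels_smoothings/ins_outs_tangle.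
- move=> d dk; have := @dart_cases d _ erefl; rewrite dk => h.
  apply: (@conn_mem _ (_, _)); apply: (@smoothing_in _ tvertex (Ordinal (vtx_capped d))).
  by rewrite in_set0.
- move=> p; rewrite smoothings_in => /hasP[i _]; rewrite in_set0 => pi.
  have [d [_ dk pE]] := @dart_ex_capped i false p (ltn_ord i) pi.
  by exists d => //; left.
Qed.

Lemma unshaded_faces : n_comp (frel (@face V)) [pred d | kappa d == false] =
  circles tvertex setT.
Proof.
rewrite (faces_classes (ps := smoothings tvertex (enum 'I_n.+1) setT) wl chk).
- by apply: classes_flatten; apply/labels_smoothings/ins_outs_tangle.
- move=> d dk; have := @dart_cases d _ erefl; rewrite dk => h.
  rewrite conn_sym; apply: (@conn_mem _ (_, _)).
  apply: (@smoothing_in _ tvertex (Ordinal (vtx_capped d))); rewrite in_setT /smoothing.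
  by move: h; rewrite !inE !xpair_eqE => /orP[] /andP[-> ->]; rewrite ?orbT.
- move=> [u v]; rewrite smoothings_in => /hasP[i _]; rewrite in_setT => pi.
  have [|d [_ dk [eu ev]]] := @dart_ex_capped i true (v, u) (ltn_ord i).
    by move: pi; rewrite !inE !xpair_eqE => /orP[] /andP[-> ->]; rewrite ?orbT.
  by exists d => //; right; rewrite eu ev.
Qed.

Lemma size_ins : size (ins tvertex (enum 'I_n.+1)) = n.+1.*2.
Proof.
rewrite /ins size_flatten sumnE /shape 2!big_map big_enum /=.
by rewrite big_const iter_addn_0 card_ord mul2n.
Qed.

Lemma fcard_edge : fcard (@edge V) (dart V) = n.+1.*2.
Proof.
have es : connect_sym (frel (@edge V)) := fconnect_sym (can_inj (edgeK wl)).
rewrite (n_comp_classes (h := @label V) (vs := flatten V) (ps := [::]) es) //.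
- rewrite /classes map_id -size_ins; apply/perm_size/uniq_perm.
  + exact: undup_uniq.
  + exact: uniq_ins_tangle.
  + by move=> l; rewrite mem_undup ins_flatten.
- by move=> d _; apply: label_in.
- by move=> l /label_ex[d <-]; exists d.
move=> x y _ _; apply/idP/eqP => /= [|e].
  move=> /connectP[p]; elim: p x => [|z p IH] x /=; first by move=> _ ->.
  by case/andP=> /eqP <- pz /(IH _ pz) <-; rewrite (edge_spec wl x).2.
by case: (edge_unique wl e) => ->; rewrite ?connect0 // es connect1 //= ?eqxx.
Qed.

Lemma card_dart : #|dart V| = n.+1 * 4.
Proof.
rewrite -sum1_card (sum_capped (fun _ _ => 1)) /= big_const iter_addn_0.
by rewrite card_ord mulnC.
Qed.

Lemma components_capped : components V = cc (glued tvertex set0 setT).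
Proof.
rewrite (components_classes (ps := glued tvertex set0 setT) wl).
- by apply: classes_flatten; apply/labels_glued/ins_outs_tangle.
- have h (d : dart V) : conn (glued tvertex set0 setT)
      (arm0 (tvertex (Ordinal (vtx_capped d)))) (label d).
    have [|ab ac ad] := @conn_glued_arms _ tvertex (Ordinal (vtx_capped d)) set0 setT _ (in_setT _).
      by rewrite in_set0.
    have : label d \in crossing_seq (tvertex (Ordinal (vtx_capped d))).
      rewrite label_capped -(mem_rot (vtx d == n)) mem_nth // size_rot crossing_seqE.
      exact: pos_capped.
    by rewrite crossing_seqE !inE => /or4P[] /eqP -> //; apply: conn_refl.
  move=> d d' e; apply: conn_trans (h d'); rewrite conn_sym.
  by rewrite (_ : Ordinal (vtx_capped d') = Ordinal (vtx_capped d)) //; apply/val_inj.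
move=> p; have ex (i : 'I_n.+1) l : l \in crossing_seq (tvertex i) ->
    exists2 d : dart V, vtx d = i & label d = l.
  move=> li; have iV : i < size V by rewrite size_capped.
  have lr : l \in nth [::] V i by rewrite capped_row // mem_rot.
  have [|d di dj] := @dart_ex V i (index l (nth [::] V i)) iV; first by rewrite index_mem.
  by exists d => //; rewrite /label di dj nth_index.
have two (i : 'I_n.+1) u v : u \in crossing_seq (tvertex i) ->
    v \in crossing_seq (tvertex i) -> p = (u, v) ->
    exists d d' : dart V, [/\ vtx d = vtx d', label d = p.1 & label d' = p.2].
  by move=> /ex[d di <-] /ex[d' di' <-] ->; exists d, d'; rewrite di di'.
rewrite mem_glued smoothings_in => /orP[/hasP[i _] | /mapP[i _ pE]].
  by rewrite in_set0 !inE => /orP[] /eqP pE; apply: (two i _ _ _ _ pE);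
    rewrite crossing_seqE !inE eqxx ?orbT.
by apply: (two i _ _ _ _ pE); rewrite crossing_seqE !inE eqxx ?orbT.
Qed.

Lemma planar_circles_tangle : planar V ->
  circles tvertex set0 + circles tvertex setT =
  #|'I_n.+1| + (cc (glued tvertex set0 setT)).*2.
Proof.
rewrite /planar size_capped fcard_edge (faces_split chk) shaded_faces unshaded_faces.
rewrite card_dart components_capped card_ord => /eqP.
by clear; move: (circles _ _) (circles _ _) (cc _) => *; lia.
Qed.

End Tangle.

(** In [W] the strands stop at four vertices of degree one, so that connections pass through
    crossings of T only and never through the outside of the disk. *)
Lemma tangle_conn T ps : well_labelled (capped T) -> tangle_connected T ->
  (forall x, x \in tcrossings T ->
   [/\ conn ps (arm0 x) (arm1 x), conn ps (arm0 x) (arm2 x) & conn ps (arm0 x) (arm3 x)]) ->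
  {in flatten (capped T) &, forall u v, conn ps u v}.
Proof.
move=> wl; rewrite /tangle_connected; case E: (ends T) => [[[e0 e1] e2] e3] cW h.
pose es := [:: [:: e0]; [:: e1]; [:: e2]; [:: e3]].
pose W := map crossing_seq (tcrossings T) ++ es.
have Wf : perm_eq (flatten (capped T)) (flatten W).
  rewrite /capped E /W -cats1 !flatten_cat perm_cat2l /=.
  by apply/permP => p /=; clear; lia.
have wlW : well_labelled W := well_labelled_perm Wf wl.
move=> u v; rewrite !(perm_mem Wf); apply: components_conn => // d d' e.
have rowW j : nth [::] W j = if j < size (tcrossings T)
    then crossing_seq (nth (outer T) (tcrossings T) j)
    else nth [::] es (j - size (tcrossings T)).
  by rewrite nth_cat size_map; case: ifP => // jT; rewrite (nth_map (outer T)).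
have [dT | dT] := ltnP (vtx d) (size (tcrossings T)).
  have xT := mem_nth (outer T) dT; have [ab ac ad] := h _ xT.
  suff lab (z : dart W) : vtx z = vtx d ->
      conn ps (arm0 (nth (outer T) (tcrossings T) (vtx d))) (label z).
    by apply: conn_trans (lab d' (esym e)); rewrite conn_sym lab.
  move=> zd; have : label z \in crossing_seq (nth (outer T) (tcrossings T) (vtx d)).
    have := pos_lt z; rewrite /label zd rowW dT; exact: mem_nth.
  by rewrite crossing_seqE !inE => /or4P[] /eqP -> //; apply: conn_refl.
have pos0 (z : dart W) : vtx z = vtx d -> pos z = 0.
  move=> zd; have := pos_lt z; rewrite zd rowW ifN -?leqNgt // /es.
  by case: (vtx d - _) => [|[|[|[|[|k]]]]] //=; case: (pos z).
by rewrite (@dart_eq W d d') ?conn_refl // !pos0.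
Qed.

Lemma vertex_parity V (kappa : dart V -> bool) i : checkerboard kappa ->
  size (nth [::] V i) = 4 ->
  exists b, forall d, vtx d = i -> kappa d = odd (pos d) (+) b.
Proof.
move=> chk s4; have [iV | iV] := ltnP i (size V); last first.
  by exists true => d di; have := vtx_lt d; rewrite di ltnNge iV.
have [|d0 d0i d00] := @dart_ex V i 0 iV; first by rewrite s4.
exists (kappa d0) => d; move e: (pos d) => j; elim: j d e => [|j IH] d e di.
  by congr kappa; apply: dart_eq; rewrite ?di ?e.
have pv : pos (nodeV d) = j.
  have := pos_lt d; rewrite pos_nodeV e di s4 => lt.
  by rewrite addSn /= addnC modnDl modn_small // ltnW.
by rewrite -[LHS]negbK -(kappa_nodeV chk) (IH _ pv) //= addNb.
Qed.

(** Exchanging the two colours reduces to a positive crossing, and then every crossing of T has its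
    odd corners shaded. At the outside, matched positions add up to the odd number 3, which reverses
    the parity. *)
Lemma same_type_colouring (L : diagram) (i : 'I_(size (crossings L))) T :
  same_type i T -> exists2 kappa : dart (capped T) -> bool, checkerboard kappa &
    forall d, kappa d = odd (pos d) (+) (vtx d == size (tcrossings T)).
Proof.
move=> [kappa [kappaT [chk chkT ind hp hn]]].
have row : nth [::] (diagram_code L) i = crossing_seq (nth (0, 0, 0, 0) (crossings L) i).
  by rewrite nth_cat size_map ltn_ord (nth_map (0, 0, 0, 0)).
have s4 : size (nth [::] (diagram_code L) i) = 4 by rewrite row crossing_seqE.
have [b kb] := vertex_parity chk s4.
have outerE d : vtx d = size (tcrossings T) -> kappaT d = odd (pos d) (+) ~~ b.
  move=> dn; have p4 : pos d < 4 by have := pos_capped d.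
  have iV : i < size (diagram_code L) by rewrite size_cat size_map ltn_addr.
  have [|d' d'i d'p] := @dart_ex (diagram_code L) i (3 - pos d) iV.
    by rewrite s4 ltnS leq_subr.
  rewrite (ind d' d) ?kb // d'p ?subnK //.
  by rewrite oddB //= addNb addbN.
case: b kb outerE => kb outerE.
  exists (fun d => ~~ kappaT d) => [d|d].
    by have [-> ->] := chkT d.
  have := vtx_capped d; rewrite ltnS leq_eqVlt => /predU1P[dn | dn].
    by rewrite outerE // dn eqxx addbF addbT.
  have ne : negative_edge kappa i by move=> d' d'i; rewrite kb // addbT.
  by rewrite (hn ne _ dn d erefl) negbK (ltn_eqF dn) addbF.
exists kappaT => // d.
have := vtx_capped d; rewrite ltnS leq_eqVlt => /predU1P[dn | dn].
  by rewrite outerE // dn eqxx.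
have pe : positive_edge kappa i by move=> d' d'i; rewrite kb // addbF.
by rewrite (hp pe _ dn d erefl) (ltn_eqF dn) addbF.
Qed.

Import Order.TTheory GRing.Theory Num.Theory.
Local Open Scope ring_scope.

(** * State sums over a planar matroid *)

Section Laurent.
Variables (F : fieldType) (A : F).

Definition delta : F := - A ^+ 2 - A ^- 2.

(** The list is a multiset of exponents of - A^4. All coefficients are positive multiplicities, so
    nothing cancels and the support is the set of members. *)
Definition lsum (s : seq int) : F := \sum_(j <- s) (- A ^+ 4) ^ j.

Lemma lsum_cat s t : lsum (s ++ t) = lsum s + lsum t.
Proof. exact: big_cat. Qed.

Hypothesis A0 : A != 0.

Lemma tau0 : - A ^+ 4 != 0. Proof. by rewrite oppr_eq0 expf_neq0. Qed.

Definition shift (k : int) (s : seq int) := map (fun j => j + k) s.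

Lemma lsum_shift k s : lsum (shift k s) = (- A ^+ 4) ^ k * lsum s.
Proof.
rewrite /lsum big_map mulr_sumr; apply: eq_bigr => j _.
by rewrite expfzDr ?tau0 // mulrC.
Qed.

Lemma lsum_shift1 s : lsum (shift 1 s) = - A ^+ 4 * lsum s.
Proof. by rewrite lsum_shift expr1z. Qed.

Lemma lsum_shiftN1 s : lsum (shift (- 1) s) = - A ^- 4 * lsum s.
Proof. by rewrite lsum_shift exprN1 invrN. Qed.

Lemma delta_loop : A * delta + A^-1 = - A ^+ 3.
Proof. by rewrite /delta; field. Qed.

Lemma delta_bridge : A + A^-1 * delta = - A ^- 3.
Proof. by rewrite /delta; field. Qed.

End Laurent.

Lemma mem_shift k s x : (x \in shift k s) = (x - k \in s).
Proof.
apply/mapP/idP => [[y ys ->] | xs]; first by rewrite addrK.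
by exists (x - k); rewrite ?subrK.
Qed.

Lemma shift_nil k s : (shift k s == [::]) = (s == [::]).
Proof. by case: s. Qed.

(** * Exponent sets that are intervals with at least two elements *)

Definition good (s : seq int) :=
  exists lo hi : int, lo < hi /\ forall x, (x \in s) = (lo <= x <= hi).

Lemma good_eq s t : s =i t -> good s -> good t.
Proof. by move=> st [lo [hi [lh h]]]; exists lo, hi; split=> // x; rewrite -st. Qed.

Lemma good_neq0 s : good s -> s != [::].
Proof. by case=> lo [hi [lh h]]; move: (h lo); rewrite lexx ltW //; case: s {h}. Qed.

Lemma good_shift k s : good s -> good (shift k s).
Proof.
case=> lo [hi [lh h]]; exists (lo + k), (hi + k); split; first by rewrite ltrD2r.
by move=> x; rewrite mem_shift h; lia.
Qed.

Lemma good_cat x s t : good s -> good t -> x \in s -> x \in t -> good (s ++ t).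
Proof.
move=> [l [h [lh sE]]] [l' [h' [lh' tE]]]; rewrite sE tE => xs xt.
exists (if l <= l' then l else l'), (if h <= h' then h' else h).
split; first by case: ifP => ?; case: ifP => ?; lia.
move=> y; rewrite mem_cat sE tE; case: ifP => ?; case: ifP => ?; lia.
Qed.

Lemma good_overlap (k : int) s : `|k| <= 1 -> good s ->
  exists2 x, x \in s & x \in shift k s.
Proof.
move=> k1 [lo [hi [lh h]]]; exists (if k == 1 then hi else lo).
  by rewrite h; case: ifP; lia.
by rewrite mem_shift h; case: ifP; lia.
Qed.

Lemma good_pm s : good s -> good (shift 1 s ++ shift (- 1) s).
Proof.
case=> lo [hi [lh h]]; exists (lo - 1), (hi + 1); split; first by lia.
by move=> x; rewrite mem_cat !mem_shift !h; lia.
Qed.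

(** Shifting a part of the interval upwards can only add the point hi + 1, and it does so exactly
    when hi lies in that part. *)
Lemma good_up s t : good (s ++ t) -> good (shift 1 s ++ (s ++ t)).
Proof.
case=> lo [hi [lh h]].
have sE x : x \in s -> lo <= x <= hi by move=> xs; rewrite -h mem_cat xs.
exists lo, (if hi \in s then hi + 1 else hi); split; first by case: ifP; lia.
move=> x; rewrite mem_cat h mem_shift.
case: (boolP (x - 1 \in s)) => [xs | xs].
  have := sE _ xs; case: (boolP (hi \in s)) => hs; first by lia.
  by have : x - 1 <> hi by [move=> e; rewrite e (negbTE hs) in xs]; lia.
case: (boolP (hi \in s)) => hs; last by lia.
have : x <> hi + 1 by move=> e; rewrite e addrK hs in xs.
by lia.
Qed.

Lemma good_down s t : good (s ++ t) -> good ((s ++ t) ++ shift (- 1) t).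
Proof.
case=> lo [hi [lh h]].
have tE x : x \in t -> lo <= x <= hi by move=> xs; rewrite -h mem_cat xs orbT.
exists (if lo \in t then lo - 1 else lo), hi; split; first by case: ifP; lia.
move=> x; rewrite mem_cat h mem_shift opprK.
case: (boolP (x + 1 \in t)) => [xs | xs].
  have := tE _ xs; case: (boolP (lo \in t)) => hs; first by lia.
  by have : x + 1 <> lo by [move=> e; rewrite e (negbTE hs) in xs]; lia.
case: (boolP (lo \in t)) => hs; last by lia.
have : x <> lo - 1 by move=> e; rewrite e subrK hs in xs.
by lia.
Qed.

(* A Laurent polynomial is represented by its values in all fields: the field of
   fractions of Z[X] gives its coefficients, and roots of unity are available. *)
Definition rep (X : forall F : fieldType, F -> F) (N : int) (s : seq int) :=
  forall (F : fieldType) (A : F), A != 0 -> X F A = A ^ N * lsum A s.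

Section Rep.
Implicit Types (X Y : forall F : fieldType, F -> F).

Lemma rep_ext X Y N s :
  (forall (F : fieldType) (A : F), A != 0 -> X F A = Y F A) ->
  rep Y N s -> rep X N s.
Proof. by move=> XY Yr F A A0; rewrite XY // Yr. Qed.

Lemma repN X N M s : N = M -> rep X N s -> rep X M s.
Proof. by move->. Qed.

Lemma rep_add X Y N s t : rep X (N - 1) s -> rep Y (N + 1) t ->
  rep (fun F A => A * X F A + A^-1 * Y F A) N (s ++ t).
Proof.
move=> Xr Yr F A A0; rewrite Xr // Yr // lsum_cat !expfzDr // exprN1 expr1z.
by field.
Qed.

Lemma rep_mulA X N s : rep X N s -> rep (fun F A => A * X F A) (N + 1) s.
Proof. by move=> Xr F A A0; rewrite Xr // expfzDr // expr1z mulrA (mulrC A). Qed.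

Lemma rep_mulAV X N s : rep X N s -> rep (fun F A => A^-1 * X F A) (N - 1) s.
Proof. by move=> Xr F A A0; rewrite Xr // expfzDr // exprN1 mulrA (mulrC A^-1). Qed.

(** The shifts here and below come from - A^3 = A^-1 (- A^4) and - A^-3 = A (- A^4)^-1. *)
Lemma rep_loop X N s : rep X N s ->
  rep (fun F A => - A ^+ 3 * X F A) (N - 1) (shift 1 s).
Proof.
move=> Xr F A A0; rewrite Xr // expfzDr // exprN1 lsum_shift1 //.
by field.
Qed.

Lemma rep_loopV X N s : rep (fun F A => - A ^+ 3 * X F A) N s ->
  rep X (N + 1) (shift (- 1) s).
Proof.
move=> Xr F A A0; rewrite expfzDr // expr1z lsum_shiftN1 //.
have -> : A ^ N * A * (- A ^- 4 * lsum A s) = - A ^- 3 * (A ^ N * lsum A s).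
  by field.
by rewrite -Xr //; field.
Qed.

Lemma rep_bridge X N s : rep X N s ->
  rep (fun F A => - A ^- 3 * X F A) (N + 1) (shift (- 1) s).
Proof.
move=> Xr F A A0; rewrite Xr // expfzDr // expr1z lsum_shiftN1 //.
by field.
Qed.

Lemma rep_bridgeV X N s : rep (fun F A => - A ^- 3 * X F A) N s ->
  rep X (N - 1) (shift 1 s).
Proof.
move=> Xr F A A0; rewrite expfzDr // exprN1 lsum_shift1 //.
have -> : A ^ N / A * (- A ^+ 4 * lsum A s) = - A ^+ 3 * (A ^ N * lsum A s).
  by field.
by rewrite -Xr //; field.
Qed.

End Rep.

(** * Uniqueness of exponents and multiplicities *)

Lemma laurent_A0 : laurent_A != 0.
Proof. by rewrite /laurent_A tofrac_eq0 polyX_eq0. Qed.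

Lemma laurent_indep (s : seq (int * int)) (n : int) :
  \sum_(p <- s) p.1%:~R * laurent_A ^ p.2 = 0 ->
  \sum_(p <- s | p.2 == n) p.1 = 0.
Proof.
move=> s0.
(* Multiplication by A^M makes all exponents nonnegative, so that coefficients of a polynomial can
   be compared. *)
pose M : int := \sum_(p <- s) `|p.2|.
have Mb p : p \in s -> 0 <= p.2 + M.
  move=> ps; have : `|p.2| <= M.
    rewrite /M (perm_big _ (perm_to_rem ps)) big_cons /= lerDl.
    by apply: sumr_ge0 => q _; apply: normr_ge0.
  by lia.
have : \sum_(p <- s) p.1 *: 'X^(absz (p.2 + M)) = 0 :> {poly int}.
  apply/eqP; rewrite -tofrac_eq0 rmorph_sum /=; apply/eqP.
  rewrite -[RHS](mul0r (laurent_A ^ M)) -[in RHS]s0 mulr_suml.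
  apply: eq_big_seq => p ps.
  rewrite -mulrA -expfzDr ?laurent_A0 // -mul_polyC rmorphM rmorphXn /=.
  congr (_ * _).
    by rewrite -{1}[p.1]intz !rmorph_int.
  by rewrite -/laurent_A -[in RHS](gez0_abs (Mb p ps)).
move=> /(congr1 (fun q : {poly int} => q`_(absz (n + M)))).
rewrite coef0 coef_sum => h.
case: (lerP 0 (n + M)) => nM; last first.
  rewrite big_seq_cond big1 // => p /andP[ps /eqP e].
  by move: (Mb p ps); rewrite e leNgt nM.
rewrite big_mkcond -[RHS]h; apply: eq_big_seq => p ps.
rewrite coefZ coefXn; move: (Mb p ps) => pM.
have -> : (absz (n + M) == absz (p.2 + M)) = (p.2 == n) by lia.
by case: eqP; rewrite ?mulr1 ?mulr0.
Qed.

Lemma lsum_laurent (s : seq int) :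
  lsum laurent_A s =
  \sum_(p <- [seq ((-1) ^ j, 4 * j) | j <- s]) p.1%:~R * laurent_A ^ p.2.
Proof.
rewrite /lsum big_map; apply: eq_bigr => j _ /=.
rewrite -[- laurent_A ^+ 4]mulN1r expfzMl -exprz_exp; congr (_ * _).
by rewrite rmorphXz ?unitrN1 //= rmorphN1.
Qed.

(** Distinct exponents j give distinct powers A^(4 j), and the sign (-1)^j depends on j alone, so
    multiplicities can be read off. It serves to compare two expansions of one state sum. *)
Lemma rep_inj X N s t : rep X N s -> rep X N t -> perm_eq s t.
Proof.
move=> /(_ _ _ laurent_A0) es /(_ _ _ laurent_A0).
rewrite es => /(mulfI (expfz_neq0 N laurent_A0)) st.
apply/allP => k _ /=; apply/eqP.
have := @laurent_indep ([seq ((-1) ^ j, 4 * j) | j <- s] ++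
                        [seq (- (-1) ^ j, 4 * j) | j <- t]) (4 * k).
rewrite !big_cat /= -lsum_laurent st.
have -> : \sum_(p <- [seq (- (-1) ^ j, 4 * j) | j <- t])
     p.1%:~R * laurent_A ^ p.2 = - lsum laurent_A t.
  rewrite lsum_laurent !big_map -sumrN; apply: eq_bigr => j _ /=.
  by rewrite rmorphN /= mulNr.
rewrite subrr => /(_ erefl); rewrite !big_map /=.
have E (u : seq int) (f : int -> int) :
    \sum_(j <- u | 4 * j == 4 * k) f j = f k *+ count_mem k u.
  elim: u => [|j u IH] /=; first by rewrite big_nil.
  rewrite big_cons IH; have -> : (4 * j == 4 * k) = (j == k) by lia.
  by case: eqP => [->|_]; rewrite ?mulrS.
rewrite (E s (fun j => (-1) ^ j)) (E t (fun j => - (-1) ^ j)).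
rewrite mulNrn => /eqP; rewrite subr_eq0.
rewrite -(mulr_natr _ (count_mem k s)) -(mulr_natr _ (count_mem k t)) => /eqP.
have u : (-1) ^ k != 0 :> int by rewrite expfz_neq0.
by move=> /(mulfI u)/eqP; rewrite eqr_nat => /eqP.
Qed.

Lemma expr_predS (F : fieldType) (x : F) n : (0 < n)%N -> x ^+ n = x * x ^+ n.-1.
Proof. by case: n => // n _; rewrite exprS. Qed.

(** The exponent on which both branches of deletion and contraction agree, with c = l C and r
    remaining edges: either branch lowers r by one, contracting a non-loop also lowers c by one, and
    the factors A and A^-1 make up for the difference. *)
Definition expo (c r : nat) : int := 2 * c%:Z - r%:Z.

Lemma expo_delete c r (k : int) : expo c r - k - 1 = expo c r.+1 - k.
Proof. by rewrite /expo; lia. Qed.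

Lemma expo_contract c r (k : int) : expo c r - k + 1 = expo c.+1 r.+1 - k.
Proof. by rewrite /expo; lia. Qed.

Lemma expo_shift c r : expo c r - 3 = expo c r.+1 - 2.
Proof. by rewrite /expo; lia. Qed.

Lemma expo_shift2 c r : expo c r - 2 = expo c.+1 r.+1 - 3.
Proof. by rewrite /expo; lia. Qed.

Lemma expo_par c r : expo c r.+1 - 3 + 1 = expo c.+1 r.+1 - 3 - 1.
Proof. by rewrite /expo; lia. Qed.

Section StateSum.
Variable I : finType.
Implicit Types (C S : {set I}) (R T : seq I) (e f : I).

Section Z.
Variables (F : fieldType) (A : F).

(* the sum of A^(#|S| - #|R minus S|) fin (C :|: S) over the subsets S of R *)
Fixpoint Z C R (fin : {set I} -> F) : F :=
  if R is e :: R' then A * Z (e |: C) R' fin + A^-1 * Z C R' fin else fin C.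

Lemma Z_mul C R c fin : Z C R (fun S => c * fin S) = c * Z C R fin.
Proof. by elim: R C => //= e R IH C; rewrite !IH; ring. Qed.

Lemma Z_lin C R a b (f g : {set I} -> F) :
  Z C R (fun S => a * f S + b * g S) = a * Z C R f + b * Z C R g.
Proof. by elim: R C => //= e R IH C; rewrite !IH; ring. Qed.

Lemma Z_contract C R e fin : Z (e |: C) R fin = Z C R (fun S => fin (e |: S)).
Proof. by elim: R C => //= f R IH C; rewrite setUCA !IH. Qed.

Lemma Z_cons C R e fin :
  Z C (e :: R) fin = Z C R (fun S => A * fin (e |: S) + A^-1 * fin S).
Proof. by rewrite Z_lin /= Z_contract. Qed.

Lemma Z_ext C R (f g : {set I} -> F) :
  (forall S, C \subset S -> S \subset C :|: [set x in R] -> f S = g S) ->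
  Z C R f = Z C R g.
Proof.
elim: R C => [|e R IH] C fg /=.
  by apply: fg; rewrite ?subsetUl.
congr (_ * _ + _ * _); apply: IH => S CS SR; apply: fg.
- exact: subset_trans (subsetUr _ _) CS.
- apply: subset_trans SR _; apply/subsetP => x; rewrite !inE.
  by case: (x == e); case: (x \in C).
- by [].
- apply: subset_trans SR _; apply/subsetP => x; rewrite !inE.
  by case: (x == e); case: (x \in C).
Qed.

Lemma Z_swap C e f R fin : Z C [:: e, f & R] fin = Z C [:: f, e & R] fin.
Proof. by rewrite /= setUCA; ring. Qed.

End Z.

Variable l : {set I} -> nat.
Hypothesis l_gt0 : forall S, (0 < l S)%N.
Hypothesis l_step : forall S e, e \notin S ->
  l (e |: S) = (l S).+1 \/ l S = (l (e |: S)).+1.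

(* l S is the number of circles of the state S.  If the edges e are those of the
   Tait graph, sp S e says that e joins two vertices that are connected by S,
   i.e. that e closes a cycle. *)
Definition sp S e := l (e |: S) == (l S).+1.

Hypothesis sp_mono : forall S (T : {set I}) e, S \subset T -> e \notin T -> sp S e -> sp T e.

Lemma spE S e : sp S e -> l (e |: S) = (l S).+1.
Proof. by move/eqP. Qed.

Lemma nspE S e : e \notin S -> ~~ sp S e -> l S = (l (e |: S)).+1.
Proof. by rewrite /sp => /l_step[->|//]; rewrite eqxx. Qed.

Lemma nsp_mono S (T : {set I}) e :
  S \subset T -> e \notin T -> ~~ sp T e -> ~~ sp S e.
Proof. by move=> ST eT; apply: contra; apply: sp_mono. Qed.

Lemma sp_loop S e f : e != f -> e \notin S -> f \notin S -> sp S e ->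
  sp (e |: S) f = sp S f.
Proof.
move=> ef eS fS se.
have /spE h : sp (f |: S) e.
  by apply: sp_mono se; rewrite ?subsetUr // !inE negb_or ef.
by rewrite /sp setUCA h (spE se) eqSS.
Qed.

Lemma sp_bridge S e f : e != f -> e \notin S -> f \notin S ->
  ~~ sp (f |: S) e -> sp (e |: S) f = sp S f.
Proof.
move=> ef eS fS se.
have efS : e \notin f |: S by rewrite !inE negb_or ef.
have se' := nsp_mono (subsetUr _ _) efS se.
by have := nspE efS se; have := nspE eS se'; rewrite /sp setUCA; lia.
Qed.

Lemma sp_par S e f : sp (e |: S) f -> sp (f |: S) e -> l (e |: S) = l (f |: S).
Proof. by move=> /spE h /spE; rewrite setUCA h => -[]. Qed.

Lemma sp_parC C e f : e \notin C -> f \notin C -> ~~ sp C e -> ~~ sp C f ->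
  sp (e |: C) f -> sp (f |: C) e.
Proof.
move=> eC fC ne nf /spE; rewrite /sp setUCA => ->.
by have := nspE eC ne; have := nspE fC nf; lia.
Qed.

Lemma nsp_ser S e f : e \notin S -> f \notin S -> ~~ sp S e -> ~~ sp S f ->
  l (e |: S) = l (f |: S).
Proof. by move=> eS fS /(nspE eS) h /(nspE fS); rewrite h => -[]. Qed.

(** The state with all remaining edges present. An edge outside it that it does not span is a
    bridge. *)
Definition top C R := C :|: [set x in R].

Lemma top_cons C e R : top C (e :: R) = e |: top C R.
Proof. by apply/setP => x; rewrite !inE orbCA. Qed.

Lemma top_setU1 C e R : top (e |: C) R = e |: top C R.
Proof. by rewrite /top setUA. Qed.

Lemma sub_top C R : C \subset top C R. Proof. exact: subsetUl. Qed.

Lemma notin_mid C R S e : S \subset top C R -> e \notin C -> e \notin R ->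
  e \notin S.
Proof.
move=> /subsetP ST eC eR; apply/negP => /ST.
by rewrite !inE (negbTE eC) (negbTE eR).
Qed.

Lemma Z_perm (F : fieldType) (A : F) C R (T : seq I) fin :
  perm_eq R T -> Z A C R fin = Z A C T fin.
Proof.
have mid C1 R1 e R2 : Z A C1 (R1 ++ e :: R2) fin = Z A C1 (e :: R1 ++ R2) fin.
  elim: R1 C1 => // f R1 IH C1; rewrite [RHS]Z_swap /= !IH /=; ring.
elim: R C T => [|e R IH] C T; first by rewrite perm_sym => /perm_nilP ->.
move=> eT; have eT' : e \in T by rewrite -(perm_mem eT) mem_head.
case/path.splitPr: eT' eT => T1 T2 eT; rewrite mid /=.
have {}eT : perm_eq R (T1 ++ T2).
  by rewrite -(perm_cons e) (perm_trans eT) // perm_sym -cat1s -[e :: T2]cat1s perm_catCA.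
by rewrite !(IH _ _ eT).
Qed.

Section Unpointed.

Definition ufin (F : fieldType) (A : F) S := delta A ^+ (l S).-1.

(* By Euler's formula, the equation says that the graph is connected and planar. *)
Definition unpointed C R :=
  [/\ uniq R, all (fun x => x \notin C) R & (l C + l (top C R) = (size R).+2)%N].

Lemma unpointed_delete C e R :
  unpointed C (e :: R) -> sp (top C R) e -> unpointed C R.
Proof.
case=> /= /andP[_ uR] /andP[_ RC] h /spE; rewrite -top_cons => h'.
by split=> //; lia.
Qed.

Lemma unpointed_contract C e R :
  unpointed C (e :: R) -> ~~ sp C e -> unpointed (e |: C) R.
Proof.
case=> /= /andP[eR uR] /andP[eC RC] h /(nspE eC) h'; split=> //.
  apply/allP => x xR; rewrite !inE negb_or (allP RC) // andbT.
  by apply: contra eR => /eqP <-.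
by move: h; rewrite top_cons top_setU1; lia.
Qed.

End Unpointed.

Section Pointed.

(* The edge e0 stands for the outside of the tangle: its two smoothings are given
   the weights A^-1 * lsum s0 and A * lsum s1 of the smoothings of L. *)
Definition pfin e0 s0 s1 (F : fieldType) (A : F) S :=
  if sp S e0 then delta A ^+ (l S).-1 * (A^-1 * lsum A s0)
  else delta A ^+ (l S).-2 * (A * lsum A s1).

Lemma pfin_loop e0 s0 s1 (F : fieldType) (A : F) S e :
  e != e0 -> e \notin S -> e0 \notin S -> sp S e ->
  pfin e0 s0 s1 A (e |: S) = delta A * pfin e0 s0 s1 A S.
Proof.
move=> ne eS e0S se; rewrite /pfin sp_loop // (spE se).
case: ifP => [s|/negbT/(nspE e0S) ->] /=.
  by rewrite (expr_predS _ (l_gt0 S)) !mulrA.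
by rewrite (expr_predS _ (l_gt0 (e0 |: S))) !mulrA.
Qed.

Lemma pfin_bridge e0 s0 s1 (F : fieldType) (A : F) S e :
  e != e0 -> e \notin S -> e0 \notin S -> ~~ sp (e0 |: S) e ->
  pfin e0 s0 s1 A S = delta A * pfin e0 s0 s1 A (e |: S).
Proof.
move=> ne eS e0S se; have b := sp_bridge ne eS e0S se; rewrite /pfin b.
have {}se : ~~ sp S e by apply: nsp_mono se; rewrite ?subsetUr // !inE negb_or ne.
have e0eS : e0 \notin e |: S by rewrite !inE negb_or eq_sym ne.
rewrite (nspE eS se); case: ifP => [s|].
  by rewrite (expr_predS _ (l_gt0 (e |: S))) !mulrA.
rewrite -b => /negbT/(nspE e0eS) ->.
by rewrite /= (expr_predS _ (l_gt0 (e0 |: (e |: S)))) !mulrA.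
Qed.

Definition pointed e0 C R :=
  [/\ uniq (e0 :: R), all (fun x => x \notin C) (e0 :: R) &
      (l C + l (e0 |: top C R) = (size R).+3)%N].

Lemma pointed_perm e0 C R (T : seq I) : perm_eq R T -> pointed e0 C R -> pointed e0 C T.
Proof.
move=> RT [u a h]; split.
- by rewrite /= -(perm_mem RT) -(perm_uniq RT).
- by rewrite /= -(perm_all _ RT).
- rewrite -(perm_size RT) -h; congr (_ + l (_ |: _))%N.
  by apply/setP => x; rewrite !inE (perm_mem RT).
Qed.

(** Deleting a non-bridge merges two faces and keeps the vertices; dually, contracting a non-loop
    merges two vertices and keeps the faces. Euler's formula survives either way. *)
Lemma pointed_delete e0 C e R :
  pointed e0 C (e :: R) -> sp (e0 |: top C R) e -> pointed e0 C R.
Proof.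
rewrite /pointed top_cons setUCA /= => -[/and3P[e0R eR uR] /and3P[e0C eC RC] h] /spE h'.
split=> /=; last by lia.
  by move: e0R; rewrite inE negb_or => /andP[_ ->].
by rewrite e0C.
Qed.

Lemma pointed_contract e0 C e R :
  pointed e0 C (e :: R) -> ~~ sp C e -> pointed e0 (e |: C) R.
Proof.
rewrite /pointed top_cons top_setU1 /=.
move=> [/and3P[e0R eR uR] /and3P[e0C eC RC] h] /(nspE eC) h'.
move: e0R; rewrite inE negb_or => /andP[ne e0R]; split=> /=; last by lia.
  by rewrite e0R.
rewrite !inE negb_or ne e0C /=.
apply/allP => x xR; rewrite !inE negb_or (allP RC) // andbT.
by apply: contra eR => /eqP <-.
Qed.

Lemma pointedP e0 C e R : pointed e0 C (e :: R) ->
  [/\ e != e0, e \notin C, e0 \notin C, e \notin R & e0 \notin R].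
Proof.
case=> /and3P[]; rewrite inE negb_or eq_sym => /andP[-> ->] -> _ /and3P[-> -> _] _.
by [].
Qed.

Lemma top_notin C R e : e \notin C -> e \notin R -> e \notin top C R.
Proof. by rewrite !inE negb_or => -> ->. Qed.

Lemma Z_loop e0 C e R s0 s1 (F : fieldType) (A : F) : A != 0 ->
  pointed e0 C (e :: R) -> sp C e ->
  Z A C (e :: R) (pfin e0 s0 s1 A) = - A ^+ 3 * Z A C R (pfin e0 s0 s1 A).
Proof.
move=> A0 /pointedP[ne eC e0C eR e0R] se; rewrite -Z_mul Z_cons.
apply: Z_ext => S CS ST; have eS := notin_mid ST eC eR.
rewrite pfin_loop ?(notin_mid ST) ?(sp_mono CS) //.
by rewrite mulrA -mulrDl delta_loop.
Qed.

Lemma Z_bridge e0 C e R s0 s1 (F : fieldType) (A : F) : A != 0 ->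
  pointed e0 C (e :: R) -> ~~ sp (e0 |: top C R) e ->
  Z A C (e :: R) (pfin e0 s0 s1 A) =
  - A ^- 3 * Z A (e |: C) R (pfin e0 s0 s1 A).
Proof.
move=> A0 /pointedP[ne eC e0C eR e0R] se; rewrite -Z_mul Z_cons Z_contract.
apply: Z_ext => S CS ST; have eS := notin_mid ST eC eR.
rewrite [in A^-1 * _](@pfin_bridge e0 s0 s1 _ _ S e) ?(notin_mid ST) //; last first.
  apply: nsp_mono se; first exact: setUS.
  by rewrite in_setU1 negb_or ne top_notin.
by rewrite mulrA -mulrDl delta_bridge.
Qed.

(** Plain deletion and contraction, which asks only that both weights be nonempty. It supplies the
    minors through which supports are later seen to overlap. *)
Lemma pfin_pos e0 C R s0 s1 : s0 != [::] -> s1 != [::] -> pointed e0 C R ->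
  exists2 s, s != [::] & rep (fun F A => Z A C R (pfin e0 s0 s1 A))
    (expo (l C) (size R) - 3) s.
Proof.
move=> n0 n1; elim: R C => [|e R IH] C p.
  case: p => _; rewrite /= andbT => e0C; rewrite /top set_nil setU0 => h.
  case: (boolP (sp C e0)) => se.
    exists s0 => // F A A0; rewrite /= /pfin se; move/spE: se => se.
    have -> : l C = 1%N by lia.
    by rewrite mul1r.
  exists s1 => // F A A0; rewrite /= /pfin (negbTE se); have h' := nspE e0C se.
  have -> : l C = 2 by lia.
  by rewrite mul1r.
have [ne eC e0C eR e0R] := pointedP p.
have eT : e \notin e0 |: top C R by rewrite in_setU1 negb_or ne top_notin.
case: (boolP (sp C e)) => se.
  have se' : sp (e0 |: top C R) e.
    by apply: sp_mono se => //; apply: subset_trans (sub_top C R) (subsetUr _ _).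
  have [s sn sr] := IH _ (pointed_delete p se').
  exists (shift 1 s); first by rewrite shift_nil.
  apply: rep_ext (fun F A A0 => Z_loop _ _ A0 p se) _.
  by apply: repN (rep_loop sr); apply: expo_delete.
have pc := pointed_contract p se; have [s sn sr] := IH _ pc.
have lC := nspE eC se.
case: (boolP (sp (e0 |: top C R) e)) => se'.
  have [t tn tr] := IH _ (pointed_delete p se').
  exists (s ++ t); first by case: (s) sn.
  apply: rep_add; [apply: repN sr | apply: repN tr].
    by rewrite lC -expo_contract addrK.
  by rewrite -expo_delete subrK.
exists (shift (- 1) s); first by rewrite shift_nil.
apply: rep_ext (fun F A A0 => Z_bridge _ _ A0 p se') _.
by apply: repN (rep_bridge sr); rewrite lC expo_contract.
Qed.

(** Where the rest spans e0, the parallel edge e contributes A delta + A^-1 = - A^3, which shifts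
    s0. Elsewhere, taking e puts e0 into the spanned case and leaving it does not, whence s0 ++
    s1. *)
Lemma Z_par e0 C e R s0 s1 (F : fieldType) (A : F) : A != 0 ->
  pointed e0 C (e :: R) -> ~~ sp C e -> ~~ sp C e0 -> sp (e |: C) e0 ->
  Z A C (e :: R) (pfin e0 s0 s1 A) =
  A^-1 * Z A C R (pfin e0 (shift 1 s0) (s0 ++ s1) A).
Proof.
move=> A0 /pointedP[ne eC e0C eR e0R] nC nC0 par; rewrite -Z_mul Z_cons.
have par' := sp_parC eC e0C nC nC0 par.
apply: Z_ext => S CS ST; have eS := notin_mid ST eC eR.
have e0S := notin_mid ST e0C e0R.
have e0eS : e0 \notin e |: S by rewrite in_setU1 negb_or eq_sym ne.
have ee0S : e \notin e0 |: S by rewrite in_setU1 negb_or ne.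
have p1 : sp (e |: S) e0 by apply: sp_mono par => //; apply: setUS.
have p2 : sp (e0 |: S) e by apply: sp_mono par' => //; apply: setUS.
have ll := sp_par p1 p2.
rewrite /pfin p1; case: ifP => [/spE h | /negbT/(nspE e0S) h].
  rewrite lsum_shift1 // ll h /= (expr_predS _ (l_gt0 S)).
  transitivity (delta A ^+ (l S).-1 * A^-1 * (A * delta A + A^-1) * lsum A s0).
    by ring.
  by rewrite delta_loop //; field.
by rewrite lsum_cat -ll in h *; rewrite h /=; field.
Qed.

(** The edges e and e0 form a double edge that alone connects two parts of the graph. Its
    contribution does not depend on the rest and splits off as a factor. *)
Lemma Z_par_ser e0 C e R s0 s1 (F : fieldType) (A : F) : A != 0 ->
  pointed e0 C (e :: R) -> ~~ sp C e -> ~~ sp C e0 -> sp (e |: C) e0 ->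
  ~~ sp (top C R) e0 ->
  Z A C (e :: R) (pfin e0 s0 s1 A) =
  lsum A (s0 ++ s1) * Z A (e0 |: C) R (ufin A).
Proof.
move=> A0 /pointedP[ne eC e0C eR e0R] nC nC0 par ser.
rewrite -Z_mul Z_cons Z_contract.
have par' := sp_parC eC e0C nC nC0 par.
apply: Z_ext => S CS ST; have eS := notin_mid ST eC eR.
have e0S := notin_mid ST e0C e0R.
have e0eS : e0 \notin e |: S by rewrite in_setU1 negb_or eq_sym ne.
have ee0S : e \notin e0 |: S by rewrite in_setU1 negb_or ne.
have p1 : sp (e |: S) e0 by apply: sp_mono par => //; apply: setUS.
have p2 : sp (e0 |: S) e by apply: sp_mono par' => //; apply: setUS.
have ll := sp_par p1 p2.
have n0 : ~~ sp S e0 by apply: nsp_mono ser => //; rewrite top_notin.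
rewrite /pfin /ufin p1 (negbTE n0) ll (nspE e0S n0) lsum_cat /=; by field.
Qed.

(** The dual of [Z_par]: without e the edge e0 is a bridge and has the weight s1, while with e both
    weights are possible. Where e0 stays unspanned even with e, the factor is - A^-3. *)
Lemma Z_ser e0 C e R s0 s1 (F : fieldType) (A : F) : A != 0 ->
  pointed e0 C (e :: R) -> sp (top C (e :: R)) e0 -> ~~ sp (top C R) e0 ->
  Z A C (e :: R) (pfin e0 s0 s1 A) =
  A * Z A (e |: C) R (pfin e0 (s0 ++ s1) (shift (- 1) s1) A).
Proof.
move=> A0 /pointedP[ne eC e0C eR e0R] sT ser.
rewrite -Z_mul Z_cons Z_contract.
have nT : ~~ sp (top C R) e.
  by apply: contra ser => sTe; rewrite -(sp_loop ne) ?top_notin // -top_cons.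
apply: Z_ext => S CS ST; have eS := notin_mid ST eC eR.
have e0S := notin_mid ST e0C e0R.
have n0 : ~~ sp S e0 by apply: nsp_mono ser => //; rewrite top_notin.
have n1 : ~~ sp S e by apply: nsp_mono nT => //; rewrite top_notin.
rewrite /pfin (negbTE n0) (nspE eS n1); case: ifP => [_ | /negbT h].
  by rewrite lsum_cat /=; field.
have e0eS : e0 \notin e |: S by rewrite in_setU1 negb_or eq_sym ne.
rewrite (nspE e0eS h) /= lsum_shiftN1 //.
rewrite (expr_predS _ (l_gt0 (e0 |: (e |: S)))).
set d := delta A ^+ _.
transitivity (d * (A + A^-1 * delta A) * A * lsum A s1); first by ring.
by rewrite delta_bridge //; field.
Qed.

(** A predicate in the bound [n], so that [ufin_good] can be called inside the induction that proves
    it. *)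
Definition pfin_good n := forall R e0 C s0 s1, (size R < n)%N ->
  s0 != [::] -> s1 != [::] -> good (s0 ++ s1) ->
  pointed e0 C R -> ~~ sp C e0 -> sp (top C R) e0 ->
  exists2 s, good s & rep (fun F A => Z A C R (pfin e0 s0 s1 A))
    (expo (l C) (size R) - 3) s.

(** An edge that is neither a loop nor a bridge can serve as e0: it contributes - A^3 when spanned
    and - A^-3 otherwise, which are the weights [shift 1 s] and [shift (- 1) s]. By [good_pm] their
    union is an interval. *)
Lemma ufin_good n R C s : pfin_good n -> (size R <= n)%N ->
  unpointed C R -> good s ->
  exists2 t, good t & rep (fun F A => lsum A s * Z A C R (ufin A))
    (expo (l C) (size R) - 2) t.
Proof.
move=> PT; elim: R C => [|e R IH] C Rn u gs.
  exists s => // F A A0; case: u => _ _; rewrite /top set_nil setU0 => h.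
  have l1 : l C = 1%N by move: h => /=; lia.
  by rewrite /= /ufin l1 mulr1 mul1r.
have [uR0 aR0 h] := u.
have /andP[eR uR] : (e \notin R) && uniq R := uR0.
have /andP[eC RC] : (e \notin C) && all (fun x => x \notin C) R := aR0.
have eT : e \notin top C R by rewrite top_notin.
case: (boolP (sp C e)) => se.
  have sT : sp (top C R) e by apply: sp_mono se => //; apply: sub_top.
  have [t gt tr] := IH _ (ltnW Rn) (unpointed_delete u sT) gs.
  exists (shift 1 t); first exact: good_shift.
  apply: (@rep_ext _ (fun F A => - A ^+ 3 * (lsum A s * Z A C R (ufin A)))).
    move=> F A A0; rewrite [RHS]mulrCA; congr (_ * _).
    rewrite -Z_mul Z_cons; apply: Z_ext => S CS ST; have eS := notin_mid ST eC eR.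
    rewrite /ufin (spE (sp_mono CS eS se)) /= (expr_predS _ (l_gt0 S)).
    by rewrite -delta_loop //; ring.
  by apply: repN (rep_loop tr); apply: expo_delete.
case: (boolP (sp (top C R) e)) => sT; last first.
  have [t gt tr] := IH _ (ltnW Rn) (unpointed_contract u se) gs.
  exists (shift (- 1) t); first exact: good_shift.
  apply: (@rep_ext _ (fun F A => - A ^- 3 * (lsum A s * Z A (e |: C) R (ufin A)))).
    move=> F A A0.
    rewrite [RHS]mulrCA; congr (_ * _).
    rewrite -Z_mul Z_cons Z_contract; apply: Z_ext => S CS ST; have eS := notin_mid ST eC eR.
    have nS := nsp_mono ST eT sT.
    rewrite /ufin (nspE eS nS) /= (expr_predS _ (l_gt0 (e |: S))).
    by rewrite -delta_bridge //; ring.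
  by apply: repN (rep_bridge tr); rewrite (nspE eC se) expo_contract.
have pt : pointed e C R.
  by split; [rewrite /= eR | rewrite /= eC | rewrite -top_cons h].
have n0 : s != [::] := good_neq0 gs.
have [|||||||t gt tr] := @PT R e C (shift 1 s) (shift (- 1) s); rewrite ?shift_nil //.
  exact: good_pm.
exists t => //; apply: repN (_ : rep _ (expo (l C) (size R) - 3) t).
  exact: expo_shift.
move: tr; apply: rep_ext => F A A0; rewrite -Z_mul Z_cons.
apply: Z_ext => S CS ST; have eS := notin_mid ST eC eR.
rewrite /pfin /ufin; case: ifP => [/spE -> | /negbT/(nspE eS) ->].
  rewrite lsum_shift1 // /= (expr_predS _ (l_gt0 S)).
  set d := delta A ^+ _.
  transitivity (d * lsum A s * (A * delta A + A^-1)); first by ring.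
  by rewrite delta_loop //; field.
rewrite lsum_shiftN1 // /= (expr_predS _ (l_gt0 (e |: S))).
set d := delta A ^+ _.
transitivity (d * lsum A s * (A + A^-1 * delta A)); first by ring.
by rewrite delta_bridge //; field.
Qed.

Lemma top_perm C R (T : seq I) : perm_eq R T -> top C R = top C T.
Proof. by move=> RT; apply/setP => x; rewrite !inE (perm_mem RT). Qed.

(* Induction on the number of edges.  A loop or a bridge contributes a unit, and
   an edge parallel to e0 or in series with e0 is absorbed by the weights of e0.
   Otherwise two edges e and f are both contracted or deleted, and the supports
   of the resulting polynomials overlap. *)
Lemma all_pfin_good n : pfin_good n.
Proof.
elim: n => [|n IH] R e0 C s0 s1; first by rewrite ltn0.
rewrite ltnS => Rn s0n s1n gs p nC0 sT0.
(* a distinguished edge may be assumed to come first in R *)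
have front (Q : I -> seq I -> bool) e : e \in R -> Q e (rem e R) ->
  exists f T, [/\ perm_eq R (f :: T), pointed e0 C (f :: T),
    (size T < n)%N, sp (top C (f :: T)) e0 & Q f T].
  move=> eR Qe; exists e, (rem e R); have pe := perm_to_rem eR.
  split=> //; first exact: pointed_perm p.
    by move: Rn; rewrite (perm_size pe).
  by rewrite -(top_perm C pe).
have Zfront f T s : perm_eq R (f :: T) ->
    rep (fun F A => Z A C (f :: T) (pfin e0 s0 s1 A))
      (expo (l C) (size (f :: T)) - 3) s ->
    rep (fun F A => Z A C R (pfin e0 s0 s1 A)) (expo (l C) (size R) - 3) s.
  move=> pe; rewrite -(perm_size pe); apply: rep_ext => F A A0.
  exact: Z_perm.
have [/hasP[e eR se] | /hasPn nloop] := boolP (has (sp C) R).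
  have [f [T [pe {}p Tn {}sT0 {e eR}se]]] := front (fun f _ => sp C f) e eR se.
  have [ne eC e0C eR e0R] := pointedP p.
  have seT : sp (top C T) f by apply: sp_mono se; rewrite ?top_notin ?sub_top.
  have [||s gs' sr] := IH T e0 C s0 s1 Tn s0n s1n gs _ nC0.
  - apply: pointed_delete p _; apply: sp_mono seT; first exact: subsetUr.
    by rewrite in_setU1 negb_or ne top_notin.
  - by rewrite -(sp_loop ne _ _ seT) ?top_notin // -top_cons.
  exists (shift 1 s); first exact: good_shift.
  apply: (Zfront _ _ _ pe); apply: rep_ext (fun F A A0 => Z_loop _ _ A0 p se) _.
  by apply: repN (rep_loop sr); apply: expo_delete.
have [/hasP[e eR se] | /hasPn nbridge] :=
    boolP (has (fun e => ~~ sp (e0 |: top C (rem e R)) e) R).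
  have [f [T [pe {}p Tn {}sT0 {e eR}se]]] :=
    front (fun f T => ~~ sp (e0 |: top C T) f) e eR se.
  have [ne eC e0C eR e0R] := pointedP p.
  have fl : ~~ sp C f by apply: nloop; rewrite (perm_mem pe) mem_head.
  have seC : ~~ sp (e0 |: C) f.
    apply: nsp_mono se; first by rewrite setUS ?sub_top.
    by rewrite in_setU1 negb_or ne top_notin.
  have [|||s gs' sr] := IH T e0 (f |: C) s0 s1 Tn s0n s1n gs.
  - exact: pointed_contract p fl.
  - by rewrite sp_bridge.
  - by rewrite top_setU1 -top_cons.
  exists (shift (- 1) s); first exact: good_shift.
  apply: (Zfront _ _ _ pe); apply: rep_ext (fun F A A0 => Z_bridge _ _ A0 p se) _.
  by apply: repN (rep_bridge sr); rewrite (nspE eC fl) expo_contract.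
have {}nbridge f T : perm_eq R (f :: T) -> sp (e0 |: top C T) f.
  move=> pe; have fR : f \in R by rewrite (perm_mem pe) mem_head.
  have := nbridge f fR; rewrite negbK; congr (sp (_ |: _) _); apply: top_perm.
  by rewrite -(perm_cons f) -(permPl (perm_to_rem fR)).
have [/hasP[e eR se] | /hasPn npar] := boolP (has (fun e => sp (e |: C) e0) R).
  have [f [T [pe {}p Tn {}sT0 {e eR}se]]] :=
    front (fun f _ => sp (f |: C) e0) e eR se.
  have [ne eC e0C eR e0R] := pointedP p.
  have fl : ~~ sp C f by apply: nloop; rewrite (perm_mem pe) mem_head.
  have nb := nbridge _ _ pe.
  case: (boolP (sp (top C T) e0)) => sT.
    have [||||||s gs' sr] := IH T e0 C (shift 1 s0) (s0 ++ s1) Tn.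
    - by rewrite shift_nil.
    - by case: (s0) s0n.
    - exact: good_up.
    - exact: pointed_delete p nb.
    - by [].
    - by [].
    exists s => //.
    apply: (Zfront _ _ _ pe); apply: rep_ext (fun F A A0 => Z_par _ _ A0 p fl nC0 se) _.
    by apply: repN (rep_mulAV sr); apply: expo_delete.
  have [|t gt tr] := @ufin_good n T (e0 |: C) (s0 ++ s1) IH (ltnW Tn) _ gs.
    have := pointed_delete p nb; case=> /= /andP[_ uT] /andP[_ TC] h.
    split=> //.
      apply/allP => x xT; rewrite in_setU1 negb_or (allP TC) // andbT.
      by apply: contra e0R => /eqP <-.
    rewrite top_setU1; move: h (nspE e0C nC0); clear.
    by move: (l _) (l _) (l _) (size _) => *; lia.
  exists t => //.
  apply: (Zfront _ _ _ pe).
  apply: rep_ext (fun F A A0 => Z_par_ser _ _ A0 p fl nC0 se sT) _.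
  by apply: repN tr; rewrite (nspE e0C nC0); apply: expo_shift2.
have [/hasP[e eR se] | /hasPn nser] :=
    boolP (has (fun e => ~~ sp (top C (rem e R)) e0) R).
  have [f [T [pe {}p Tn {}sT0 {e eR}se]]] :=
    front (fun f T => ~~ sp (top C T) e0) e eR se.
  have [ne eC e0C eR e0R] := pointedP p.
  have fR : f \in R by rewrite (perm_mem pe) mem_head.
  have fl := nloop _ fR.
  have [||||||s gs' sr] := IH T e0 (f |: C) (s0 ++ s1) (shift (- 1) s1) Tn.
  - by case: (s0) s0n.
  - by rewrite shift_nil.
  - exact: good_down.
  - exact: pointed_contract p fl.
  - exact: npar.
  - by rewrite top_setU1 -top_cons.
  exists s => //.
  apply: (Zfront _ _ _ pe); apply: rep_ext (fun F A A0 => Z_ser _ _ A0 p sT0 se) _.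
  by apply: repN (rep_mulA sr); rewrite (nspE eC fl) expo_contract.
have {}nser f T : perm_eq R (f :: T) -> sp (top C T) e0.
  move=> pe; have fR : f \in R by rewrite (perm_mem pe) mem_head.
  have := nser f fR; rewrite negbK; congr (sp _ _); apply: top_perm.
  by rewrite -(perm_cons f) -(permPl (perm_to_rem fR)).
(* At least two edges are left: with none, e0 would be both spanned and not spanned by C, and a
   single one would be parallel to e0. *)
case: R Rn p sT0 nloop npar nbridge nser {front Zfront} => [|e [|f R]] Rn p sT0.
- by move: sT0; rewrite /top set_nil setU0 (negbTE nC0).
- move=> _ /(_ e (mem_head _ _)); move: sT0.
  by rewrite top_cons /top set_nil setU0 => ->.
move=> nloop npar nbridge nser.
have pe : perm_eq [:: e, f & R] [:: f, e & R].
  by rewrite -cat1s -[f :: e :: R]cat1s -[e :: R]cat1s -[f :: R]cat1s perm_catCA.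
have [eR fR] : e \in [:: e, f & R] /\ f \in [:: e, f & R].
  by rewrite !inE !eqxx orbT.
have [el fl ep fp] := And4 (nloop e eR) (nloop f fR) (npar e eR) (npar f fR).
have [eb fb] := (nbridge _ _ (perm_refl _), nbridge _ _ pe).
have [es fs] := (nser _ _ (perm_refl _), nser _ _ pe).
have pf := pointed_perm pe p.
have [ee0 eC e0C efR e0fR] := pointedP p.
have [fe0 fC _ feR e0eR] := pointedP pf.
have [ef eR'] : e != f /\ e \notin R by move: efR; rewrite inE negb_or => /andP.
have [_ fR'] : f != e /\ f \notin R by move: feR; rewrite inE negb_or => /andP.
have e0R : e0 \notin R by move: e0fR; rewrite inE negb_or => /andP[].
have pCe := pointed_contract p el; have pCf := pointed_contract pf fl.
have pDe := pointed_delete p eb.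
(* Contracting e, deleting e or contracting f leaves e0 neither a loop nor a bridge, as no edge is
   parallel to e0 or in series with it. *)
have [||s gs' sr] := IH (f :: R) e0 (e |: C) s0 s1 _ s0n s1n gs pCe ep.
- by [].
- by rewrite top_setU1 -top_cons.
have [|t gt tr] := IH (f :: R) e0 C s0 s1 _ s0n s1n gs pDe nC0 es.
- by [].
have [||u gu ur] := IH (e :: R) e0 (f |: C) s0 s1 _ s0n s1n gs pCf fp.
- by [].
- by rewrite top_setU1 -top_cons -(top_perm _ pe).
have lCe := nspE eC el; have lCf := nspE fC fl.
have eT : e \notin e0 |: top C R by rewrite in_setU1 negb_or ee0 top_notin.
have fT : f \notin e0 |: top C R by rewrite in_setU1 negb_or fe0 top_notin.
have join w : good (s ++ w) -> rep (fun F A => Z A C (f :: R) (pfin e0 s0 s1 A))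
    (expo (l C) (size (f :: R)) - 3) w ->
  exists2 s, good s & rep (fun F A => Z A C [:: e, f & R] (pfin e0 s0 s1 A))
    (expo (l C) (size [:: e, f & R]) - 3) s.
  move=> gw wr; exists (s ++ w) => //; apply: rep_add.
    by apply: repN sr; rewrite [in RHS]lCe -expo_contract addrK.
  by apply: repN wr; rewrite -[in RHS]expo_delete subrK.
(* For parallel e and f, both contractions give the same sum over R, and contracting e turns f into
   a loop; that sum therefore has the support [shift (- 1) s]. *)
have [par | npf] := boolP (sp (e |: C) f).
  have par' := sp_parC eC fC el fl par.
  have ef_eq (F : fieldType) (A : F) :
      Z A (f |: C) R (pfin e0 s0 s1 A) = Z A (e |: C) R (pfin e0 s0 s1 A).
    rewrite !Z_contract; apply: Z_ext => S CS ST.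
    have [eS fS e0S] := And3 (notin_mid ST eC eR') (notin_mid ST fC fR') (notin_mid ST e0C e0R).
    have lS S' : C \subset S' -> e \notin S' -> f \notin S' -> l (e |: S') = l (f |: S').
      move=> CS' eS' fS'; apply: sp_par.
        by apply: sp_mono par; rewrite ?setUS // in_setU1 negb_or eq_sym ef.
      by apply: sp_mono par'; rewrite ?setUS // in_setU1 negb_or ef.
    rewrite /pfin /sp (setUCA [set e0] [set f]) (setUCA [set e0] [set e]) (lS S) //.
    rewrite (lS (e0 |: S)) ?in_setU1 ?negb_or ?ee0 ?fe0 //.
    exact: subset_trans CS (subsetUr _ _).
  have er : rep (fun F A => Z A (e |: C) R (pfin e0 s0 s1 A))
      (expo (l (e |: C)) (size (f :: R)) - 3 + 1) (shift (- 1) s).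
    apply: rep_loopV; apply: rep_ext sr => F A A0.
    by rewrite (Z_loop _ _ A0 pCe par).
  have [sf | nsf] := boolP (sp (e0 |: top C R) f).
    have [d dn dr] := pfin_pos s0n s1n (pointed_delete pDe sf).
    have tE : perm_eq t (shift (- 1) s ++ d).
      apply: rep_inj tr _; apply: rep_add.
        apply: rep_ext (fun F A _ => ef_eq F A) _.
        by apply: repN er; rewrite lCe; apply: expo_par.
      by apply: repN dr; rewrite -expo_delete subrK.
    have [x xs xs'] := good_overlap (isT : `|- 1 : int| <= 1) gs'.
    apply: join tr; apply: (good_cat gs' gt xs).
    by rewrite (perm_mem tE) mem_cat xs'.
  (* Now f is a bridge once e is deleted, so the deletion branch is s shifted by -2, which adjoins s
     because s has two elements. *)
  have gpm := good_pm (good_shift (- 1) gs').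
  apply: (join (shift (- 1) (shift (- 1) s))).
    apply: good_eq gpm => x; rewrite !mem_cat; congr (_ || _).
    by rewrite !mem_shift opprK subrK.
  apply: (@rep_ext _ (fun F A => - A ^- 3 * Z A (e |: C) R (pfin e0 s0 s1 A))).
    by move=> F A A0; rewrite (Z_bridge _ _ A0 pDe nsf) ef_eq.
  by apply: repN (rep_bridge er); rewrite lCe expo_par subrK.
have nspf := pointed_contract pCe npf.
(* The dual case: e and f are in series, both contractions agree, and their sum over R has the
   support [shift 1 t], which is contained in s. *)
have [sf | nsf] := boolP (sp (e0 |: top C R) f); last first.
  have nse : ~~ sp (e0 |: top C R) e.
    have tE g : e0 |: top C (g :: R) = g |: (e0 |: top C R).
      by rewrite top_cons setUCA.
    move: eb fb; rewrite !tE => eb fb.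
    have := spE eb; rewrite setUCA (spE fb) => -[h].
    by rewrite /sp h (nspE fT nsf); apply/eqP; elim: (l _) => // n' IHn [].
  have ef_eq (F : fieldType) (A : F) :
      Z A (f |: C) R (pfin e0 s0 s1 A) = Z A (e |: C) R (pfin e0 s0 s1 A).
    rewrite !Z_contract; apply: Z_ext => S CS ST.
    have [eS fS e0S] := And3 (notin_mid ST eC eR') (notin_mid ST fC fR') (notin_mid ST e0C e0R).
    have lS S' : S' \subset e0 |: top C R -> l (e |: S') = l (f |: S').
      move=> ST'; apply: nsp_ser.
      - by apply: contra eT; apply: subsetP ST' _.
      - by apply: contra fT; apply: subsetP ST' _.
      - exact: nsp_mono nse.
      - exact: nsp_mono nsf.
    rewrite /pfin /sp (setUCA [set e0] [set f]) (setUCA [set e0] [set e]) (lS S) ?(lS (e0 |: S)) ?setUS //.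
    exact: subset_trans ST (subsetUr _ _).
  have fr : rep (fun F A => Z A (f |: C) R (pfin e0 s0 s1 A))
      (expo (l C) (size (f :: R)) - 3 - 1) (shift 1 t).
    apply: rep_bridgeV; apply: rep_ext tr => F A A0.
    by rewrite (Z_bridge _ _ A0 pDe nsf).
  have [c cn cr] := pfin_pos s0n s1n nspf.
  have sE : perm_eq s (c ++ shift 1 t).
    apply: rep_inj sr _; apply: rep_add.
      by apply: repN cr; rewrite (nspE _ npf) ?in_setU1 ?negb_or ?fC 1?eq_sym ?ef // -expo_contract addrK.
    apply: rep_ext (fun F A _ => esym (ef_eq F A)) _.
    by apply: repN fr; rewrite lCe -expo_par.
  have [x xt xt'] := good_overlap (isT : `|1 : int| <= 1) gt.
  apply: join tr; apply: (good_cat gs' gt _ xt).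
  by rewrite (perm_mem sE) mem_cat xt' orbT.
(* The four minors: both edges contracted (a), only e contracted (b), only f contracted (c), both
   deleted (d). The intervals s and u share a, the intervals u and t share c, and u lies in the
   union of s and t. *)
have pD := pointed_delete pDe sf.
have sfe : sp (e0 |: top (e |: C) R) f.
  rewrite top_setU1 setUCA; apply: sp_mono sf; rewrite ?subsetUr //.
  by rewrite in_setU1 negb_or eq_sym ef.
have [a an ar] := pfin_pos s0n s1n nspf.
have [b bn br] := pfin_pos s0n s1n (pointed_delete pCe sfe).
have [c cn cr] := pfin_pos s0n s1n (pointed_contract pDe fl).
have [d dn dr] := pfin_pos s0n s1n pD.
have sE : perm_eq s (a ++ b).
  apply: rep_inj sr _; apply: rep_add.
    by apply: repN ar; rewrite (nspE _ npf) ?in_setU1 ?negb_or ?fC 1?eq_sym ?ef // -expo_contract addrK.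
  by apply: repN br; rewrite -[in RHS]expo_delete subrK.
have tE : perm_eq t (c ++ d).
  apply: rep_inj tr _; apply: rep_add.
    by apply: repN cr; rewrite lCf -expo_contract addrK.
  by apply: repN dr; rewrite -[in RHS]expo_delete subrK.
have uE : perm_eq u (a ++ c).
  apply: rep_inj ur _; apply: rep_add.
    rewrite setUCA; apply: repN ar.
    have -> : l (f |: C) = l (e |: C) by move: lCe; rewrite lCf => -[].
    by rewrite (nspE _ npf) ?in_setU1 ?negb_or ?fC 1?eq_sym ?ef // -expo_contract addrK.
  by apply: repN cr; rewrite -[in RHS]expo_delete subrK.
have xmem (w : seq int) : w != [::] -> exists x, x \in w.
  by case: w => // x w _; exists x; rewrite mem_head.
have [[x xa] [y yc]] := (xmem a an, xmem c cn).
have gsu : good (s ++ u).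
  apply: (good_cat gs' gu (x := x)); first by rewrite (perm_mem sE) mem_cat xa.
  by rewrite (perm_mem uE) mem_cat xa.
have gsut : good ((s ++ u) ++ t).
  apply: (good_cat gsu gt (x := y)); last by rewrite (perm_mem tE) mem_cat yc.
  by rewrite mem_cat (perm_mem uE) mem_cat yc !orbT.
apply: join tr; apply: good_eq gsut => z.
rewrite !mem_cat (perm_mem sE) (perm_mem uE) (perm_mem tE) !mem_cat.
by case: (z \in a); case: (z \in b); case: (z \in c).
Qed.

End Pointed.
End StateSum.

(** * Isotopy invariance of the bracket *)

Definition clabels (xs : seq crossing) : seq nat := flatten (map crossing_seq xs).

Lemma clabels_cons x xs : clabels (x :: xs) = crossing_seq x ++ clabels xs.
Proof. by []. Qed.

Lemma clabels_perm xs ys : perm_eq xs ys -> perm_eq (clabels xs) (clabels ys).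
Proof. by move=> e; apply/perm_flatten/perm_map. Qed.

Lemma flatten_diagram xs ps :
  flatten (diagram_code (Diagram xs ps)) = clabels xs ++ labels ps.
Proof. exact: flatten_cat. Qed.

Section Bracket.
Variables (F : fieldType) (A : F).
Implicit Types (xs : seq crossing) (ps qs ws : seq (nat * nat)).

(** Circles are counted as classes of labels, so that local rewriting may pass through arc lists
    that are not well labelled. *)
Fixpoint cbracket xs ps : F :=
  match xs with
  | [::] => delta A ^+ (cc ps).-1
  | (a, b, c, d) :: xs' =>
      A * cbracket xs' [:: (a, b), (c, d) & ps]
      + A^-1 * cbracket xs' [:: (a, d), (b, c) & ps]
  end.

Lemma bracket_recE xs ps : well_labelled (diagram_code (Diagram xs ps)) ->
  bracket_rec A xs ps = cbracket xs ps.
Proof.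
elim: xs ps => [|[[[a b] c] d] xs IH] ps wl /=; first by rewrite components_arcs.
rewrite !IH //; apply: well_labelled_perm wl.
  rewrite !flatten_diagram clabels_cons /= !labels_cons.
  by apply/permP => p; rewrite /= !count_cat /=; clear; lia.
rewrite !flatten_diagram clabels_cons /= !labels_cons.
by apply/permP => p; rewrite /= !count_cat /=; clear; lia.
Qed.

Lemma bracketE D : well_labelled (diagram_code D) ->
  bracket A D = cbracket (crossings D) (arcs D).
Proof. by case: D => xs ps; apply: bracket_recE. Qed.

(** Listing the smoothings apart from the remaining arcs reduces identities of brackets to
    identities between numbers of classes. *)
Fixpoint states xs : seq (F * seq (nat * nat)) :=
  match xs with
  | [::] => [:: (1, [::])]
  | (a, b, c, d) :: xs' =>
      [seq (A * st.1, st.2 ++ [:: (a, b); (c, d)]) | st <- states xs'] ++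
      [seq (A^-1 * st.1, st.2 ++ [:: (a, d); (b, c)]) | st <- states xs']
  end.

Lemma cbracket_states xs ps :
  cbracket xs ps = \sum_(st <- states xs) st.1 * delta A ^+ (cc (st.2 ++ ps)).-1.
Proof.
elim: xs ps => [|[[[a b] c] d] xs IH] ps /=; first by rewrite big_seq1 mul1r.
rewrite big_cat !big_map /= !IH !mulr_sumr; congr (_ + _);
  by apply: eq_bigr => st _; rewrite mulrA -catA.
Qed.

Lemma states_labels xs st : st \in states xs -> perm_eq (labels st.2) (clabels xs).
Proof.
elim: xs st => [|[[[a b] c] d] xs IH] st /=; first by rewrite inE => /eqP ->.
rewrite mem_cat => /orP[] /mapP[st' /IH/permP h ->];
  by apply/permP => p; rewrite labels_cat clabels_cons !count_cat h /=; lia.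
Qed.

(** The exponent of delta is one less than a number of classes, which must therefore be positive;
    [qs != [::]] ensures this. *)
Lemma cbracket_scale k xs ps qs : qs != [::] ->
  (forall ws, labels ws =i clabels xs -> cc (ws ++ ps) = k + cc (ws ++ qs))%N ->
  cbracket xs ps = delta A ^+ k * cbracket xs qs.
Proof.
move=> qs0 h; rewrite !cbracket_states mulr_sumr; apply: eq_big_seq => st sts.
rewrite h; last exact/perm_mem/states_labels.
rewrite mulrCA -exprD; congr (_ * _ ^+ _).
have : (0 < cc (st.2 ++ qs))%N.
  case: qs qs0 {h} => // -[a b] qs _; apply: (@cc_gt0 _ a).
  by rewrite labels_cat mem_cat labels_cons mem_head orbT.
by case: (cc _) => // m _; rewrite addnS.
Qed.

Lemma cbracket_eq xs ps qs :
  (forall ws, labels ws =i clabels xs -> cc (ws ++ ps) = cc (ws ++ qs)) ->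
  cbracket xs ps = cbracket xs qs.
Proof.
move=> h; rewrite !cbracket_states; apply: eq_big_seq => st sts.
by rewrite h //; apply/perm_mem/states_labels.
Qed.

Lemma cbracket_mem xs ps qs : ps =i qs -> cbracket xs ps = cbracket xs qs.
Proof.
move=> e; apply: cbracket_eq => ws _; apply: cc_eq_mem => p.
by rewrite !mem_cat e.
Qed.

Lemma cbracket_local k xs loc loc' ps : loc' != [::] ->
  (forall ws, labels ws =i clabels xs ++ labels ps ->
     cc (loc ++ ws) = k + cc (loc' ++ ws))%N ->
  cbracket xs (loc ++ ps) = delta A ^+ k * cbracket xs (loc' ++ ps).
Proof.
move=> l0 h; apply: cbracket_scale => [|ws wsl].
  by case: (loc') l0.
rewrite (@cc_eq_mem _ (loc ++ ws ++ ps)) => [|p]; last first.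
  by rewrite !mem_cat; do 2!case: (_ \in _).
rewrite h => [|l]; last by rewrite labels_cat !mem_cat wsl.
by congr addn; apply: cc_eq_mem => p; rewrite !mem_cat; do 2!case: (_ \in _).
Qed.

Lemma cbracket_elim x a b xs ps : x != a -> x != b -> x \notin clabels xs ->
  x \notin labels ps ->
  cbracket xs [:: (a, x), (x, b) & ps] = cbracket xs ((a, b) :: ps).
Proof.
move=> xa xb xX xP.
have := @cbracket_local 0 xs [:: (a, x); (x, b)] [:: (a, b)] ps isT.
rewrite expr0 mul1r; apply=> ws wsl; apply: cc_elim => //.
by rewrite wsl mem_cat negb_or xX.
Qed.

Lemma cbracket_circle a xs p ps : a \notin clabels xs ->
  a \notin labels (p :: ps) ->
  cbracket xs [:: (a, a), p & ps] = delta A * cbracket xs (p :: ps).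
Proof.
move=> aX aP.
have := @cbracket_local 1 xs [:: (a, a); p] [:: p] ps isT.
rewrite expr1; apply=> ws wsl; apply: cc_circle => //.
case: p aP => b c; rewrite !labels_cons !inE !negb_or => /and3P[-> -> aP] /=.
by rewrite wsl mem_cat negb_or aX.
Qed.

Lemma cbracket_flip a b xs ps :
  cbracket xs ((a, b) :: ps) = cbracket xs ((b, a) :: ps).
Proof.
have := @cbracket_local 0 xs [:: (a, b)] [:: (b, a)] ps isT.
by rewrite expr0 mul1r; apply=> ws wsl; apply: cc_flip.
Qed.

Lemma cbracket_swap p q xs ps :
  cbracket xs [:: p, q & ps] = cbracket xs [:: q, p & ps].
Proof. by apply: cbracket_mem => r; rewrite !inE orbCA. Qed.

Lemma cbracket_arcs xs ps qs : perm_eq ps qs -> cbracket xs ps = cbracket xs qs.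
Proof. by move=> /perm_mem; apply: cbracket_mem. Qed.

Lemma cbracket_perm xs ys ps : perm_eq xs ys -> cbracket xs ps = cbracket ys ps.
Proof.
have sw x y zs qs : cbracket [:: x, y & zs] qs = cbracket [:: y, x & zs] qs.
  case: x y => [[[a b] c] d] [[[a' b'] c'] d'] /=.
  set p1 := (a, b); set p2 := (c, d); set p3 := (a, d); set p4 := (b, c).
  set q1 := (a', b'); set q2 := (c', d'); set q3 := (a', d'); set q4 := (b', c').
  have e r1 r2 s1 s2 : cbracket zs [:: r1, r2, s1, s2 & qs] =
      cbracket zs [:: s1, s2, r1, r2 & qs].
    by apply: cbracket_mem => r; rewrite !inE; do 4!case: (r == _).
  by rewrite (e q1) (e q3) (e q1 q2 p3) (e q3 q4 p3); ring.
have mid (zs : seq crossing) x ts qs : cbracket (zs ++ x :: ts) qs = cbracket (x :: zs ++ ts) qs.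
  elim: zs qs => // y zs IH qs; rewrite [RHS]sw.
  by case: y => [[[a b] c] d] /=; rewrite !IH.
elim: xs ys ps => [|x xs IH] ys ps; first by rewrite perm_sym => /perm_nilP ->.
move=> e; have xy : x \in ys by rewrite -(perm_mem e) mem_head.
case/path.splitPr: xy e => zs ts e; rewrite mid.
have {}e : perm_eq xs (zs ++ ts).
  by rewrite -(perm_cons x) (perm_trans e) // perm_sym -cat1s -[x :: ts]cat1s perm_catCA.
by case: x => [[[a b] c] d] /=; rewrite !(IH _ _ e).
Qed.

Lemma cbracket_rotate a b c d xs ps :
  cbracket ((a, b, c, d) :: xs) ps = cbracket ((c, d, a, b) :: xs) ps.
Proof.
rewrite /=; congr (_ * _ + _ * _); first exact: cbracket_swap.
by rewrite cbracket_flip cbracket_swap cbracket_flip.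
Qed.

Lemma clabels_relabel f xs : clabels (map (relabel_crossing f) xs) = map f (clabels xs).
Proof. by elim: xs => //= -[[[a b] c] d] xs IH; rewrite !clabels_cons /= IH. Qed.

Lemma states_relabel f xs : states (map (relabel_crossing f) xs) =
  [seq (st.1, map_arcs f st.2) | st <- states xs].
Proof.
elim: xs => //= -[[[a b] c] d] xs IH; rewrite IH map_cat.
by congr cat; rewrite -!map_comp; apply: eq_map => st /=; rewrite /map_arcs map_cat.
Qed.

Lemma cbracket_relabel f xs ps : injective f ->
  cbracket (map (relabel_crossing f) xs) (map_arcs f ps) = cbracket xs ps.
Proof.
move=> inj; rewrite !cbracket_states states_relabel big_map /=.
apply: eq_bigr => st _; rewrite /map_arcs -map_cat.
by rewrite -[map _ _]/(map_arcs f (st.2 ++ ps)) cc_map.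
Qed.

Lemma cbracket_join a b xs ps :
  (a \in clabels xs ++ labels ps) || (b \in clabels xs ++ labels ps) ->
  cbracket xs ((a, b) :: ps) =
  cbracket (map (relabel_crossing (rename a b)) xs) (map_arcs (rename a b) ps).
Proof.
move=> ab; rewrite !cbracket_states states_relabel big_map /=.
apply: eq_big_seq => st /states_labels/perm_mem sl.
rewrite /map_arcs -map_cat -cc_join.
  by congr (_ * _ ^+ _.-1); apply: cc_eq_mem => p; rewrite inE !mem_cat !inE orbCA.
by move: ab; rewrite labels_cat !mem_cat !sl.
Qed.

Lemma cbracket_R1 a b c xs ps : A != 0 -> a \notin clabels xs ->
  a \notin labels ((b, c) :: ps) ->
  cbracket ((a, a, b, c) :: xs) ps = - A ^+ 3 * cbracket xs ((b, c) :: ps).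
Proof.
move=> A0 aX aP; rewrite /= cbracket_circle //.
move: aP; rewrite labels_cons !inE !negb_or => /and3P[ab ac aP].
rewrite (cbracket_swap (a, c)) (cbracket_flip a b) cbracket_elim // -delta_loop //; ring.
Qed.

Lemma cbracket_R1' a b c xs ps : A != 0 -> a \notin clabels xs ->
  a \notin labels ((b, c) :: ps) ->
  cbracket ((b, a, a, c) :: xs) ps = - A ^- 3 * cbracket xs ((b, c) :: ps).
Proof.
move=> A0 aX aP; rewrite /= (cbracket_swap (b, c)) cbracket_circle //.
move: aP; rewrite labels_cons !inE !negb_or => /and3P[ab ac aP].
rewrite cbracket_elim // -delta_bridge //; ring.
Qed.

Lemma cbracket_R2 a b c d x y xs ps : A != 0 ->
  x != y -> x \notin [:: a; b; c; d] -> y \notin [:: a; b; c; d] ->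
  x \notin clabels xs ++ labels ps -> y \notin clabels xs ++ labels ps ->
  cbracket [:: (a, x, y, b), (y, x, c, d) & xs] ps =
  cbracket xs [:: (a, c), (b, d) & ps].
Proof.
rewrite !inE !mem_cat !negb_or => A0 xy.
move=> /and4P[xa xb xc xd] /and4P[ya yb yc yd] /andP[xX xP] /andP[yX yP].
have yx : y != x by rewrite eq_sym.
(* Of the four states of the two crossings, three reduce to the arcs (a, b), (c, d), with the
   factors A^2, delta and A^-2, whose sum is 0. Only the state of [e2] remains. *)
have e1 : cbracket xs [:: (y, x), (c, d), (a, x), (y, b) & ps] =
          cbracket xs [:: (a, b), (c, d) & ps].
  rewrite (@cbracket_arcs _ _ [:: (a, x), (y, x), (y, b), (c, d) & ps]); last first.
    by apply/permP => p /=; clear; lia.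
  rewrite cbracket_swap cbracket_flip cbracket_swap cbracket_elim //; last first.
    by rewrite !labels_cons !inE !negb_or xy xb xc xd.
  by rewrite cbracket_elim // !labels_cons !inE !negb_or yc yd.
have e2 : cbracket xs [:: (y, d), (x, c), (a, x), (y, b) & ps] =
          cbracket xs [:: (a, c), (b, d) & ps].
  rewrite (@cbracket_arcs _ _ [:: (a, x), (x, c), (y, b), (y, d) & ps]); last first.
    by apply/permP => p /=; clear; lia.
  rewrite cbracket_elim //; last first.
    by rewrite !labels_cons !inE !negb_or xy xb xd.
  rewrite (@cbracket_arcs _ _ [:: (y, b), (y, d), (a, c) & ps]); last first.
    by apply/permP => p /=; clear; lia.
  rewrite cbracket_flip cbracket_elim //; last first.
    by rewrite !labels_cons !inE !negb_or ya yc.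
  exact: cbracket_swap.
have e3 : cbracket xs [:: (y, x), (c, d), (a, b), (x, y) & ps] =
          delta A * cbracket xs [:: (a, b), (c, d) & ps].
  rewrite (@cbracket_arcs _ _ [:: (y, x), (x, y), (a, b), (c, d) & ps]); last first.
    by apply/permP => p /=; clear; lia.
  rewrite -(@cbracket_circle y) //; last first.
    by rewrite !labels_cons !inE !negb_or ya yb yc yd.
  have := @cbracket_local 0 xs [:: (y, x); (x, y)] [:: (y, y)] [:: (a, b), (c, d) & ps] isT.
  rewrite expr0 mul1r; apply=> ws wsl; apply: cc_elim => //.
  by rewrite wsl mem_cat !labels_cons !inE !negb_or xX xa xb xc xd.
have e4 : cbracket xs [:: (y, d), (x, c), (a, b), (x, y) & ps] =
          cbracket xs [:: (a, b), (c, d) & ps].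
  rewrite (@cbracket_arcs _ _ [:: (x, c), (x, y), (y, d), (a, b) & ps]); last first.
    by apply/permP => p /=; clear; lia.
  rewrite cbracket_flip cbracket_elim //; last first.
    by rewrite !labels_cons !inE !negb_or xy xa xb xd.
  rewrite cbracket_elim //; first exact: cbracket_swap.
  by rewrite !labels_cons !inE !negb_or ya yb.
by rewrite /= e1 e2 e3 e4 /delta; field.
Qed.

Lemma relabel_crossings_id a b xs : b \notin clabels xs ->
  map (relabel_crossing (rename a b)) xs = xs.
Proof.
elim: xs => //= -[[[p q] r] s] xs IH; rewrite clabels_cons !inE !negb_or.
case/and5P=> /negbTE bp /negbTE bq /negbTE br /negbTE bs bX.
by rewrite IH // /relabel_crossing /rename ![_ == b]eq_sym bp bq br bs.
Qed.

Lemma relabel_arcs_id a b ps : b \notin labels ps -> map_arcs (rename a b) ps = ps.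
Proof.
elim: ps => //= -[p q] ps IH; rewrite labels_cons !inE !negb_or.
case/and3P=> /negbTE bp /negbTE bq bX.
by rewrite IH // /relabel_arc /rename /= ![_ == b]eq_sym bp bq.
Qed.

Lemma cbracket_subst a b xs1 xs ps1 ps :
  b \in clabels xs1 ++ labels ps1 -> b \notin clabels xs -> b \notin labels ps ->
  cbracket (xs1 ++ xs) ((a, b) :: ps1 ++ ps) =
  cbracket (map (relabel_crossing (rename a b)) xs1 ++ xs)
           (map (relabel_arc (rename a b)) ps1 ++ ps).
Proof.
move=> b1 bX bP; rewrite cbracket_join.
  rewrite /map_arcs !map_cat (relabel_crossings_id a bX).
  by rewrite -[map (relabel_arc _) ps]/(map_arcs (rename a b) ps) relabel_arcs_id.
rewrite orbC labels_cat /clabels map_cat flatten_cat !mem_cat; move: b1.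
by rewrite mem_cat => /orP[] ->; rewrite ?orbT.
Qed.

Lemma cbracket_cons a b c d xs ps : cbracket ((a, b, c, d) :: xs) ps =
  A * cbracket xs [:: (a, b), (c, d) & ps]
  + A^-1 * cbracket xs [:: (a, d), (b, c) & ps].
Proof. by []. Qed.

Arguments cbracket : simpl never.

Section R3.
Variables (t m b t' m' b' x y z : nat) (xs : seq crossing) (ps : seq (nat * nat)).
Let ends := [:: t; m; b; t'; m'; b'].
Hypotheses (A0 : A != 0) (xyz : uniq [:: x; y; z]).
Hypothesis fresh_ends : forall l, l \in [:: x; y; z] -> l \notin ends.
Hypothesis fresh_xs : forall l, l \in [:: x; y; z] -> l \notin clabels xs.
Hypothesis fresh_ps : forall l, l \in [:: x; y; z] -> l \notin labels ps.

Let xin : x \in [:: x; y; z]. Proof. by rewrite !inE eqxx. Qed.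
Let yin : y \in [:: x; y; z]. Proof. by rewrite !inE eqxx orbT. Qed.
Let zin : z \in [:: x; y; z]. Proof. by rewrite !inE eqxx !orbT. Qed.

Let nx l : l \in [:: y, z & ends] -> (l == x) = false.
Proof.
move=> lE; apply/negP => /eqP lx; move: lE; rewrite lx !inE.
move: xyz; rewrite /= !inE !negb_or => /andP[/andP[/negbTE -> /negbTE ->] _] /=.
by have := fresh_ends xin; rewrite !inE => /negbTE ->.
Qed.

Let ny l : l \in [:: x, z & ends] -> (l == y) = false.
Proof.
move=> lE; apply/negP => /eqP ly; move: lE; rewrite ly !inE eq_sym.
move: xyz; rewrite /= !inE !negb_or => /andP[/andP[/negbTE -> _] /andP[/negbTE -> _]] /=.
by have := fresh_ends yin; rewrite !inE => /negbTE ->.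
Qed.

Let fresh_labels l u v : l \in [:: x; y; z] -> l != u -> l != v ->
  l \notin labels ((u, v) :: ps).
Proof. by move=> lx lu lv; rewrite labels_cons !inE !negb_or lu lv fresh_ps. Qed.

Let notin_ends l u : l \in [:: x; y; z] -> u \in ends -> l != u.
Proof. by move=> lx uE; apply/eqP => lu; have := fresh_ends lx; rewrite lu uE. Qed.

Let R2_fresh a c d e l : l \in [:: x; y; z] ->
  {subset [:: a; c; d; e] <= ends} -> l \notin [:: a; c; d; e].
Proof. by move=> lx sub; apply/negP => /sub; apply/negP/fresh_ends. Qed.

Lemma R3_absorb :
  cbracket [:: (b, t', z, x), (z, m', b', y) & xs] [:: (m, x), (y, t) & ps] =
  cbracket [:: (b, t', z, m), (z, m', b', t) & xs] ps.
Proof.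
have := @cbracket_subst m x [:: (b, t', z, x); (z, m', b', y)] xs [:: (y, t)] ps.
rewrite /= /relabel_arc /relabel_crossing /rename /= eqxx.
rewrite !nx ?inE ?eqxx ?orbT // => -> //; try by rewrite ?fresh_xs ?fresh_ps.
rewrite cbracket_flip.
have := @cbracket_subst t y [:: (b, t', z, m); (z, m', b', y)] xs [::] ps.
rewrite /= /relabel_arc /relabel_crossing /rename /= eqxx.
rewrite !ny ?inE ?eqxx ?orbT // => -> //; try by rewrite ?fresh_xs ?fresh_ps.
Qed.

Lemma R3_cup :
  cbracket [:: (b, t', z, x), (z, m', b', y) & xs] [:: (m, t), (x, y) & ps] =
  cbracket xs [:: (b', b), (m', t'), (m, t) & ps].
Proof.
rewrite cbracket_swap.
have := @cbracket_subst x y [:: (b, t', z, x); (z, m', b', y)] xs [:: (m, t)] ps.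
rewrite /= /relabel_arc /relabel_crossing /rename /= eqxx.
rewrite !ny ?inE ?eqxx ?orbT // => -> //; try by rewrite ?fresh_xs ?fresh_ps.
rewrite cbracket_rotate.
rewrite (@cbracket_perm _ [:: (z, m', b', x), (z, x, b, t') & xs]); last first.
  by apply/permP => p /=; clear; lia.
rewrite cbracket_rotate cbracket_R2 //.
- by rewrite eq_sym nx // !inE eqxx ?orbT.
- by apply: R2_fresh => // l; rewrite !inE => /or4P[] /eqP->; rewrite !eqxx ?orbT.
- by apply: R2_fresh => // l; rewrite !inE => /or4P[] /eqP->; rewrite !eqxx ?orbT.
- rewrite mem_cat negb_or fresh_xs // fresh_labels //; apply: notin_ends => //.
    by rewrite !inE eqxx ?orbT.
  by rewrite !inE eqxx ?orbT.
- rewrite mem_cat negb_or fresh_xs // fresh_labels //; apply: notin_ends => //.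
    by rewrite !inE eqxx ?orbT.
  by rewrite !inE eqxx ?orbT.
Qed.

Lemma R3'_absorb :
  cbracket [:: (b, x, z, t), (z, y, b', m') & xs] [:: (m, x), (t', y) & ps] =
  cbracket [:: (b, m, z, t), (z, t', b', m') & xs] ps.
Proof.
have := @cbracket_subst m x [:: (b, x, z, t); (z, y, b', m')] xs [:: (t', y)] ps.
rewrite /= /relabel_arc /relabel_crossing /rename /= eqxx.
rewrite !nx ?inE ?eqxx ?orbT // => -> //; try by rewrite ?fresh_xs ?fresh_ps.
have := @cbracket_subst t' y [:: (b, m, z, t); (z, y, b', m')] xs [::] ps.
rewrite /= /relabel_arc /relabel_crossing /rename /= eqxx.
rewrite !ny ?inE ?eqxx ?orbT // => -> //; try by rewrite ?fresh_xs ?fresh_ps.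
Qed.

Lemma R3'_cup :
  cbracket [:: (b, x, z, t), (z, y, b', m') & xs] [:: (m, t'), (y, x) & ps] =
  cbracket xs [:: (b, b'), (t, m'), (m, t') & ps].
Proof.
rewrite cbracket_swap cbracket_flip.
have := @cbracket_subst x y [:: (b, x, z, t); (z, y, b', m')] xs [:: (m, t')] ps.
rewrite /= /relabel_arc /relabel_crossing /rename /= eqxx.
rewrite !ny ?inE ?eqxx ?orbT // => -> //; try by rewrite ?fresh_xs ?fresh_ps.
rewrite cbracket_R2 //.
- by rewrite eq_sym nx // !inE eqxx ?orbT.
- by apply: R2_fresh => // l; rewrite !inE => /or4P[] /eqP->; rewrite !eqxx ?orbT.
- by apply: R2_fresh => // l; rewrite !inE => /or4P[] /eqP->; rewrite !eqxx ?orbT.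
- rewrite mem_cat negb_or fresh_xs // fresh_labels //; apply: notin_ends => //.
    by rewrite !inE eqxx ?orbT.
  by rewrite !inE eqxx ?orbT.
- rewrite mem_cat negb_or fresh_xs // fresh_labels //; apply: notin_ends => //.
    by rewrite !inE eqxx ?orbT.
  by rewrite !inE eqxx ?orbT.
Qed.

End R3.

(** Kauffman's argument: the crossing of the top and middle strands is smoothed on both sides. One
    smoothing gives the same crossings up to rotation; in the other the bottom strand slips off by a
    second Reidemeister move. *)
Lemma cbracket_R3 t m b t' m' b' x y z xs ps : A != 0 -> uniq [:: x; y; z] ->
  (forall l, l \in [:: x; y; z] -> l \notin [:: t; m; b; t'; m'; b']) ->
  (forall l, l \in [:: x; y; z] -> l \notin clabels xs) ->
  (forall l, l \in [:: x; y; z] -> l \notin labels ps) ->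
  cbracket [:: (m, x, y, t), (b, t', z, x), (z, m', b', y) & xs] ps =
  cbracket [:: (m', x, y, t'), (b', t, z, x), (z, m, b, y) & xs] ps.
Proof.
move=> A0 u fe fX fP.
have fe' l : l \in [:: x; y; z] -> l \notin [:: t'; m'; b'; t; m; b].
  by move=> /fe; apply: contra; rewrite !inE; do 6!case: (l == _).
rewrite !(cbracket_cons m) !(cbracket_cons m'); congr (_ * _ + _ * _).
  rewrite !R3_absorb // cbracket_rotate; apply: etrans (cbracket_perm _ _) _; last first.
    by rewrite cbracket_rotate.
  by apply/permP => p /=; clear; lia.
rewrite !R3_cup // cbracket_flip; apply: cbracket_mem => p.
by rewrite !inE; do 3!case: (p == _).
Qed.

Lemma cbracket_R3' t m b t' m' b' x y z xs ps : A != 0 -> uniq [:: x; y; z] ->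
  (forall l, l \in [:: x; y; z] -> l \notin [:: t; m; b; t'; m'; b']) ->
  (forall l, l \in [:: x; y; z] -> l \notin clabels xs) ->
  (forall l, l \in [:: x; y; z] -> l \notin labels ps) ->
  cbracket [:: (b, x, z, t), (m, t', y, x), (z, y, b', m') & xs] ps =
  cbracket [:: (b', x, z, t'), (m', t, y, x), (z, y, b, m) & xs] ps.
Proof.
move=> A0 u fe fX fP.
have fe' l : l \in [:: x; y; z] -> l \notin [:: t'; m'; b'; t; m; b].
  by move=> /fe; apply: contra; rewrite !inE; do 6!case: (l == _).
rewrite (@cbracket_perm _ [:: (m, t', y, x), (b, x, z, t), (z, y, b', m') & xs]);
  last by apply/permP => p /=; clear; lia.
rewrite (@cbracket_perm [:: (b', x, z, t'), _, _ & xs]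
  [:: (m', t, y, x), (b', x, z, t'), (z, y, b, m) & xs]); last by apply/permP => p /=; clear; lia.
rewrite !(cbracket_cons m) !(cbracket_cons m'); congr (_ * _ + _ * _).
  rewrite !R3'_cup // (cbracket_flip b b') cbracket_swap (cbracket_flip t m').
  rewrite (@cbracket_arcs _ _ [:: (m, t'), (m', t), (b', b) & ps]); last first.
    by apply/permP => p /=; clear; lia.
  rewrite (cbracket_flip m t').
  by apply: cbracket_mem => p; rewrite !inE; do 3!case: (p == _).
rewrite !R3'_absorb // cbracket_rotate.
by apply: etrans (cbracket_perm _ _) _; last rewrite cbracket_rotate; [|reflexivity];
  apply/permP => p /=; lia.
Qed.

End Bracket.

Arguments cbracket : simpl never.

(** Invariance up to sign and a power of A is enough, so the writhe need not be followed through an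
    isotopy. The unit is the same in all fields. *)
Definition unit_equiv (X Y : forall F : fieldType, F -> F) :=
  exists (b : bool) (k : int), forall (F : fieldType) (A : F), A != 0 ->
    X F A = (-1) ^+ b * A ^ k * Y F A.

Lemma unit_equiv_eq X Y :
  (forall (F : fieldType) (A : F), A != 0 -> X F A = Y F A) -> unit_equiv X Y.
Proof. by move=> h; exists false, 0 => F A A0; rewrite h // !mul1r. Qed.

Lemma unit_equiv_sym X Y : unit_equiv X Y -> unit_equiv Y X.
Proof.
move=> [b [k h]]; exists b, (- k) => F A A0; rewrite h // mulrA mulrACA.
by rewrite -expfzDr // addNr mulr1 -signr_addb addbb mul1r.
Qed.

Lemma unit_equiv_trans X Y W : unit_equiv X Y -> unit_equiv Y W -> unit_equiv X W.
Proof.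
move=> [b [k h]] [b' [k' h']]; exists (b (+) b'), (k + k') => F A A0.
by rewrite h // h' // expfzDr // signr_addb; ring.
Qed.

(** A label has only two ends; when both lie in the local picture [L], none is left for the rest.
    This provides the freshness conditions of the Reidemeister moves. *)
Lemma wl_fresh V L rest : well_labelled V -> perm_eq (flatten V) (L ++ rest) ->
  forall x, (1 < count_mem x L)%N -> count_mem x L = 2%N /\ x \notin rest.
Proof.
move=> wl e x xL.
have xV : x \in flatten V.
  by rewrite (perm_mem e) mem_cat -has_pred1 has_count (ltnW xL).
have := allP wl x xV; rewrite (permP e) count_cat => /eqP h.
split; first by lia.
by apply/count_memPn; lia.
Qed.

Lemma R3_fresh V x y z ends xs ps : well_labelled V ->
  perm_eq (flatten V) ([:: x; y; x; z; z; y] ++ (ends ++ clabels xs ++ labels ps)) ->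
  [/\ uniq [:: x; y; z],
      forall l, l \in [:: x; y; z] -> l \notin ends,
      forall l, l \in [:: x; y; z] -> l \notin clabels xs &
      forall l, l \in [:: x; y; z] -> l \notin labels ps].
Proof.
move=> wl pe; have fr := wl_fresh wl pe.
have frl l : l \in [:: x; y; z] -> l \notin ends ++ clabels xs ++ labels ps.
  move=> lx; have [|] := fr l; last by [].
  by move: lx; rewrite !inE => /or3P[] /eqP -> /=; rewrite eqxx; lia.
split; first last.
- by move=> l /frl; rewrite !mem_cat !negb_or => /and3P[].
- by move=> l /frl; rewrite !mem_cat !negb_or => /and3P[].
- by move=> l /frl; rewrite !mem_cat !negb_or => /and3P[].
have [|hx _] := fr x; first by rewrite /= eqxx; lia.
have [|hy _] := fr y; first by rewrite /= eqxx; lia.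
move: hx hy; rewrite /= !inE !eqxx ![y == x]eq_sym ![z == x]eq_sym ![z == y]eq_sym.
by case: (x == y); case: (x == z); case: (y == z).
Qed.

Lemma move_bracket D D' : link_diagram D -> link_diagram D' -> move D D' ->
  unit_equiv (fun F A => bracket A D) (fun F A => bracket A D').
Proof.
move=> [_ wl _] [_ wl' _] mv.
apply: (@unit_equiv_trans _ (fun F A => cbracket A (crossings D) (arcs D))).
  by apply: unit_equiv_eq => F A _; apply: bracketE.
apply: (@unit_equiv_trans _ (fun F A => cbracket A (crossings D') (arcs D'))); last first.
  by apply: unit_equiv_eq => F A _; rewrite bracketE.
move: wl {wl'}; case: mv => /=.
- move=> xs xs' ps ps' ex ep _; apply: unit_equiv_eq => F A _.
  by rewrite (cbracket_perm _ _ ex) (cbracket_arcs _ _ ep).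
- by move=> a b c d xs ps _; apply: unit_equiv_eq => F A _; apply: cbracket_rotate.
- by move=> a b xs ps _; apply: unit_equiv_eq => F A _; apply: cbracket_flip.
- move=> f [xs ps] finj _; apply: unit_equiv_eq => F A _ /=.
  exact/esym/cbracket_relabel.
- move=> a b xs ps ab wl; apply: unit_equiv_eq => F A _; apply: cbracket_join.
  have := allP wl a; rewrite flatten_diagram labels_cons mem_cat !inE eqxx orbT => /(_ isT).
  rewrite count_cat /= eqxx [b == a]eq_sym (negbTE ab) /= => /eqP h.
  have : (0 < count_mem a (clabels xs) + count_mem a (labels ps))%N.
    by move: h; clear; move: (count_mem _ _) (count_mem _ _) => u v; lia.
  by rewrite -count_cat -has_count has_pred1 => ->.
- move=> a b c xs ps wl; exists true, 3 => F A A0.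
  have [||_ ] := @wl_fresh _ [:: a; a] ([:: b; c] ++ clabels xs ++ labels ps) wl _ a.
  + by rewrite flatten_diagram.
  + by rewrite /= eqxx.
  rewrite !inE mem_cat !negb_or => /and4P[ab ac aX aP].
  by rewrite cbracket_R1 // ?mulN1r // labels_cons !inE !negb_or ab ac.
- move=> a b c xs ps wl; exists true, (-3) => F A A0.
  have [||_ ] := @wl_fresh _ [:: a; a] ([:: b; c] ++ clabels xs ++ labels ps) wl _ a.
  + by rewrite flatten_diagram !clabels_cons; apply/permP => p; rewrite /= !count_cat /=; clear; lia.
  + by rewrite /= eqxx.
  rewrite !inE mem_cat !negb_or => /and4P[ab ac aX aP].
  by rewrite cbracket_R1' // ?mulN1r // labels_cons !inE !negb_or ab ac.
- move=> a b c d x y xs ps wl; apply: unit_equiv_eq => F A A0.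
  have pe : perm_eq (flatten (diagram_code
       (Diagram [:: (a, x, y, b), (y, x, c, d) & xs] ps)))
     ([:: x; y; y; x] ++ ([:: a; b; c; d] ++ clabels xs ++ labels ps)).
    by rewrite flatten_diagram !clabels_cons; apply/permP => p; rewrite /= !count_cat /=; clear; lia.
  have [|hx] := wl_fresh wl pe (x := x); first by rewrite /= eqxx; lia.
  rewrite mem_cat negb_or => /andP[xE xN].
  have [|_] := wl_fresh wl pe (x := y); first by rewrite /= eqxx; lia.
  rewrite mem_cat negb_or => /andP[yE yN].
  apply: cbracket_R2 => //.
  by move: hx; rewrite /= eqxx eq_sym; case: eqP => // ->; rewrite eqxx.
- move=> t m b t' m' b' x y z xs ps wl; apply: unit_equiv_eq => F A A0.
  have pe : perm_eq (flatten (diagram_code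
       (Diagram [:: (m, x, y, t), (b, t', z, x), (z, m', b', y) & xs] ps)))
     ([:: x; y; x; z; z; y] ++ ([:: t; m; b; t'; m'; b'] ++ clabels xs ++ labels ps)).
    by rewrite flatten_diagram !clabels_cons; apply/permP => p; rewrite /= !count_cat /=; clear; lia.
  have [u fe fX fP] := R3_fresh wl pe; exact: cbracket_R3.
- move=> t m b t' m' b' x y z xs ps wl; apply: unit_equiv_eq => F A A0.
  have pe : perm_eq (flatten (diagram_code
       (Diagram [:: (b, x, z, t), (m, t', y, x), (z, y, b', m') & xs] ps)))
     ([:: x; y; x; z; z; y] ++ ([:: t; m; b; t'; m'; b'] ++ clabels xs ++ labels ps)).
    by rewrite flatten_diagram !clabels_cons; apply/permP => p; rewrite /= !count_cat /=; clear; lia.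
  have [u fe fX fP] := R3_fresh wl pe; exact: cbracket_R3'.
Qed.

Lemma isotopic_bracket D D' : isotopic D D' ->
  unit_equiv (fun F A => bracket A D) (fun F A => bracket A D').
Proof.
elim=> [x y [lx ly mv] | x | x y _ | x y z _ xy _].
- exact: move_bracket.
- exact: unit_equiv_eq.
- exact: unit_equiv_sym.
- exact: unit_equiv_trans.
Qed.

(* up to a unit, X is a sum of powers of - A^4: as a polynomial in A^4, its
   coefficients have alternating signs *)
Definition coherent (X : forall F : fieldType, F -> F) (s : seq int) :=
  exists (b : bool) (m : int), forall (F : fieldType) (A : F), A != 0 ->
    X F A = (-1) ^+ b * A ^ m * lsum A s.

Lemma coherent_equiv X Y s : unit_equiv X Y -> coherent Y s -> coherent X s.
Proof.
move=> [b [k h]] [b' [k' h']]; exists (b (+) b'), (k + k') => F A A0.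
by rewrite h // h' // expfzDr // signr_addb; ring.
Qed.

(** * Quasi-alternating links *)

Lemma exprNz (F : fieldType) (x : F) (k : int) :
  (- x) ^ k = (-1) ^+ odd (absz k) * x ^ k.
Proof.
rewrite -[- x]mulN1r expfzMl signr_odd; congr (_ * _).
by case: k => n; rewrite /exprz //= -signr_odd; case: (odd _); rewrite ?invr1 ?invrN1.
Qed.

Section Determinant.

Let zeta : algC := 4.-root (-1).

Lemma zeta4 : zeta ^+ 4 = -1. Proof. exact: rootCK. Qed.

Lemma norm1_exprz (z : algC) (m : int) : `|z| = 1 -> `|z ^ m| = 1.
Proof.
by move=> z1; case: m => n; rewrite /exprz ?normfV normrX z1 expr1n ?invr1.
Qed.

Lemma norm_zeta : `|zeta| = 1.
Proof.
by apply/eqP; rewrite -(@pexpr_eq1 _ _ 4) // -normrX zeta4 normrN1.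
Qed.

Lemma zeta_neq0 : zeta != 0. Proof. by rewrite -normr_eq0 norm_zeta oner_neq0. Qed.

(** All powers of - A^4 are 1 at zeta, so the determinant is the number of terms. *)
Lemma lsum_zeta s : lsum zeta s = (size s)%:R.
Proof.
rewrite /lsum zeta4 opprK (eq_bigr (fun=> 1)) => [|j _]; last by rewrite exp1rz.
by rewrite big_const_seq count_predT iter_addr_0.
Qed.

Lemma norm_unit (b : bool) (z : algC) (m : int) : `|z| = 1 -> `|(-1) ^+ b * z ^ m| = 1.
Proof. by move=> z1; rewrite normrM normrX normrN1 expr1n mul1r norm1_exprz. Qed.

Lemma has_det_bracket D m : has_det D m -> m = `|bracket zeta D|.
Proof.
case=> o _ ->; rewrite /jones normrM norm1_exprz ?mul1r //.
by rewrite normrN normrX norm_zeta expr1n.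
Qed.

(** As a primitive eighth root of unity, zeta takes real values only at exponents divisible by 4,
    and zeta^4 = -1 determines the sign. *)
Lemma zeta_exp (k : int) (b : bool) : zeta ^ k = (-1) ^+ b ->
  exists2 q : int, k = q * 4 & b = odd (absz q).
Proof.
have [q [r [kE rE]]] : exists q, exists r : nat, k = q * 4 + r%:Z /\ (r < 4)%N.
  exists (k %/ 4)%Z, (absz (k %% 4)%Z); have := divz_eq k 4; have := ltz_pmod k (d := 4) isT.
  have := modz_ge0 k (d := 4) isT; lia.
have z4q : zeta ^ (q * 4) = (-1) ^+ odd (absz q).
  by rewrite mulrC -exprz_exp -[zeta ^ 4]/(zeta ^+ 4) zeta4 exprNz exp1rz mulr1.
rewrite kE expfzDr ?zeta_neq0 // z4q => e.
have zr : zeta ^+ r = (-1) ^+ (b (+) odd (absz q)).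
  by rewrite signr_addb -e -[_ ^ r%:Z]/(zeta ^+ r) mulrAC -signr_addb addbb mul1r.
have one : (-1 : algC) != 1 by rewrite eqNr oner_eq0.
have zr2 : zeta ^+ (r * 2) = 1 by rewrite exprM zr sqrr_sign.
case: r rE zr zr2 kE {e} => [|[|[|[|//]]]] _ zr zr2 kE.
- exists q; first by rewrite addr0.
  by move: zr; case: b (odd _) => [] [] // /eqP; rewrite expr0 expr1 eq_sym (negbTE one).
- by move: one; rewrite -zeta4 (exprM zeta (1 * 2) 2) zr2 expr1n eqxx.
- by move: one; rewrite -zeta4 zr2 eqxx.
- have : zeta ^+ (4 * 3) = 1 by rewrite (exprM zeta (3 * 2) 2) zr2 expr1n.
  by move/eqP; rewrite exprM zeta4 -signr_odd expr1 (negbTE one).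
Qed.

(* det is additive only if the two terms of the skein relation have the same
   phase at zeta, an eighth root of unity *)
Lemma coherent_pair X0 X1 s0 s1 : coherent X0 s0 -> coherent X1 s1 ->
  s0 != [::] -> s1 != [::] ->
  `|zeta * X0 _ zeta + zeta^-1 * X1 _ zeta| = `|X0 _ zeta| + `|X1 _ zeta| ->
  exists (b : bool) (m : int) (q : int), forall (F : fieldType) (A : F), A != 0 ->
    X0 F A = (-1) ^+ b * A ^ m * (A^-1 * lsum A s0) /\
    X1 F A = (-1) ^+ b * A ^ m * (A * lsum A (shift q s1)).
Proof.
move=> [b0 [m0 h0]] [b1 [m1 h1]] n0 n1.
have size0 (s : seq int) : s != [::] -> (size s)%:R != 0 :> algC by rewrite pnatr_eq0 size_eq0.
rewrite h0 ?zeta_neq0 // h1 ?zeta_neq0 // !lsum_zeta.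
set u0 := zeta * _; set u1 := zeta^-1 * _.
have u0E : u0 = (-1) ^+ b0 * zeta ^ (m0 + 1) * (size s0)%:R.
  by rewrite /u0 expfzDr ?zeta_neq0 // expr1z; ring.
have u1E : u1 = (-1) ^+ b1 * zeta ^ (m1 - 1) * (size s1)%:R.
  by rewrite /u1 expfzDr ?zeta_neq0 // exprN1; ring.
have nu0 : `|u0| = (size s0)%:R by rewrite u0E normrM norm_unit ?norm_zeta // mul1r normr_nat.
have nu1 : `|u1| = (size s1)%:R by rewrite u1E normrM norm_unit ?norm_zeta // mul1r normr_nat.
have hn (b : bool) (m : int) n : `|(-1) ^+ b * zeta ^ m * n%:R| = n%:R.
  by rewrite normrM norm_unit ?norm_zeta // mul1r normr_nat.
rewrite !hn -nu0 -nu1 => /normCDeq[t _ [e0 e1]].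
have {}e0 : (-1) ^+ b0 * zeta ^ (m0 + 1) = t.
  by move: u0E; rewrite e0 nu0 mulrC => /(mulIf (size0 _ n0)) ->.
have {}e1 : (-1) ^+ b1 * zeta ^ (m1 - 1) = t.
  by move: u1E; rewrite e1 nu1 mulrC => /(mulIf (size0 _ n1)) ->.
have [|q kE bE] := @zeta_exp (m1 - 1 - (m0 + 1)) (b0 (+) b1).
  rewrite expfzDr ?zeta_neq0 // -invr_expz signr_addb -[zeta ^ (m1 - 1)](signrMK b1) e1 -e0.
  by rewrite -!mulrA divff ?expfz_neq0 ?zeta_neq0 // mulr1 mulrC.
exists b0, (m0 + 1), q => F A A0; rewrite h0 // h1 //; split.
  by rewrite expfzDr // expr1z; field.
have -> : m1 = (m0 + 1) + 1 + 4 * q by lia.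
rewrite lsum_shift // !expfzDr // !expr1z.
have -> : b1 = b0 (+) odd (absz q) by rewrite -bE addbA addbb.
rewrite -exprz_exp -[A ^ 4]/(A ^+ 4) signr_addb.
by rewrite (exprNz (A ^+ 4)); ring.
Qed.

End Determinant.

Section Smoothing.
Variables (L : diagram) (i : 'I_(size (crossings L))).

Lemma perm_other_crossings :
  perm_eq (crossings L) (crossing_at i :: other_crossings i).
Proof.
rewrite /other_crossings /crossing_at (tnth_nth (0, 0, 0, 0)%N) /=.
rewrite -{1}(cat_take_drop i (crossings L)) (drop_nth (0, 0, 0, 0)%N) //.
by rewrite -cat1s perm_catCA.
Qed.

Hypothesis wl : well_labelled (diagram_code L).

Lemma smooth_wl : well_labelled (diagram_code (smooth_0 i)) /\
  well_labelled (diagram_code (smooth_infty i)).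
Proof.
have /permP pe := clabels_perm perm_other_crossings; move: pe.
rewrite /smooth_0 /smooth_infty; case: (crossing_at i) => [[[a b] c] d] pe.
by split; apply: well_labelled_perm wl; case: (L) i pe => xs ps j pe;
  rewrite !flatten_diagram !labels_cons; apply/permP => p;
  move: (pe p); rewrite clabels_cons /= !count_cat /=; lia.
Qed.

Lemma bracket_smooth (F : fieldType) (A : F) :
  bracket A L = A * bracket A (smooth_0 i) + A^-1 * bracket A (smooth_infty i).
Proof.
have [w0 w1] := smooth_wl; rewrite !bracketE //.
rewrite (cbracket_perm _ _ perm_other_crossings) /smooth_0 /smooth_infty.
by case: (crossing_at i) => [[[a b] c] d].
Qed.

End Smoothing.

Lemma qa_pair L i s0 s1 : link_diagram L -> det_additive i ->
  coherent (fun F A => bracket A (smooth_0 i)) s0 ->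
  coherent (fun F A => bracket A (smooth_infty i)) s1 ->
  s0 != [::] -> s1 != [::] ->
  exists (b : bool) (m : int) (q : int), forall (F : fieldType) (A : F), A != 0 ->
    bracket A (@smooth_0 L i) = (-1) ^+ b * A ^ m * (A^-1 * lsum A s0) /\
    bracket A (smooth_infty i) = (-1) ^+ b * A ^ m * (A * lsum A (shift q s1)).
Proof.
case=> _ wl _ [m [m0 [m1 [[dm dm0 dm1] [_ _ mE]]]]] c0 c1 n0 n1.
apply: (coherent_pair c0 c1 n0 n1).
by rewrite -bracket_smooth // -(has_det_bracket dm) -(has_det_bracket dm0) -(has_det_bracket dm1).
Qed.

Lemma qa_coherent D : quasi_alternating D ->
  exists2 s, s != [::] & coherent (fun F A => bracket A D) s.
Proof.
elim=> {D} [D iso | D L i iso lL _ [s0 n0 c0] _ [s1 n1 c1] det].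
  exists [:: 0] => //; apply: coherent_equiv (isotopic_bracket iso) _.
  exists false, 0 => F A A0; rewrite bracketE // /lsum big_seq1.
  by rewrite /cbracket /= !mul1r.
have [b [m [q h]]] := qa_pair lL det c0 c1 n0 n1.
exists (s0 ++ shift q s1); first by case: (s0) n0.
apply: coherent_equiv (isotopic_bracket iso) _; exists b, m => F A A0.
have [_ wl _] := lL; rewrite (bracket_smooth i wl) lsum_cat.
by have [-> ->] := h F A A0; field.
Qed.

(* for A^2 + A^-2 = -1 all circles count for 1 *)
Lemma bracket_rec_cubic (F : fieldType) (A : F) xs ps : - A ^+ 2 - A ^- 2 = 1 ->
  bracket_rec A xs ps = (A + A^-1) ^+ size xs.
Proof.
move=> d1; elim: xs ps => [|[[[a b] c] d] xs IH] ps /=; first by rewrite d1 expr1n.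
by rewrite !IH -mulrDl exprS.
Qed.

Lemma coherent_two_terms D s : coherent (fun F A => bracket A D) s ->
  (1 < size s)%N -> exists x y, [/\ x \in s, y \in s & x != y].
Proof.
move=> [b [m h]]; case: s h => // x s h s1.
have [/allP/= eqx | /allPn[y ys xy]] := boolP (all (pred1 x) s); last first.
  by exists x, y; rewrite mem_head inE ys orbT eq_sym.
(* At a primitive cube root of unity A^2 + A^-2 = -1 and A + A^-1 = -1, so the bracket has modulus
   1, whereas equal exponents would add up to the modulus [size s]. *)
have [w wp] := C_prim_root_exists (isT : (0 < 3)%N).
have w3 := prim_expr_order wp.
have w0 : w != 0 by apply/eqP => w0; move/eqP: w3; rewrite w0 expr0n /= eq_sym oner_eq0.
have nw : `|w| = 1 by apply/eqP; rewrite -(@pexpr_eq1 _ _ 3) // -normrX w3 normr1.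
have w1 : w != 1 by rewrite -(prim_order_dvd wp 1).
have w2 : w ^+ 2 + w + 1 = 0.
  have : (w - 1) * (w ^+ 2 + w + 1) == 0.
    have -> : (w - 1) * (w ^+ 2 + w + 1) = w ^+ 3 - 1 by ring.
    by rewrite w3 subrr.
  by rewrite mulf_eq0 subr_eq0 (negbTE w1) => /eqP.
have wV : w^-1 = w ^+ 2 by apply: (mulfI w0); rewrite divff // -exprS w3.
have d1 : - w ^+ 2 - w ^- 2 = 1.
  rewrite -exprVn wV -exprM -[w ^+ (2 * 2)]mul1r.
  have -> : w ^+ (2 * 2) = w by rewrite -[(2 * 2)%N]/(3 + 1)%N exprD w3 mul1r expr1.
  by apply/eqP; rewrite mul1r -opprD eq_sym -subr_eq0 opprK addrC w2.
have lE : lsum w (x :: s) = (size s).+1%:R * (- w ^+ 4) ^ x.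
  rewrite /lsum (eq_big_seq (fun=> (- w ^+ 4) ^ x)).
    by rewrite big_const_seq count_predT iter_addr_0 mulr_natl.
  by move=> j; rewrite inE => /predU1P[->|/eqx/eqP->].
have := h algC w w0; rewrite /bracket bracket_rec_cubic // lE.
move=> /(congr1 (fun z => `|z|)); rewrite normrX wV addrC.
have -> : w ^+ 2 + w = -1 by apply/eqP; rewrite -subr_eq0 opprK w2.
rewrite normrN1 expr1n normrM norm_unit // mul1r normrM normr_nat.
rewrite norm1_exprz ?mulr1; last by rewrite normrN normrX nw expr1n.
by move/eqP; rewrite eq_sym pnatr_eq1; move: s1 => /=; case: (size s).
Qed.

(** * Gaps of the Jones polynomial, supports and parities of exponents *)

Lemma sqrt_t_exp (j : int) : sqrt_t ^ j = laurent_A ^ (- 2 * j).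
Proof. by rewrite /sqrt_t exprz_inv mulNr -mulrN -exprz_exp. Qed.

Lemma no_gap_support (b : bool) (M : int) s : s != [::] ->
  no_gap ((-1) ^+ b * laurent_A ^ M * lsum laurent_A s) ->
  exists lo hi : int, forall x, (x \in s) = (lo <= x <= hi).
Proof.
move=> s0 [n [k [c [c0 e]]]].
pose S1 := [seq ((-1) ^+ b * (-1) ^ j, M + 4 * j) | j <- s] : seq (int * int).
pose S2 := [seq (- c i, - 2 * (n + (i : nat)%:Z * 2)) | i <- index_enum 'I_k.+1].
have ind e' : \sum_(p <- S1 ++ S2 | p.2 == e') p.1 = 0.
  apply: laurent_indep; rewrite big_cat /S1 /S2 !big_map /=.
  have -> : \sum_(j <- s) ((-1) ^+ b * (-1) ^ j)%:~R * laurent_A ^ (M + 4 * j) =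
      (-1) ^+ b * laurent_A ^ M * lsum laurent_A s.
    rewrite lsum_laurent big_map mulr_sumr; apply: eq_bigr => j _ /=.
    by rewrite expfzDr ?laurent_A0 // rmorphM rmorph_sign /=; ring.
  rewrite e -big_split big1 //= => i _.
  by rewrite sqrt_t_exp rmorphN /= [X in _ + X]mulNr subrr.
have cnt x : \sum_(p <- S1 | p.2 == M + 4 * x) p.1 =
    (-1) ^+ b * (-1) ^ x *+ count_mem x s.
  rewrite /S1 big_map /=; elim: (s) => [|j u IH] /=; first by rewrite big_nil.
  rewrite big_cons IH /=; have -> : (M + 4 * j == M + 4 * x) = (j == x) by lia.
  by case: eqP => [->|_]; rewrite ?mulrS.
have key x : (x \in s) = [exists i : 'I_k.+1, M + 4 * x == - 2 * (n + (i : nat)%:Z * 2)].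
  have := ind (M + 4 * x); rewrite big_cat /= cnt => h.
  apply/idP/existsP => [xs | [i /eqP ei]].
    have [//|no] := boolP [exists i : 'I_k.+1, M + 4 * x == - 2 * (n + (i : nat)%:Z * 2)].
      by move/existsP.
    move: h; rewrite /S2 big_map big_pred0 ?addr0 => [/eqP|i]; last first.
      by apply/negP => ei; case/existsP: no; exists i; rewrite eq_sym.
    rewrite mulrn_eq0 mulf_eq0 signr_eq0 expfz_eq0 andbF orbF.
    by move: xs; rewrite -has_pred1 has_count; case: (count _ _).
  apply/negPn/negP => /count_memPn x0; move: h; rewrite x0 mulr0n add0r.
  rewrite /S2 big_map (bigD1 i) /=; last by rewrite -ei.
  rewrite big1 ?addr0 => [/eqP|j /andP[/eqP ej ji]].
    by rewrite oppr_eq0 (negbTE (c0 i)).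
  by case/negP: ji; apply/eqP/val_inj; move: ei ej => /=; lia.
have [x0 x0s] : exists x, x \in s by case: (s) s0 => // x u _; exists x; rewrite mem_head.
move: x0s; rewrite key => /existsP[i0 /eqP e0].
(* Since t = A^-4, the index i corresponds to the exponent x0 + i0 - i; the two ends belong to i = k
   and i = 0. *)
exists (x0 + (i0 : nat)%:Z - k%:Z), (x0 + (i0 : nat)%:Z) => x; rewrite key.
apply/existsP/idP => [[i /eqP ei] | xb]; first by have := ltn_ord i; lia.
have ik : (absz (x0 + (i0 : nat)%:Z - x)%R < k.+1)%N by lia.
by exists (Ordinal ik); apply/eqP => /=; lia.
Qed.

Lemma no_gap_of_support (b : bool) (M lo hi : int) s : lo <= hi ->
  (forall x, (x \in s) = (lo <= x <= hi)) -> ~~ odd (absz M) ->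
  no_gap ((-1) ^+ b * laurent_A ^ M * lsum laurent_A s).
Proof.
move=> lh h Me; pose M2 : int := (M %/ 2)%Z.
have ME : M = M2 * 2.
  by have := divz_eq M 2; have := modz_ge0 M (d := 2) isT; have := ltz_pmod M (d := 2) isT; rewrite /M2; lia.
pose k := absz (hi - lo); pose x (i : 'I_k.+1) := hi - (i : nat)%:Z.
(* The first exponent n solves - 2 (n + 2 i) = M + 4 (hi - i); this requires M even, and the order
   is reversed because t = A^-4. *)
exists (- M2 - 2 * hi), k, (fun i => (-1) ^+ b * (-1) ^ (x i) * (count_mem (x i) s)%:R).
split=> [i|].
  rewrite !mulf_neq0 ?signr_eq0 ?expfz_neq0 // pnatr_eq0 -lt0n -has_count has_pred1 h /x.
  by have := ltn_ord i; rewrite /k; lia.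
rewrite mulr_sumr (eq_big_seq (fun j => \sum_(i < k.+1) if j == x i then
   (-1) ^+ b * laurent_A ^ M * (- laurent_A ^+ 4) ^ j else 0)); last first.
  move=> j; rewrite h => jb; have ik : (absz (hi - j)%R < k.+1)%N by rewrite /k; lia.
  rewrite (bigD1 (Ordinal ik)) //= ifT; last by rewrite /x /=; apply/eqP; lia.
  rewrite big1 ?addr0 // => i ni; case: eqP => // e.
  by case/negP: ni; apply/eqP/val_inj; move: e; rewrite /x /=; lia.
rewrite exchange_big; apply: eq_bigr => i _ /=.
rewrite -big_mkcond (eq_bigr (fun=> (-1) ^+ b * laurent_A ^ M * (- laurent_A ^+ 4) ^ (x i))); last first.
  by move=> j /eqP ->.
rewrite big_const_seq iter_addr_0 -(mulr_natr _ (count _ _)).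
have -> : (- laurent_A ^+ 4) ^ x i = ((-1) ^ x i)%:~R * laurent_A ^ (4 * x i).
  rewrite -[- laurent_A ^+ 4]mulN1r expfzMl -exprz_exp; congr (_ * _).
  by rewrite rmorphXz ?unitrN1 //= rmorphN1.
rewrite sqrt_t_exp !rmorphM rmorph_sign rmorph_nat /=.
have -> : - 2 * (- M2 - 2 * hi + (i : nat)%:Z * 2) = M + 4 * x i.
  by rewrite ME /x; lia.
by rewrite expfzDr ?laurent_A0 //; ring.
Qed.

Lemma odd_sum_sign (I : finType) (P : pred I) (f : I -> int) :
  (forall i, P i -> odd (absz (f i))) ->
  odd (absz (\sum_(i | P i) f i)) = odd #|P|.
Proof.
move=> fo; rewrite -sum1_card.
pose K (u : int) (n : nat) := odd (absz u) = odd n.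
rewrite -[_ = _]/(K (\sum_(i | P i) f i) (\sum_(i in P) 1)%N).
apply: (big_ind2 K) => [// | u n v k uK vK | i Pi].
  by rewrite /K oddD -uK -vK; lia.
by rewrite /K fo.
Qed.

Lemma odd_writhe D (o : orient D) : odd (absz (writhe o)) = odd (size (crossings D)).
Proof.
rewrite /writhe odd_sum_sign => [|d _]; last by case: ifP.
congr odd; rewrite -sum1_card big_mkcond /=.
rewrite (eq_bigr (fun d => if (vtx d < size (crossings D))%N && (pos d == 0%N) then 1%N else 0%N)) //.
rewrite (sum_darts _ (fun i j => if (i < size (crossings D))%N && (j == 0%N) then 1%N else 0%N)).
transitivity (\sum_(i < size (diagram_code D)) if (i < size (crossings D))%N then 1 else 0)%N.
  apply: eq_bigr => i _; case: ifP => iD; last by rewrite big1.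
  have sz : (0 < size (nth [::] (diagram_code D) i))%N.
    rewrite nth_cat size_map iD (nth_map (0, 0, 0, 0)%N) //.
    by case: (nth _ _ _) => [[[]]].
  by rewrite (bigD1 (Ordinal sz)) //= big1 // => j; rewrite -val_eqE /= => /negbTE ->.
rewrite size_cat size_map big_split_ord /= [X in (_ + X)%N]big1 => [|i _].
  by rewrite addn0 (eq_bigr (fun=> 1%N)) ?sum1_card ?card_ord // => i _; rewrite ltn_ord.
by rewrite ifN // -leqNgt leq_addr.
Qed.

Lemma bracket_recN (F : fieldType) (A : F) xs ps :
  bracket_rec (- A) xs ps = (-1) ^+ size xs * bracket_rec A xs ps.
Proof.
elim: xs ps => [|[[[a b] c] d] xs IH] ps /=; first by rewrite !sqrrN mul1r.
by rewrite !IH invrN exprS; ring.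
Qed.

(** Replacing A by - A multiplies the bracket by the sign of the number of crossings and leaves
    [lsum] unchanged. The two signs are compared at zeta, where [lsum] is a nonzero integer. *)
Lemma coherent_parity D (b : bool) (m : int) s : s != [::] ->
  (forall (F : fieldType) (A : F), A != 0 ->
     bracket A D = (-1) ^+ b * A ^ m * lsum A s) ->
  odd (absz m) = odd (size (crossings D)).
Proof.
move=> s0 h; pose z : algC := 4.-root (-1).
have z0 : z != 0 by apply: zeta_neq0.
have := h algC (- z); rewrite oppr_eq0 => /(_ z0).
rewrite /bracket bracket_recN -/(bracket z D) h // exprNz.
have -> : lsum (- z) s = lsum z s by rewrite /lsum exprNn -signr_odd mul1r.
rewrite -signr_odd.
have nz : (-1) ^+ b * z ^ m * lsum z s != 0.
  by rewrite !mulf_neq0 ?signr_eq0 ?expfz_neq0 // lsum_zeta pnatr_eq0 size_eq0.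
rewrite [RHS](_ : _ = (-1) ^+ odd (absz m) * ((-1) ^+ b * z ^ m * lsum z s)); last by ring.
move=> /(mulIf nz)/eqP; rewrite (inj_eq (@signr_inj _)).
by move/eqP.
Qed.

Lemma jones_bracket (F : fieldType) (A : F) D (o : orient D) :
  jones A o = (-1) ^+ odd (absz (writhe o)) * A ^ (- 3 * writhe o) * bracket A D.
Proof.
rewrite /jones exprNz; congr (_ ^+ _ * _ * _).
  by rewrite abszN.
by rewrite -[A ^+ 3]/(A ^ 3) exprz_exp mulrN mulNr.
Qed.

(** * Inserting a tangle *)

Section Expand.
Variables (I : finType) (y : I -> crossing) (F : fieldType) (A : F).

Lemma cbracket_cons_smoothing i xs ps :
  cbracket A (y i :: xs) ps =
  A * cbracket A xs (smoothing true (y i) ++ ps) +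
  A^-1 * cbracket A xs (smoothing false (y i) ++ ps).
Proof.
rewrite /smoothing; case: (y i) => [[[a b] c] d]; rewrite cbracket_cons.
congr (_ + _ * _); rewrite cbracket_swap cbracket_flip cbracket_swap; reflexivity.
Qed.

(** P collects the crossings already smoothed according to C, and R those still to be smoothed. *)
Lemma cbracket_expand (P R : seq I) (C : {set I}) xs ps :
  uniq (P ++ R) -> {in R, forall i, i \notin C} ->
  cbracket A (map y R ++ xs) (smoothings y P C ++ ps) =
  Z A C R (fun S => cbracket A xs (smoothings y (P ++ R) S ++ ps)).
Proof.
elim: R P C => [|i R IH] P C u RC /=; first by rewrite cats0.
have iP : i \notin P.
  by move: u; rewrite cat_uniq => /and3P[_ /hasPn/(_ i (mem_head _ _))].
have ep : perm_eq (P ++ i :: R) ((i :: P) ++ R) by rewrite -cat1s perm_catCA.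
have u' : uniq ((i :: P) ++ R) by rewrite -(perm_uniq ep).
have iR : i \notin R by move: u' => /= /andP[]; rewrite mem_cat negb_or => /andP[].
have iC := RC i (mem_head _ _).
have fin S : cbracket A xs (smoothings y (P ++ i :: R) S ++ ps) =
    cbracket A xs (smoothings y ((i :: P) ++ R) S ++ ps).
  by apply: cbracket_arcs; rewrite perm_cat2r; apply: smoothings_perm.
have Zfin C' : Z A C' R (fun S => cbracket A xs (smoothings y (P ++ i :: R) S ++ ps)) =
    Z A C' R (fun S => cbracket A xs (smoothings y ((i :: P) ++ R) S ++ ps)).
  by apply: Z_ext => S _ _.
rewrite !Zfin -!IH //.
- rewrite cbracket_cons_smoothing !smoothings_cons setU11 (negbTE iC) -!catA.
  congr (_ * cbracket A _ (_ ++ (_ ++ _)) + _); apply: eq_smoothings => j jP.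
  by rewrite in_setU1; case: eqP => // ji; rewrite -ji jP in iP.
- by move=> j jR; apply: RC; rewrite inE jR orbT.
- move=> j jR; rewrite in_setU1 negb_or RC ?inE ?jR ?orbT // andbT.
  by apply: contraNneq iR => <-.
Qed.

End Expand.

Lemma cc_glue x y u v ps : x \notin [:: u; v] -> y \notin [:: u; v] ->
  x \notin labels ps -> y \notin labels ps ->
  cc [:: (x, y), (u, y), (v, x) & ps] = cc ((u, v) :: ps).
Proof.
rewrite !inE !negb_or => /andP[xu xv] /andP[yu yv] xN yN.
have rot3 p q r : cc [:: p, q, r & ps] = cc [:: r, p, q & ps].
  by apply: cc_eq_mem => z; rewrite !inE; do 3!case: (z == _).
have [<-|xy] := eqVneq x y.
  rewrite cc_dup ?conn_refl ?labels_cons ?inE ?eqxx ?orbT //.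
  rewrite -(@cc_elim x u v) // [RHS](@cc_eq_mem _ [:: (x, v), (u, x) & ps]) => [|p]; last first.
    by rewrite !inE orbCA.
  by rewrite [RHS]cc_flip; apply: cc_eq_mem => p; rewrite !inE orbCA.
rewrite -(@cc_elim x u v) // -(@cc_elim y u x) 1?eq_sym //.
- by rewrite cc_flip rot3 cc_flip rot3 rot3; apply: cc_eq_mem => p;
    rewrite !inE; do 3!case: (p == _).
- by rewrite eq_sym.
- by rewrite labels_cons !inE !negb_or yv yN eq_sym xy.
Qed.

(** The labels q0, ..., q3 are the endpoints of the tangle. Its two strands join them in pairs,
    which leaves a smoothing of the replaced crossing. *)
Lemma cc_glue2 a b c d q0 q1 q2 q3 ps :
  all (fun q => q \notin [:: a; b; c; d] ++ labels ps) [:: q0; q1; q2; q3] ->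
  [&& q0 != q2, q0 != q3, q1 != q2 & q1 != q3] ->
  cc [:: (q1, q0), (q3, q2), (a, q0), (b, q1), (c, q2), (d, q3) & ps] =
  cc [:: (a, b), (c, d) & ps].
Proof.
move=> /allP fr /and4P[n02 n03 n12 n13].
have {}fr q : q \in [:: q0; q1; q2; q3] ->
    [&& q != a, q != b, q != c, q != d & q \notin labels ps].
  by move=> /fr; rewrite mem_cat !inE !negb_or -!andbA.
have /and5P[a0 b0 c0 d0 f0] : [&& q0 != a, q0 != b, q0 != c, q0 != d & q0 \notin labels ps].
  by apply: fr; rewrite !inE eqxx.
have /and5P[a1 b1 c1 d1 f1] : [&& q1 != a, q1 != b, q1 != c, q1 != d & q1 \notin labels ps].
  by apply: fr; rewrite !inE eqxx ?orbT.
have /and5P[a2 b2 c2 d2 f2] : [&& q2 != a, q2 != b, q2 != c, q2 != d & q2 \notin labels ps].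
  by apply: fr; rewrite !inE eqxx ?orbT.
have /and5P[a3 b3 c3 d3 f3] : [&& q3 != a, q3 != b, q3 != c, q3 != d & q3 \notin labels ps].
  by apply: fr; rewrite !inE eqxx ?orbT.
rewrite (@cc_eq_mem _ [:: (q1, q0), (a, q0), (b, q1), (q3, q2), (c, q2), (d, q3) & ps]); last first.
  by move=> p; rewrite !inE; do 6!case: (p == _).
rewrite cc_glue ?labels_cons ?inE ?negb_or ?a0 ?b0 ?a1 ?b1 ?c0 ?c1 ?d0 ?d1 ?f0 ?f1 ?n02 ?n03 ?n12 ?n13 //.
rewrite (@cc_eq_mem _ [:: (q3, q2), (c, q2), (d, q3), (a, b) & ps]); last first.
  by move=> p; rewrite !inE; do 4!case: (p == _).
rewrite cc_glue ?labels_cons ?inE ?negb_or ?a2 ?b2 ?c2 ?d2 ?a3 ?b3 ?c3 ?d3 ?f2 ?f3 //.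
by apply: cc_eq_mem => p; rewrite !inE orbCA.
Qed.

Section Insertion.
Variables (I : finType) (y : I -> crossing) (e : I).
Hypothesis uniq_ins : uniq (ins y (enum I)).
Hypothesis ins_outs : perm_eq (ins y (enum I)) (outs y (enum I)).
Variables (F : fieldType) (A : F) (xs : seq crossing) (ps : seq (nat * nat)).
Variables a b c d : nat.
Hypothesis fresh : forall x, x \in ins y (enum I) ->
  x \notin [:: a; b; c; d] ++ labels ps ++ clabels xs.

(** By [circles_nf] the tangle smoothed according to S consists of k circles and two strands, and
    [sp] tells which smoothing of the replaced crossing the strands form. The exponents
    [(circles y S).-1] and [(circles y S).-2] both equal k. *)
Lemma cbracket_insert :
  cbracket A (map y (rem e (enum I)) ++ xs)
    [:: (a, arm1 (y e)), (b, arm0 (y e)), (c, arm3 (y e)), (d, arm2 (y e)) & ps] =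
  Z A set0 (rem e (enum I)) (fun S =>
    if sp (circles y) S e
    then delta A ^+ (circles y S).-1 * cbracket A xs [:: (a, b), (c, d) & ps]
    else delta A ^+ (circles y S).-2 * cbracket A xs [:: (a, d), (b, c) & ps]).
Proof.
set conn4 := (X in cbracket A _ X).
have := @cbracket_expand _ y _ A [::] (rem e (enum I)) set0 xs conn4.
rewrite /= rem_uniq ?enum_uniq // => -> //; last by move=> j; rewrite inE.
apply: Z_ext => S _; rewrite set0U => SR.
have eS : e \notin S.
  apply: contraTN SR => eS; apply/subsetPn; exists e => //.
  by rewrite inE mem_rem_uniq ?enum_uniq // !inE eqxx.
have [k [up [lSe lS ne nf]]] := circles_nf uniq_ins ins_outs eS.
have [n02 n13] := uniq_arms uniq_ins ins_outs e.
have frarm q : q \in [:: arm0 (y e); arm1 (y e); arm2 (y e); arm3 (y e)] ->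
    q \notin [:: a; b; c; d] ++ labels ps ++ clabels xs.
  by move=> qe; apply/fresh/(arms_ins ins_outs qe).
have cw ws : labels ws =i clabels xs ->
    cc (ws ++ smoothings y (rem e (enum I)) S ++ conn4) =
    (k + cc (smoothing up (y e) ++ conn4 ++ ws))%N.
  move=> wsl; rewrite -nf.
  - by apply: cc_eq_mem => p; rewrite !mem_cat orbCA [RHS]orbA orbC -orbA; do 3!case: (_ \in _).
  - move=> x; rewrite labels_cat mem_cat /conn4 !labels_cons !inE.
    by do 4!case: (x == _); rewrite ?orbT.
  move=> x xi xe; rewrite labels_cat mem_cat wsl.
  have xI : x \in ins y (enum I).
    rewrite -(labels_smoothings ins_outs S).
    rewrite (perm_mem (labels_perm (smoothings_perm y S (perm_enum_rem e)))).
    by rewrite smoothings_cons labels_cat mem_cat xi orbT.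
  have := fresh xI; move: xe; rewrite /conn4 !labels_cons !(inE, mem_cat) !negb_or.
  by do 8!case: (x == _) => //=; case: (_ \in _).
have fr4 ws : labels ws =i clabels xs ->
  all (fun q => q \notin [:: a; b; c; d] ++ labels (ps ++ ws))
    [:: arm1 (y e); arm0 (y e); arm3 (y e); arm2 (y e)].
  move=> wsl; apply/allP => q qe; have := frarm q; rewrite labels_cat !mem_cat wsl.
  by apply; move: qe; rewrite !inE; do 4!case: (q == _).
rewrite /sp lSe lS; case: up lSe lS ne nf cw => lSe lS /andP[ne1 ne2] nf cw.
  rewrite addn2 addn1 eqxx /=; apply: cbracket_scale => // ws wsl.
  rewrite cw // /smoothing /conn4; congr addn.
  rewrite /= (@cc_glue2 a b c d (arm1 (y e)) (arm0 (y e)) (arm3 (y e)) (arm2 (y e))) ?fr4 //.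
    by apply: cc_eq_mem => p; rewrite !(inE, mem_cat); do 2!case: (p == _); rewrite /= ?orbT // orbC.
  by rewrite n13 (eq_sym _ (arm2 _)) ne2 ne1 n02.
rewrite /= addn1 addn2 eqSS ltn_eqF // /=; apply: cbracket_scale => // ws wsl.
rewrite cw // /smoothing /conn4; congr addn.
transitivity (cc [:: (a, d), (c, b) & ps ++ ws]).
  rewrite -(@cc_glue2 a d c b (arm1 (y e)) (arm2 (y e)) (arm3 (y e)) (arm0 (y e))).
  - by apply: cc_eq_mem => p; rewrite !inE; do 6!case: (p == _).
  - apply/allP => q qe; have /allP/(_ q) := fr4 _ wsl.
    have -> : q \in [:: arm1 (y e); arm0 (y e); arm3 (y e); arm2 (y e)].
      by move: qe; rewrite !inE; do 4!case: (q == _).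
    by move/(_ isT); rewrite !(inE, mem_cat) !negb_or; do 4!case: (q == _).
  - by rewrite n13 eq_sym ne1 ne2 eq_sym n02.
rewrite (@cc_eq_mem _ [:: (c, b), (a, d) & ps ++ ws]) => [|p]; last by rewrite !inE orbCA.
rewrite cc_flip; apply: cc_eq_mem => p.
by rewrite !(inE, mem_cat); do 2!case: (p == _); rewrite /= ?orbT // orbC.
Qed.
End Insertion.

Section Relabel.
Variables (f : nat -> nat) (I : finType) (y : I -> crossing).
Let fy i := relabel_crossing f (y i).

Lemma smoothings_relabel P S : smoothings fy P S = map_arcs f (smoothings y P S).
Proof.
elim: P => // i P IH; rewrite !smoothings_cons IH /map_arcs map_cat; congr cat.
by rewrite /fy /smoothing; case: (y i) => [[[a b] c] d]; case: (i \in S).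
Qed.

Lemma ins_relabel P : ins fy P = map f (ins y P).
Proof.
elim: P => // i P; rewrite /ins /= => ->; rewrite /fy.
by case: (y i) => [[[a b] c] d].
Qed.

Lemma outs_relabel P : outs fy P = map f (outs y P).
Proof.
elim: P => // i P; rewrite /outs /= => ->; rewrite /fy.
by case: (y i) => [[[a b] c] d].
Qed.

Lemma circles_relabel S : injective f -> circles fy S = circles y S.
Proof. by move=> inj; rewrite /circles smoothings_relabel cc_map. Qed.

End Relabel.

Lemma flatten_relabel f xs :
  flatten (map crossing_seq (map (relabel_crossing f) xs)) = map f (flatten (map crossing_seq xs)).
Proof. exact: clabels_relabel. Qed.

(** * Bracket of the link with the tangle inserted *)

Section Replacement.
Variables (L : diagram) (c : 'I_(size (crossings L))) (T : tangle).
Let odds (l : nat) := l.*2.+1.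

Lemma odds_inj : injective odds.
Proof. by move=> m n [] /double_inj. Qed.

Lemma perm_flatten_replace :
  perm_eq (flatten (diagram_code (replace_crossing c T)))
    (map double (flatten (diagram_code L)) ++ map odds (flatten (capped T))).
Proof.
have pc := perm_flatten (perm_map crossing_seq (perm_other_crossings c)).
apply/permP => q; rewrite /diagram_code !flatten_cat !map_cat !count_cat.
rewrite (permP (perm_map double pc)) /replace_crossing /capped.
case: (crossing_at c) => [[[a b] c'] d]; case: (ends T) => [[[e0 e1] e2] e3] /=.
rewrite -!/(labels _) -cats1 map_cat !flatten_cat !flatten_relabel !map_cat !count_cat.
rewrite labels_map /= /odds; clear.
move: (count _ _) (count _ _) (count _ _) (q a.*2) (q b.*2) (q c'.*2) (q d.*2).
by move: (q e0.*2.+1) (q e1.*2.+1) (q e2.*2.+1) (q e3.*2.+1) => *; lia.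
Qed.

Lemma replace_wl : well_labelled (diagram_code L) -> well_labelled (capped T) ->
  well_labelled (diagram_code (replace_crossing c T)).
Proof.
move=> /allP wL /allP wT; apply/allP => l.
rewrite (perm_mem perm_flatten_replace) (permP perm_flatten_replace) count_cat.
have ev (s : seq nat) m : count_mem m.*2 (map odds s) = 0%N.
  by apply/count_memPn/mapP => -[k _ /(congr1 odd)]; rewrite /odds /= !odd_double.
have od (s : seq nat) m : count_mem (odds m) (map double s) = 0%N.
  by apply/count_memPn/mapP => -[k _ /(congr1 odd)]; rewrite /odds /= !odd_double.
have inj f (s : seq nat) m : injective f -> count_mem (f m) (map f s) = count_mem m s.
  by move=> fi; rewrite count_map; apply: eq_count => k /=; rewrite (inj_eq fi).
rewrite mem_cat => /orP[] /mapP[m ms ->].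
  by rewrite ev addn0 inj ?wL //; apply: double_inj.
by rewrite od add0n inj ?wT //; apply: odds_inj.
Qed.

Variable kappa : dart (capped T) -> bool.
Hypothesis wlL : well_labelled (diagram_code L).
Hypothesis wlT : well_labelled (capped T).
Hypothesis chk : checkerboard kappa.
Hypothesis kappaE :
  forall d, kappa d = odd (pos d) (+) (vtx d == size (tcrossings T)).

Lemma bracket_replace (F : fieldType) (A : F) :
  bracket A (replace_crossing c T) =
  Z A set0 (rem ord_max (enum 'I_(size (tcrossings T)).+1)) (fun S =>
    let l := circles (@tvertex T) in
    if sp l S ord_max then delta A ^+ (l S).-1 * bracket A (smooth_0 c)
    else delta A ^+ (l S).-2 * bracket A (smooth_infty c)).
Proof.
have [wl0 wl1] := smooth_wl c wlL.
rewrite (bracketE _ (replace_wl wlL wlT)) !(bracketE _ wl0, bracketE _ wl1).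
have uT := uniq_ins_tangle wlT chk kappaE; have ioT := ins_outs_tangle wlT chk kappaE.
pose y i := relabel_crossing odds (@tvertex T i).
have uy : uniq (ins y (enum 'I_(size (tcrossings T)).+1)).
  by rewrite ins_relabel map_inj_uniq //; apply: odds_inj.
have ioy : perm_eq (ins y (enum 'I_(size (tcrossings T)).+1))
    (outs y (enum 'I_(size (tcrossings T)).+1)).
  by rewrite ins_relabel outs_relabel; apply: perm_map.
have xT : perm_eq (map y (rem ord_max (enum 'I_(size (tcrossings T)).+1)))
    (map (relabel_crossing odds) (tcrossings T)).
  rewrite -(perm_cons (y ord_max)).
  apply: (@perm_trans _ (map y (enum 'I_(size (tcrossings T)).+1))).
    by rewrite perm_sym; apply: (perm_map y (perm_enum_rem ord_max)).
  have -> : map y (enum 'I_(size (tcrossings T)).+1) =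
      rcons (map (relabel_crossing odds) (tcrossings T)) (y ord_max).
    rewrite (map_comp (fun j => relabel_crossing odds (nth (outer T) (tcrossings T) j)) val).
    rewrite val_enum_ord -addn1 iotaD map_cat add0n cats1; congr rcons.
    by rewrite (map_comp (relabel_crossing odds) (nth _ _)) map_nth_iota0 // take_size.
  by rewrite perm_rcons.
rewrite /replace_crossing /smooth_0 /smooth_infty; case: (crossing_at c) => [[[a b] c'] d].
case E: (ends T) => [[[e0 e1] e2] e3] /=.
rewrite (@cbracket_perm _ A _ (map y (rem ord_max (enum 'I_(size (tcrossings T)).+1)) ++
   map (relabel_crossing double) (other_crossings c))); last first.
  by rewrite perm_catC perm_cat2r perm_sym.
have y_end : y ord_max = (odds e1, odds e0, odds e3, odds e2).
  by rewrite /y /tvertex /= nth_default // /outer E.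
have := @cbracket_insert _ y ord_max uy ioy F A
  (map (relabel_crossing double) (other_crossings c)) (map_arcs double (arcs L))
  a.*2 b.*2 c'.*2 d.*2.
rewrite y_end => -> //.
  apply: Z_ext => S _ _; rewrite /sp !circles_relabel; try exact: odds_inj.
  by case: ifP => _; congr (_ * _);
    [rewrite -(@cbracket_relabel _ A double _ ((a, b) :: (c', d) :: arcs L))
    | rewrite -(@cbracket_relabel _ A double _ ((a, d) :: (b, c') :: arcs L))] => //;
    apply: double_inj.
(* Labels of T have become odd and those of L even, so they never meet. *)
move=> x; rewrite ins_relabel => /mapP[m _ ->]; apply/negP => h.
suff /mapP[k _ /(congr1 odd)] : odds m \in map double ([:: a; b; c'; d] ++
    labels (arcs L) ++ clabels (other_crossings c)) by rewrite /odds /= !odd_double.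
by move: h; rewrite labels_map clabels_relabel !map_cat.
Qed.

End Replacement.

Lemma top_rem (I : finType) (e : I) : top set0 (rem e (enum I)) = [set~ e].
Proof.
apply/setP => x; rewrite /top set0U !inE mem_rem_uniq ?enum_uniq // inE.
by rewrite mem_enum andbT.
Qed.

(** The outside of the tangle is the edge [ord_max]: connectedness makes it neither a loop nor a
    bridge, and planarity gives Euler's formula. *)
Lemma states_good T (kappa : dart (capped T) -> bool) (s0 s1 : seq int) :
  tangle_diagram T -> tangle_connected T -> checkerboard kappa ->
  (forall d, kappa d = odd (pos d) (+) (vtx d == size (tcrossings T))) ->
  s0 != [::] -> s1 != [::] -> good (s0 ++ s1) ->
  let l := circles (@tvertex T) in
  let R := rem ord_max (enum 'I_(size (tcrossings T)).+1) in
  exists2 s, good s &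
    rep (fun F A => Z A set0 R (pfin l ord_max s0 s1 A)) (expo (l set0) (size R) - 3) s.
Proof.
move=> /andP[wlT plT] conT chk kappaE n0 n1 gs l R.
have uT := uniq_ins_tangle wlT chk kappaE; have ioT := ins_outs_tangle wlT chk kappaE.
have pc := planar_circles_tangle wlT chk kappaE plT.
have con ps : (forall i : 'I_(size (tcrossings T)).+1, i != ord_max ->
     [/\ conn ps (arm0 (tvertex i)) (arm1 (tvertex i)),
         conn ps (arm0 (tvertex i)) (arm2 (tvertex i))
       & conn ps (arm0 (tvertex i)) (arm3 (tvertex i))]) ->
    {in ins (@tvertex T) (enum 'I_(size (tcrossings T)).+1) &, forall u v, conn ps u v}.
  move=> h u v; rewrite !(ins_flatten wlT chk kappaE); apply: tangle_conn => // x xT.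
  have xs : (index x (tcrossings T) < (size (tcrossings T)).+1)%N by rewrite ltnS index_size.
  have := h (Ordinal xs); rewrite /tvertex /= nth_index //; apply.
  by rewrite -val_eqE /= ltn_eqF // index_mem.
have uR : uniq (ord_max :: R) by rewrite -(perm_uniq (perm_enum_rem _)) enum_uniq.
apply: (@all_pfin_good _ l _ _ _ (size R).+1) => //.
- by move=> S; apply: circles_gt0 ioT _ ord_max.
- by move=> S e eS; case: (circles_step uT ioT eS) => [[]|]; [left|right].
- by move=> S S' e SS eS; apply: circles_mono uT ioT pc _ _ _ SS eS.
- split=> //; first by apply/allP => x _; rewrite inE.
  have -> : ord_max |: top set0 R = setT by rewrite top_rem setUCr.
  by rewrite (circles_planar ioT pc con) cardT (perm_size (perm_enum_rem ord_max)) addn2.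
- by rewrite /sp setU0 (circles_not_loop uT ioT pc con).
- by rewrite top_rem /sp (circles_not_bridge uT ioT pc con).
Qed.

Lemma jones_lsum D (o : orient D) (b : bool) (m : int) s (F : fieldType) (A : F) :
  A != 0 -> bracket A D = (-1) ^+ b * A ^ m * lsum A s ->
  jones A o = (-1) ^+ (odd (absz (writhe o)) (+) b) * A ^ (- 3 * writhe o + m) * lsum A s.
Proof.
by move=> A0 e; rewrite jones_bracket e signr_addb expfzDr // !mulrA (mulrAC _ (A ^ _) (_ ^+ b)).
Qed.

Theorem theorem4p1 (L : diagram) (c : 'I_(size (crossings L))) (T : tangle)
    (L_link : link_diagram L)
    (L_qa : quasi_alternating_at c)
    (T_tangle : tangle_diagram T)
    (T_reduced : tangle_reduced T)
    (T_alternating : tangle_alternating T)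
    (T_connected : tangle_connected T)
    (T_type : same_type c T)
    (o : orient L) (o_ok : orientation o)
    (o' : orient (replace_crossing c T)) (o'_ok : orientation o')
    (L_no_gap : no_gap (jones_polynomial o)) :
  no_gap (jones_polynomial o').
Proof.
case: L_qa => qa0 qa1 det.
have [s0 n0 c0] := qa_coherent qa0; have [s1 n1 c1] := qa_coherent qa1.
have [b [m [q h]]] := qa_pair L_link det c0 c1 n0 n1.
have [_ wlL _] := L_link; have [wlT _] := andP T_tangle.
have [kappa chk kappaE] := same_type_colouring T_type.
have n1' : shift q s1 != [::] by case: (s1) n1.
have bL (F : fieldType) (A : F) : A != 0 ->
    bracket A L = (-1) ^+ b * A ^ m * lsum A (s0 ++ shift q s1).
  move=> A0; rewrite (bracket_smooth c wlL) lsum_cat.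
  by have [-> ->] := h F A A0; field.
have nn : s0 ++ shift q s1 != [::] by case: (s0) n0.
have gs : good (s0 ++ shift q s1).
  have [x [y [xs ys xy]]] : exists x y,
      [/\ x \in s0 ++ shift q s1, y \in s0 ++ shift q s1 & x != y].
    apply: (@coherent_two_terms L); first by exists b, m => F A A0; apply: bL.
    (* Both smoothings contribute at least one term, so there are at least two. *)
    by case: (s0) n0 (shift q s1) n1' => // a s _ [|a' s'] // _; rewrite size_cat /= addnS.
  have [|lo [hi hs]] := @no_gap_support (odd (absz (writhe o)) (+) b)
      (- 3 * writhe o + m) (s0 ++ shift q s1) nn.
    by rewrite -(jones_lsum _ laurent_A0 (bL _ _ laurent_A0)).
  exists lo, hi; split=> //; move: xs ys; rewrite !hs => /andP[x1 x2] /andP[y1 y2].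
  rewrite lt_neqAle (le_trans x1 x2) andbT; apply: contraNneq xy => e.
  by rewrite eq_le; move: x1 x2 y1 y2; rewrite e => *; apply/andP; split; lia.
have [s [lo [hi [lh hs]]] sE] := states_good T_tangle T_connected chk kappaE n0 n1' gs.
set N := (_ - 3) in sE.
have bR (F : fieldType) (A : F) : A != 0 ->
    bracket A (replace_crossing c T) = (-1) ^+ b * A ^ (m + N) * lsum A s.
  (* The unit common to both smoothings of c is taken out of the state sum; what remains are the
     weights of [pfin]. *)
  move=> A0; rewrite expfzDr // -!mulrA -sE // mulrA -Z_mul (bracket_replace _ wlL wlT chk kappaE).
  apply: Z_ext => S _ _ /=; have [-> ->] := h F A A0.
  by rewrite /pfin; case: ifP => _; rewrite mulrCA.
have sn : s != [::].
  by apply/eqP => s_nil; have := hs lo; rewrite s_nil lexx (ltW lh).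
have par := coherent_parity sn bR.
rewrite /jones_polynomial (jones_lsum _ laurent_A0 (bR _ _ laurent_A0)).
apply: no_gap_of_support (ltW lh) hs _.
(* The writhe and m + N both have the parity of the number of crossings, so the exponent of A in
   front is even. *)
by move: par (odd_writhe o'); clear; move: (writhe o') (m + N) (size _) => *; lia.
Qed.
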